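(* Let $n\ge 1$, let $\mathcal N=[N_1,\dots,N_n]$ be a vector of nonnegative integers with $N=\sum_i N_i\ge 1$, and let $\{\kappa_{l,j}\}_{1\le l\le n,\ j\in\Lambda_l}$ be complex constants, not all zero, such that all roots of the GMAM polynomial $W_{\mathcal N}(z)$ with these parameters are simple. For $A>0$ let $\mathbf q^{\mathcal N}(x,t)=[q_1^{\mathcal N},\dots,q_n^{\mathcal N}]^T$ be the $\mathcal N$-order vector rogue wave solution with internal parameters $d_{l,j}=\kappa_{l,j}A^j$ for $1\le l\le n$, $j\in\Lambda_l$ (and $d_{l,(n+1)j}=0$ for all $j\geq 1$). For each of the $\Gamma$ roots $\bar z_0$ of $W_{\mathcal N}$ let $(\bar x_0,\bar t_0)\in\mathbb R^2$ be defined by $$\mathrm i\,\chi^{[1]}(\bar x_0+\chi_0\bar t_0)=\bar z_0A-\Delta(\bar z_0),$$ where $\Delta(\bar z_0)$ is the constant (independent of $A$) defined in the context. Then, as $A\to\infty$, the pattern of $q_k^{\mathcal N}$ splits into $\Gamma$ first-order rogue waves $\hat q_k^{[1]}(x-\bar x_0,t-\bar t_0)\,q_k^{[0]}(x,t)$, one for each root $\bar z_0$, in the following sense. (i) For each root $\bar z_0$, when $\sqrt{(x-\bar x_0)^2+(t-\bar t_0)^2}=O(1)$ (that is, uniformly on $\sqrt{(x-\bar x_0)^2+(t-\bar t_0)^2}\le R$ for every fixed $R>0$), $$q_k^{\mathcal N}(x,t)=\hat q_k^{[1]}(x-\bar x_0,t-\bar t_0)\,q_k^{[0]}(x,t)+O(A^{-1}),\qquad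 A\to\infty,\quad 1\le k\le n.$$ (ii) As $A\to\infty$ with $(x,t)$ far from all the points $(\bar x_0,\bar t_0)$ (that is, with the distance from $(x,t)$ to the set of all the points $(\bar x_0,\bar t_0)$ tending to infinity), $\mathbf q^{\mathcal N}(x,t)$ approaches the plane wave background: $\mathbf q^{\mathcal N}(x,t)-\mathbf q^{[0]}(x,t)\to \mathbf 0$.
   Context: **Equation and background.** The $n$-component nonlinear Schrödinger equation is $\mathrm i\mathbf q_t+\frac12\mathbf q_{xx}+\|\mathbf q\|_2^2\mathbf q=\mathbf 0$, $\mathbf q=[q_1(x,t),\dots,q_n(x,t)]^T$ complex valued. Fix $\lambda_0\in\mathbb C$ with $\Im\lambda_0\neq0$ and for $1\le k\le n$ put $a_k=\frac{2\Im\lambda_0}{n+1}\csc\frac{k\pi}{n+1}$, $b_k=\frac{2\Im\lambda_0}{n+1}\cot\frac{k\pi}{n+1}-2\Re\lambda_0$, $\mathbf a=(a_1,\dots,a_n)$, $q_k^{[0]}(x,t)=a_ke^{\mathrm i\theta_k}$, $\theta_k=b_kx+(-\frac{b_k^2}{2}+\|\mathbf a\|_2^2)t$, $\mathbf q^{[0]}=[q_1^{[0]},\dots,q_n^{[0]}]^T$. Put $\chi_0=2\Re\lambda_0+\mathrm i\frac{2\Im\lambda_0}{n+1}$; it is an $(n+1)$-fold root $\chi$ of the characteristic equation $\left(\chi-2\lambda-\sum_{i=1}^n\frac{a_i^2}{\chi+b_i}\right)\prod_{j=1}^n(\chi+b_j)=0$ at $\lambda=\lambda_0$. Fix $\lambda^{[1]}\in\mathbb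 C\setminus\{0\}$ and let $\lambda(\varepsilon)=\lambda_0+\lambda^{[1]}\varepsilon^{n+1}$, $\chi(\varepsilon)=\chi_0+\sum_{i\ge1}\chi^{[i]}\varepsilon^i$ be a power series such that $(\lambda(\varepsilon),\chi(\varepsilon))$ satisfies the characteristic equation. **Expansions.** $\alpha_j,\beta_j,h_{1,j},h_{2,j}^{[k]}$ are defined by $\mathrm i(\chi(\varepsilon)-\lambda(\varepsilon))=\sum_{j\ge0}\alpha_j\varepsilon^j$, $\ \frac{\chi(\varepsilon)^2}{2}-\lambda(\varepsilon)^2-\|\mathbf a\|_2^2=\sum_{j\ge0}\beta_j\varepsilon^j$, $\ \ln\left(\frac{\chi_0-\chi_0^*}{\chi^{[1]}\varepsilon}\cdot\frac{\chi(\varepsilon)-\chi_0}{\chi(\varepsilon)-\chi_0^*}\right)=\sum_{j\ge1}h_{1,j}\varepsilon^j$, $\ \ln\frac{\chi(\varepsilon)+b_k}{\chi_0+b_k}=\sum_{j\ge1}h^{[k]}_{2,j}\varepsilon^j$. Here $^*$ is complex conjugation. Put $\mathbf h_1=(h_{1,1},h_{1,2},\dots)$, $\mathbf h_2^{[k]}=(h_{2,1}^{[k]},h_{2,2}^{[k]},\dots)$. Given complex parameters $d_{l,j}$ ($1\le l\le n$, $j\ge1$), put $x_j^{[l,+]}=\alpha_jx+\beta_j\mathrm it+d_{l,j}$, $x_j^{[l,-]}=(x_j^{[l,+]})^*$, $\mathbf x^{[l,\pm]}=(x_1^{[l,\pm]},x_2^{[l,\pm]},\dots)$. Schur polynomials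 $S_j(\mathbf z)$, $\mathbf z=(z_1,z_2,\dots)$, are defined by $\sum_{j\ge0}S_j(\mathbf z)\varepsilon^j=\exp(\sum_{j\ge1}z_j\varepsilon^j)$. **Rogue wave solution.** $q_k^{\mathcal N}(x,t)=q_k^{[0]}(x,t)\dfrac{\det\mathbf M^{[k]}}{\det\mathbf M^{[0]}}$, $1\le k\le n$, where for $0\le s\le n$, $\mathbf M^{[s]}=(M^{[s;l_1,l_2]})_{1\le l_1,l_2\le n}$ is the $N\times N$ block matrix with blocks $M^{[s;l_1,l_2]}=\left(\tau^{[s;l_1,l_2]}_{(n+1)(i-1)+l_1,(n+1)(j-1)+l_2}\right)_{1\le i\le N_{l_1},1\le j\le N_{l_2}}$ (blocks with $N_{l}=0$ are absent), $\tau^{[0;l_1,l_2]}_{i,j}=\sum_{v=0}^{\min(i,j)}C_1^vS_{i-v}(\mathbf x^{[l_1,-]}+v\mathbf h_1^* )S_{j-v}(\mathbf x^{[l_2,+]}+v\mathbf h_1)$, $\tau^{[k;l_1,l_2]}_{i,j}=\sum_{v=0}^{\min(i,j)}C_1^vS_{i-v}(\mathbf x^{[l_1,-]}+v\mathbf h_1^*+(\mathbf h_2^{[k]})^* )S_{j-v}(\mathbf x^{[l_2,+]}+v\mathbf h_1-\mathbf h_2^{[k]})$ for $1\le k\le n$, with $C_1=\frac{|\chi^{[1]}|^2}{|\chi_0-\chi_0^*|^2}$. Only the $d_{l,j}$ with $j\le(n+1)(N_l-1)+l$ enter. Let $\Lambda_l=\{i:\ 1\le i\le(n+1)(N_l-1)+l,\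 (n+1)\nmid i\}$. **First-order rogue wave.** $$\hat q_k^{[1]}(x,t)=1+\frac{2\mathrm i}{|\chi_0+b_k|^2}\cdot\frac{(\Re\chi_0+b_k)(x+\Re(\chi_0)t)-(\Im\chi_0)^2t+\frac{\mathrm i}{2}}{(x+\Re(\chi_0)t)^2+(\Im\chi_0)^2t^2+\frac1{4(\Im\chi_0)^2}}.$$ **GMAM polynomials.** For complex $\kappa_{l,i}$, define $\varphi_{l,j}(z)$ by $\sum_{j\ge0}\varphi_{l,j}(z)\varepsilon^j=\exp\left(z\varepsilon+\sum_{i\ge1,\,(n+1)\nmid i}\kappa_{l,i}\varepsilon^i\right)$, $1\le l\le n$, and $\varphi_{l,j}=0$ for $j<0$. The generalized mixed Adler–Moser (GMAM) polynomial is $$W_{\mathcal N}(z)=c_{\mathcal N}\,\mathcal W\left(\{\varphi_{1,(n+1)(j-1)+1}\}_{j=1}^{N_1},\{\varphi_{2,(n+1)(j-1)+2}\}_{j=1}^{N_2},\dots,\{\varphi_{n,(n+1)(j-1)+n}\}_{j=1}^{N_n}\right),$$ $\mathcal W$ being the Wronskian determinant in $z$ of the $N$ listed functions and $c_{\mathcal N}$ the real constant making $W_{\mathcal N}$ monic. It depends only on $\kappa_{l,i}$ with $i\in\Lambda_l$, and its degree is $\Gamma=\sum_{l=1}^n\frac{N_l}{2}(n(N_l-1)+2l)-\sum_{1\le l<k\le n}N_lN_k$. **The constant $\Delta(\bar z_0)$.** For a simple root $\bar z_0$ let $(\hat x_0,\hat t_0)\in\mathbb R^2$ be the unique solution of $\mathrm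 i\chi^{[1]}(\hat x_0+\chi_0\hat t_0)=\bar z_0$ and set $\Delta(\bar z_0)=(\alpha_2\hat x_0+\beta_2\mathrm i\hat t_0)\dfrac{W^{[2]}_{\mathcal N}(\bar z_0)}{W_{\mathcal N}'(\bar z_0)}$, where $$W^{[2]}_{\mathcal N}(\bar z_0)=c_{\mathcal N}\left[\det_{1\le i,j\le N}\left(\varphi_{l_j,(n+1)p_j+l_j-\bar p_i}(\bar z_0)\right)+\det_{1\le i,j\le N}\left(\varphi_{l_j,(n+1)p_j+l_j-\hat p_i}(\bar z_0)\right)\right],$$ with $l_j=l$ and $p_j=j-1-\sum_{k<l}N_k$ when $\sum_{k<l}N_k<j\le\sum_{k\le l}N_k$; $\bar p_i=N$ if $i=N-1$ and $\bar p_i=i-1$ otherwise; $\hat p_i=N+1$ if $i=N$ and $\hat p_i=i-1$ otherwise. *)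

(* Defs.v *)
From HB Require Import structures.
From mathcomp Require Import all_boot all_order all_algebra.
From mathcomp Require Import all_classical all_reals all_analysis.
From mathcomp Require Import complex.

Set Implicit Arguments.
Unset Strict Implicit.
Unset Printing Implicit Defensive.

Import Order.TTheory GRing.Theory Num.Theory.
Import numFieldNormedType.Exports.

Local Open Scope ring_scope.
Local Open Scope complex_scope.

Notation modC := ComplexField.Normc.normc.

(* A formal power series in eps is the sequence of its coefficients. *)
Section FormalSeries.
Variable S : comUnitRingType.
Implicit Types (f g u : nat -> S) (c : S).

Definition fps_const c : nat -> S := fun m => if m == 0%N then c else 0.

Definition fps_addc f c : nat -> S := fun m => f m + fps_const c m.

Definition fps_mul f g : nat -> S :=
  fun m => \sum_(i < m.+1) f i * g (m - i)%N.

Definition fps_pow f (k : nat) : nat -> S := iter k (fps_mul f) (fps_const 1).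

(* sum_k w_k u^k for a series u with u 0 = 0; then the powers k > m do not
   contribute to the coefficient of eps^m. *)
Definition fps_comp (w : nat -> S) u : nat -> S :=
  fun m => \sum_(k < m.+1) w k * fps_pow u k m.

(* 1 / f, for f 0 invertible: the geometric series in 1 - f / f 0 *)
Definition fps_inv f : nat -> S :=
  fun m => (f 0%N)^-1 *
    fps_comp (fun=> 1) (fps_addc (fun j => - (f j / f 0%N)) 1) m.

(* ln f, for f 0 = 1: the Mercator series in f - 1.  The term k = 0 vanishes
   since 0^-1 = 0. *)
Definition fps_ln f : nat -> S :=
  fps_comp (fun k => (-1) ^+ k.+1 / k%:R) (fps_addc f (-1)).

(* Schur polynomials: exp (sum_(j >= 1) z_j eps^j) = sum_j S_j(z) eps^j.
   The variables are z 1, z 2, ...; the value z 0 is ignored. *)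
Definition schur (j : nat) (z : nat -> S) : S :=
  fps_comp (fun k => (k`!%:R)^-1) (fun i => if i == 0%N then 0 else z i) j.

End FormalSeries.

Section NLS.
Variables (R : realType) (n : nat).
Local Notation C := R[i].
Local Notation Re := complex.Re.
Local Notation Im := complex.Im.

Definition expi (theta : R) : C := cos theta +i* sin theta.

Section Background.
Variable lam0 : C.

(* Components are indexed by k : 'I_n, standing for the component k + 1. *)
Definition ang (k : 'I_n) : R := k.+1%:R * pi / n.+1%:R.

Definition a_ (k : 'I_n) : R := 2 * Im lam0 / n.+1%:R * (sin (ang k))^-1.

Definition b_ (k : 'I_n) : R :=
  2 * Im lam0 / n.+1%:R * (cos (ang k) / sin (ang k)) - 2 * Re lam0.

Definition norm2a : R := \sum_(k < n) a_ k ^+ 2.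

Definition theta (k : 'I_n) (x t : R) : R :=
  b_ k * x + (- (b_ k ^+ 2 / 2) + norm2a) * t.

Definition q0 (k : 'I_n) (x t : R) : C := (a_ k)%:C * expi (theta k x t).

Definition chi0 : C := (2 * Re lam0) +i* (2 * Im lam0 / n.+1%:R).

Definition qhat1 (k : 'I_n) (x t : R) : C :=
  1 + 2 * 'i%C / ((modC (chi0 + (b_ k)%:C) ^+ 2)%:C) *
    ((((Re chi0 + b_ k) * (x + Re chi0 * t) - Im chi0 ^+ 2 * t)%:C + 'i%C / 2) /
     ((x + Re chi0 * t) ^+ 2 + Im chi0 ^+ 2 * t ^+ 2
        + (4 * Im chi0 ^+ 2)^-1)%:C).

Section Perturbation.
Variables (lam1 : C) (chi : nat -> C).

Definition lam : nat -> C :=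
  fun m => if m == 0%N then lam0 else if m == n.+1 then lam1 else 0.

Definition chareq_lhs : nat -> C :=
  fps_mul
    (fun m => chi m - 2 * lam m
       - \sum_(i < n) ((a_ i) ^+ 2)%:C * fps_inv (fps_addc chi (b_ i)%:C) m)
    (\big[@fps_mul C / fps_const 1]_(j < n) fps_addc chi (b_ j)%:C).

Definition chi_expansion : Prop :=
  chi 0%N = chi0 /\ forall m, chareq_lhs m = 0.

Definition alpha (j : nat) : C := 'i%C * (chi j - lam j).

Definition beta (j : nat) : C :=
  fps_mul chi chi j / 2 - fps_mul lam lam j - fps_const norm2a%:C j.

(* chi m.+1 / chi 1 are the coefficients of (chi(eps) - chi0) / (chi 1 eps). *)
Definition h1 : nat -> C :=
  fps_ln (fps_mul (fun m => chi m.+1 / chi 1%N)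
                  (fun m => (chi0 - chi0^*%C)
                            * fps_inv (fps_addc chi (- chi0^*%C)) m)).

Definition h2 (k : 'I_n) : nat -> C :=
  fps_ln (fun m => fps_addc chi (b_ k)%:C m / (chi0 + (b_ k)%:C)).

Definition C1 : C := ((modC (chi 1%N) ^+ 2) / (modC (chi0 - chi0^*%C) ^+ 2))%:C.

Section RogueWave.
Variables (Nv : 'I_n -> nat) (d : 'I_n -> nat -> C).

Definition xplus (x t : R) (l : 'I_n) (j : nat) : C :=
  alpha j * x%:C + beta j * 'i%C * t%:C + d l j.

Definition xminus (x t : R) (l : 'I_n) (j : nat) : C := (xplus x t l j)^*%C.

(* The superscript s in 0, ..., n: None is s = 0, Some k is component k. *)
Definition hshift (s : option 'I_n) (j : nat) : C :=
  if s is Some k then h2 k j else 0.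

Definition tau (x t : R) (s : option 'I_n) (l1 l2 : 'I_n) (i j : nat) : C :=
  \sum_(v < (minn i j).+1)
    C1 ^+ v
    * schur (i - v)
        (fun r => xminus x t l1 r + v%:R * (h1 r)^*%C + (hshift s r)^*%C)
    * schur (j - v)
        (fun r => xplus x t l2 r + v%:R * h1 r - hshift s r).

(* l : 'I_n and i : 'I_(Nv l) are 0-based, so the index (n+1)(i-1)+l reads: *)
Definition idx (l : 'I_n) (i : nat) : nat := (n.+1 * i + l.+1)%N.

Definition Mmat (x t : R) (s : option 'I_n) : 'M[C]_(\sum_(l < n) Nv l) :=
  \mxblock_(l1 < n, l2 < n)
    \matrix_(i < Nv l1, j < Nv l2) tau x t s l1 l2 (idx l1 i) (idx l2 j).

Definition qN (k : 'I_n) (x t : R) : C :=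
  q0 k x t * (\det (Mmat x t (Some k)) / \det (Mmat x t None)).

End RogueWave.
End Perturbation.
End Background.

Section GMAM.
Variables (Nv : 'I_n -> nat) (kappa : 'I_n -> nat -> C).
Local Notation N := (\sum_(l < n) Nv l)%N.

(* i <= (n+1)(N_l - 1) + l, written without truncated subtraction: Lambda_l is
   empty when N_l = 0. *)
Definition Lambda (l : 'I_n) : pred nat :=
  fun i => [&& (0 < i)%N, (i + n.+1 <= n.+1 * Nv l + l.+1)%N
             & ~~ (n.+1 %| i)%N].

Definition phi (l : 'I_n) (j : nat) : {poly C} :=
  schur j (fun i => 'X *+ (i == 1%N) +
                    (if (n.+1 %| i)%N then 0 else (kappa l i)%:P)).

Definition phiz (l : 'I_n) (j : int) : {poly C} :=
  if j is Posz m then phi l m else 0.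

Definition wronskian (r : nat) (f : 'I_r -> {poly C}) : {poly C} :=
  \det (\matrix_(i < r, j < r) ((f j)^`(i))).

(* tagnat.sig1 j and tagnat.sig2 j are l_j and p_j: the block containing the
   flat index j : 'I_N and the 0-based position of j in that block. *)
Definition wr : {poly C} :=
  wronskian (fun j : 'I_N => phi (tagnat.sig1 j)
                                 (idx (tagnat.sig1 j) (tagnat.sig2 j))).

Definition cN : C := (lead_coef wr)^-1.

Definition gmam : {poly C} := cN *: wr.

Definition Gamma : rat :=
  \sum_(l < n) (Nv l)%:R / 2 * (n%:R * ((Nv l)%:R - 1) + 2 * l.+1%:R)
  - \sum_(l < n) \sum_(k < n | (l < k)%N) (Nv l)%:R * (Nv k)%:R.

(* i : 'I_N is 0-based *)
Definition pbar (i : 'I_N) : nat := if i.+2 == N then N else i.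
Definition phat (i : 'I_N) : nat := if i.+1 == N then N.+1 else i.

Definition shifted_det (p : 'I_N -> nat) (z : C) : C :=
  \det (\matrix_(i < N, j < N)
    (phiz (tagnat.sig1 j)
       ((idx (tagnat.sig1 j) (tagnat.sig2 j))%:Z - (p i)%:Z)).[z]).

Definition W2 (z : C) : C := cN * (shifted_det pbar z + shifted_det phat z).

Definition Delta (lam0 lam1 : C) (chi : nat -> C) (z : C) (xh th : R) : C :=
  (alpha lam0 lam1 chi 2 * xh%:C + beta lam0 lam1 chi 2 * 'i%C * th%:C)
  * (W2 z / (gmam^`()).[z]).

End GMAM.

Definition dist2 (x t x' t' : R) : R :=
  Num.sqrt ((x - x') ^+ 2 + (t - t') ^+ 2).

End NLS.

(* Main.v *)
(** By the symmetrized Cauchy-Binet formula det M^[s] is, up to the factor N!, a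
    sum over maps f of C_1^(sum f) conj(b_f(h)) b_f(-h), where h = h_2^[s] and
    b_f(h) = det S_(J_j - f_i)(x^[l_j,+] + f_i h_1 + h).  Rescale the j-th
    variable by B^-j, with B = A near a point z_0 A, and B = A + |Z| in general,
    where Z = i chi^[1] (x + chi_0 t).  To leading order b_f becomes a minor of
    the GMAM Wronskian at (Z, A), and only f with image {0, .., N-1} or
    {0, .., N-2, N} matter: all other f carry a factor B^-4.

    Away from the roots the first type dominates, with size |W(Z / A)|^2, for
    every s, so the ratio tends to 1: the roots are simple, hence separated, and
    |W| is at least a multiple of the distance from Z to the points z A.  Near a
    root z_0 the Wronskian vanishes and its first-order expansion
    W'(z_0) (zeta - Delta) / A + (second-order shifts) / A competes with the
    second type W'(z_0); Delta is chosen to cancel the second-order shifts, which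
    leaves (conj(zeta + h) (zeta - h) + C_1) / (|zeta|^2 + C_1), the first-order
    rogue wave.  The x_1-shifts f_i h_(1,1) disappear because h_(1,1) = 0, which
    follows from (chi - chi_0)^(n+1) = 2 lambda^[1] eps^(n+1) prod (chi + b_j).

    The degree of W is Gamma because its leading coefficient is a multiple of the
    Vandermonde determinant of the distinct indices J_j. *)

Require Import Defs.
From HB Require Import structures.
From mathcomp Require Import all_boot all_order all_algebra.
From mathcomp Require Import all_classical all_reals all_analysis.
From mathcomp Require Import complex.
From mathcomp Require Import perm ring lra zify.

Set Implicit Arguments.
Unset Strict Implicit.
Unset Printing Implicit Defensive.

Import Order.TTheory GRing.Theory Num.Theory.
Import numFieldNormedType.Exports.

Local Open Scope ring_scope.
Local Open Scope complex_scope.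

(** The obstacle is uniformity in (x, t): claim (i) lives on moving discs, claim (ii) on an
    unbounded region. Orders of magnitude are therefore bounds on a region [D] of points (A, x, t)
    with a small parameter [del], which is 1/A near a root and 1/B far away, and one set of
    determinant expansions serves both cases. At the scale B the ratio A/B varies over (0, 1], hence
    the homogenized Wronskian in two variables.

    Rescaling makes the d_(l,r) bounded and leaves alpha_r x + beta_r i t with a factor del^(r-1)
    for r >= 2. The case r = 2 is of first order in del, exactly the order that decides the picture
    at a root; this is the origin of Delta.

    Far from the roots the leading term |H|^2 may itself be as small as a multiple of (Q del)^2,
    where Q bounds the distance from Z to the points z A from below. Errors must therefore be
    measured against |H|: they are O(|H| del + del^2), that is O(1/Q) relative to |H|^2, so that the
    distance itself drives the convergence in (ii). *)

(** * Formal power series and Schur polynomials *)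

(* An alias, so that the pointwise product on [nat -> S] is not inferred. *)
Definition fps (S : comUnitRingType) := nat -> S.

Section SeriesRing.
Variable S : comUnitRingType.
Local Notation F := (fps S).
Implicit Types f g h u : F.

HB.instance Definition _ := gen_eqMixin F.
HB.instance Definition _ := gen_choiceMixin F.

Let addA : associative (fun f g : F => (fun m => f m + g m) : F).
Proof. by move=> f g h; apply/funext => m; rewrite addrA. Qed.
Let addC : commutative (fun f g : F => (fun m => f m + g m) : F).
Proof. by move=> f g; apply/funext => m; rewrite addrC. Qed.
Let add0 : left_id (fun=> 0 : S) (fun f g : F => (fun m => f m + g m) : F).
Proof. by move=> f; apply/funext => m; rewrite add0r. Qed.
Let addN : left_inverse (fun=> 0 : S) (fun f : F => (fun m => - f m) : F)
  (fun f g : F => (fun m => f m + g m) : F).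
Proof. by move=> f; apply/funext => m; rewrite addNr. Qed.

HB.instance Definition _ := GRing.isZmodule.Build F addA addC add0 addN.

Let mulA : associative (@fps_mul S : F -> F -> F).
Proof.
move=> f g h; apply/funext => m; rewrite /fps_mul.
under eq_bigr do rewrite big_distrr /=.
under [RHS]eq_bigr do rewrite big_distrl /=.
transitivity (\sum_(i < m.+1) \sum_(j < m.+1 | (i + j <= m)%N)
    f i * g j * h (m - (i + j))%N).
  apply: eq_bigr => -[i /= lim] _; rewrite ltnS in lim.
  rewrite (big_ord_widen m.+1 (fun j => f i * (g j * h (m - i - j)%N)));
    last by lia.
  by apply: eq_big => [j|j _]; [lia|rewrite mulrA subnDA].
rewrite [LHS]pair_big_dep [RHS](eq_bigr (fun k : 'I_m.+1 => \sum_(i < m.+1 | (i <= k)%N)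
  f i * g (k - i)%N * h (m - k)%N)); last first.
  move=> k _; rewrite (big_ord_widen m.+1
    (fun i => f i * g (k - i)%N * h (m - k)%N)) ?ltn_ord //.
rewrite pair_big_dep /=.
(* The change of indices is (i, j) -> (i + j, i), with inverse (k, i) -> (i, k - i). *)
pose up (p : 'I_m.+1 * 'I_m.+1) : 'I_m.+1 * 'I_m.+1 :=
  (inord (p.1 + p.2), p.1).
pose dn (p : 'I_m.+1 * 'I_m.+1) : 'I_m.+1 * 'I_m.+1 :=
  (p.2, inord (p.1 - p.2)).
rewrite [RHS](reindex_onto up dn) /=; last first.
  case=> -[k hk] [i hi] /= ik; rewrite /up /dn /=; congr pair.
  by apply: val_inj; rewrite /= !inordK; lia.
apply: eq_big => [[[i hi] [j hj]]|[[i hi] [j hj]]] /=.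
  apply/idP/andP => [ij|].
    have ijm : (i + j < m.+1)%N by [].
    have ijE : (inord (i + j) : 'I_m.+1) = (i + j)%N :> nat by rewrite inordK.
    rewrite ijE leq_addr; split=> //; apply/eqP; congr pair.
    by apply: val_inj; rewrite /= ijE addKn inordK.
  case=> _ /eqP[] /(congr1 val) /=.
  (* Out of range [inord] returns its default 0, which would force [j = 0], and then [i + j <= m]
     after all. *)
  case: (leqP (i + j) m) => // mij.
  rewrite /inord /insubd [insub (i + j)%N]insubN /=; last by rewrite ltnS -ltnNge.
  rewrite sub0n insubT //= => j0; lia.
by move=> ij; rewrite inordK ?addKn.
Qed.

Let mulC : commutative (@fps_mul S : F -> F -> F).
Proof.
move=> f g; apply/funext => m; rewrite /fps_mul.
rewrite (reindex_inj rev_ord_inj) /=; apply: eq_bigr => -[i hi] _ /=.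
by rewrite subSS subKn // mulrC.
Qed.

Let mul1 : left_id (@fps_const S 1) (@fps_mul S : F -> F -> F).
Proof.
move=> f; apply/funext => m; rewrite /fps_mul big_ord_recl /= mul1r subn0.
by rewrite big1 ?addr0 // => i _; rewrite /fps_const mul0r.
Qed.

Let mulD : left_distributive (@fps_mul S : F -> F -> F) +%R.
Proof.
move=> f g h; apply/funext => m; rewrite /fps_mul /= -[RHS]big_split /=.
by apply: eq_bigr => i _; rewrite mulrDl.
Qed.

Let one_neq0 : (@fps_const S 1 : F) != 0.
Proof. by apply/eqP => /(congr1 (fun f : F => f 0%N)) /eqP; rewrite oner_eq0. Qed.

HB.instance Definition _ :=
  GRing.Zmodule_isComNzRing.Build F mulA mulC mul1 mulD one_neq0.

Lemma fps_mulE f g : fps_mul f g = f * g. Proof. by []. Qed.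

Lemma fps_coefM f g m : (f * g) m = \sum_(i < m.+1) f i * g (m - i)%N.
Proof. by []. Qed.

Lemma fps_coef_sum (I : Type) (r : seq I) (P : pred I) (G : I -> F) m :
  (\sum_(i <- r | P i) G i) m = \sum_(i <- r | P i) G i m.
Proof. exact: (big_morph (fun f : F => f m)). Qed.

Lemma fps_coefMn f k m : (f *+ k) m = f m *+ k.
Proof.
elim: k => [//|k IH]; rewrite !mulrS -IH.
by [].
Qed.

Lemma fps_powE f k : fps_pow f k = f ^+ k.
Proof. by elim: k => [//|k IH]; rewrite exprS -IH. Qed.

Definition fpsC c : F := fps_const c.

Lemma fpsCM c f m : (fpsC c * f) m = c * f m.
Proof.
rewrite fps_coefM big_ord_recl /= subn0 big1 ?addr0 // => i _.
by rewrite /fpsC /fps_const mul0r.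
Qed.

Lemma fpsC_is_zmod_morphism : zmod_morphism fpsC.
Proof.
move=> c c'; apply/funext => m.
rewrite -[RHS]/(fps_const c m - fps_const c' m) /fpsC /fps_const.
by case: eqP => // _; rewrite subrr.
Qed.

Lemma fpsC_is_monoid_morphism : monoid_morphism fpsC.
Proof.
split=> // c c'; apply/funext => m; rewrite fpsCM.
by rewrite /fpsC /fps_const; case: eqP => //; rewrite mulr0.
Qed.

HB.instance Definition _ :=
  GRing.isZmodMorphism.Build S F fpsC fpsC_is_zmod_morphism.
HB.instance Definition _ :=
  GRing.isMonoidMorphism.Build S F fpsC fpsC_is_monoid_morphism.

Lemma fps_coefX_lt f g k m : f 0%N = 0 -> (m < k)%N -> (f ^+ k * g) m = 0.
Proof.
move=> f0; elim: k m g => // k IH m g mk; rewrite exprSr -mulrA.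
rewrite fps_coefM big1 // => -[i im] _ /=; have [ik|ki] := ltnP i k.
  by have := IH i 1 ik; rewrite mulr1 => ->; rewrite mul0r.
by rewrite (_ : m - i = 0)%N ?fps_coefM ?big_ord1 ?f0 ?mul0r ?mulr0//; lia.
Qed.

Lemma fps_comp_widen (w : nat -> S) u m M : u 0%N = 0 -> (m <= M)%N ->
  fps_comp w u m = \sum_(k < M.+1) w k * (u ^+ k : F) m.
Proof.
move=> u0 mM; rewrite /fps_comp.
rewrite (big_ord_widen M.+1 (fun k => w k * fps_pow u k m)) //.
rewrite big_mkcond; apply: eq_bigr => k _; rewrite fps_powE.
case: ifP => // /negbT; rewrite -leqNgt => mk.
by rewrite -[u ^+ k]mulr1 fps_coefX_lt ?mulr0.
Qed.

Lemma fps_mulVr f : f 0%N \is a GRing.unit -> (fps_inv f : F) * f = 1.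
Proof.
move=> uf; pose w : F := fps_addc (fun j => - (f j / f 0%N)) 1.
have w0 : w 0%N = 0 by rewrite /w /fps_addc /fps_const /= divrr // addNr.
have fE : f = fpsC (f 0%N) * (1 - w).
  apply/funext => m; rewrite fpsCM.
  rewrite (_ : (1 - w) m = fps_const 1 m - (- (f m / f 0%N) + fps_const 1 m)) //.
  by rewrite opprD opprK addrCA subrr addr0 mulrCA divrr ?mulr1.
apply/funext => m; rewrite fps_coefM.
(* With f = f_0 (1 - w), the truncated geometric sum telescopes to 1 - w^(m+1), and w^(m+1) has no
   coefficient of order m. *)
transitivity ((\sum_(k < m.+1) w ^+ k * (1 - w)) m); last first.
  rewrite -mulr_suml -[1 - w]opprB mulrN mulrC -subrX1 opprB.
  rewrite -[LHS]/((1 : F) m - (w ^+ m.+1) m).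
  by rewrite -[w ^+ m.+1]mulr1 fps_coefX_lt ?subr0.
rewrite -mulr_suml fps_coefM; apply: eq_bigr => -[i im] _ /=.
have -> : f (m - i)%N = f 0%N * (1 - w) (m - i)%N by rewrite {1}fE fpsCM.
rewrite /fps_inv -/w (fps_comp_widen _ w0 (M := m)); last by lia.
rewrite mulrACA mulVr // mul1r fps_coef_sum; congr (_ * _).
by apply: eq_bigr => k _; rewrite mul1r.
Qed.

Lemma fps_ln_coef1 f : fps_ln f 1%N = f 1%N.
Proof.
rewrite /fps_ln /fps_comp !big_ord_recl big_ord0 /= addr0.
rewrite invr0 !mulr0 ?mul0r add0r expr2 mulrNN !mulr1 invr1 mul1r.
rewrite fps_mulE -[fps_const 1]/(1 : F) mulr1.
by rewrite mul1r /fps_addc /fps_const /= addr0.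
Qed.

Lemma eq_fps_comp (w : nat -> S) u v m : (forall i, (i <= m)%N -> u i = v i) ->
  fps_comp w u m = fps_comp w v m.
Proof.
move=> uv; apply: eq_bigr => k _; congr (_ * _); move: (k : nat) => {}k.
rewrite !fps_powE.
elim: k m uv => // k IH m uv; rewrite !exprS !fps_coefM; apply: eq_bigr => i _.
by rewrite uv -1?ltnS // IH // => j jm; apply: uv; lia.
Qed.

End SeriesRing.

Section Schur.
Variable S : comUnitRingType.
Hypothesis unitS : forall k, (k.+1%:R : S) \is a GRing.unit.
Local Notation F := (fps S).
Implicit Types z w : nat -> S.

Lemma schur0 z : schur 0 z = 1.
Proof. by rewrite /schur /fps_comp big_ord1 /= fact0 invr1 mul1r. Qed.

(* the Euler operator eps d/d eps *)
Let euler (f : F) : F := fun m => m%:R * f m.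

Let eulerM (f g : F) : euler (f * g) = euler f * g + f * euler g.
Proof.
apply/funext => m; rewrite /euler fps_coefM mulr_sumr.
rewrite -[RHS]/((euler f * g) m + (f * euler g) m) !fps_coefM -big_split /=.
apply: eq_bigr => -[i im] _ /=; rewrite mulrA [f i * _]mulrCA -!mulrA -mulrDl.
by rewrite -natrD subnKC.
Qed.

Let eulerX (f : F) k : euler (f ^+ k.+1) = (f ^+ k * euler f) *+ k.+1.
Proof.
elim: k => [|k IH]; first by rewrite expr0 mul1r.
by rewrite exprS eulerM IH mulrnAr mulrA -exprS [euler f * _]mulrC -mulrS.
Qed.

(** Comes from [euler (exp u) = euler u * exp u] by comparing coefficients. This recursion
    determines all Schur polynomials and replaces the exponential series from here on. *)
Lemma schurS m z :
  m.+1%:R * schur m.+1 z = \sum_(i < m.+1) i.+1%:R * z i.+1 * schur (m - i) z.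
Proof.
pose u : F := fun i => if i == 0%N then 0 else z i.
have u0 : u 0%N = 0 by [].
rewrite /schur /fps_comp -/u big_ord_recl /= mulrDr mulrCA.
rewrite [X in X + _](_ : _ = 0) ?add0r; last by rewrite /fps_const /= ?mulr0.
rewrite mulr_sumr.
(* Stopping the exponential at u^m loses nothing: [euler u] has no constant term, so it meets only
   coefficients of order at most m. *)
transitivity ((euler u * (\sum_(k < m.+1) fpsC (k`!%:R)^-1 * u ^+ k)) m.+1).
  rewrite mulr_sumr fps_coef_sum; apply: eq_bigr => -[k km] _; rewrite /bump /= add1n.
  rewrite -[fps_mul u _]/(fps_pow u k.+1) fps_powE mulrCA.
  rewrite -[_ * (u ^+ _) _]/(euler (u ^+ k.+1) m.+1) eulerX fps_coefMn.
  rewrite [euler u * _]mulrCA fpsCM [euler u * _]mulrC.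
  rewrite -[X in _ * X = _]mulr_natl mulrA.
  congr (_ * _); rewrite factS natrM invrM ?mulrVK ?unitS //.
  elim: (k) => [|j IH]; first by rewrite unitr1.
  by rewrite factS natrM unitrM unitS.
rewrite fps_coefM big_ord_recl {1}/euler !mul0r add0r; apply: eq_bigr => -[i im] _.
rewrite lift0 subSS /euler; congr (_ * _).
rewrite fps_coef_sum -[RHS]/(fps_comp (fun k => (k`!%:R)^-1) u (m - i)).
rewrite (fps_comp_widen _ u0 (leq_subr i m)).
by apply: eq_bigr => k _; rewrite fpsCM.
Qed.

(** Identities between Schur polynomials are proved through this: it suffices that the other side
    starts at 1 and obeys the same recursion. *)
Lemma schur_uniq z (G : nat -> S) : G 0%N = 1 ->
  (forall m, m.+1%:R * G m.+1 = \sum_(i < m.+1) i.+1%:R * z i.+1 * G (m - i)%N) ->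
  forall m, G m = schur m z.
Proof.
move=> G0 GS; elim/ltn_ind => -[|m] IH; first by rewrite G0 schur0.
apply: (mulrI (unitS m)); rewrite GS schurS; apply: eq_bigr => i _.
by rewrite IH // ltnS leq_subr.
Qed.

Lemma schur1 z : schur 1 z = z 1%N.
Proof.
have := schurS 0 z; rewrite mul1r big_ord1 schur0 mulr1 => ->.
by rewrite mul1r.
Qed.

Lemma schur2 z : schur 2 z = z 2%N + 2^-1 * z 1%N ^+ 2.
Proof.
apply: (mulrI (unitS 1)); rewrite schurS !big_ord_recl big_ord0 /= addr0.
rewrite /bump /= schur1 schur0 mulrDr mulrA mulrV ?(unitS 1) // !mul1r mulr1.
by rewrite addrC expr2.
Qed.

Lemma eq_schur m z w : (forall i, (0 < i <= m)%N -> z i = w i) ->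
  schur m z = schur m w.
Proof.
by move=> zw; apply: eq_fps_comp => -[//|i] im /=; apply: zw.
Qed.

(** Weighted homogeneity, z_j having weight j; every rescaling of the determinants rests on it. *)
Lemma schur_scale m c z : schur m (fun j => c ^+ j * z j) = c ^+ m * schur m z.
Proof.
symmetry; move: m; apply: schur_uniq; first by rewrite expr0 mul1r schur0.
move=> m; rewrite mulrCA schurS mulr_sumr; apply: eq_bigr => -[i im] _ /=.
rewrite -[in c ^+ m.+1](subnKC im) subSS exprD; ring.
Qed.

(** This is exp(z + w) = exp z exp w: by the product rule for [euler], the product of the two
    generating series satisfies the recursion of the sum. *)
Lemma schurD m z w :
  schur m (fun j => z j + w j) = \sum_(i < m.+1) schur i w * schur (m - i) z.
Proof.
pose E z : F := fun j => schur j z.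
pose u z : F := fun i => i%:R * z i.
have EE z1 : euler (E z1) = u z1 * E z1.
  apply/funext => -[|k]; first by rewrite fps_coefM big_ord1 /euler /u !mul0r.
  rewrite -[LHS]/(k.+1%:R * schur k.+1 z1) schurS fps_coefM.
  rewrite [RHS]big_ord_recl {1}/u !mul0r add0r.
  by apply: eq_bigr => i _; rewrite lift0 subSS.
symmetry; rewrite -[LHS]/((E w * E z) m); move: m; apply: schur_uniq.
  by rewrite fps_coefM big_ord1 /E !schur0 mulr1.
move=> m; rewrite -[LHS]/(euler (E w * E z) m.+1) eulerM !EE.
have -> : u w * E w * E z + E w * (u z * E z) = (u w + u z) * (E w * E z).
  by rewrite mulrDl !mulrA [E w * u z]mulrC.
rewrite fps_coefM big_ord_recl.
rewrite [X in X * _](_ : _ = 0) ?mul0r ?add0r; last first.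
  by rewrite -[LHS]/(u w 0%N + u z 0%N) /u !mul0r addr0.
apply: eq_bigr => i _; rewrite lift0 subSS; congr (_ * _).
by rewrite -[LHS]/(u w i.+1 + u z i.+1) /u mulrDr addrC.
Qed.

Lemma schur_X m (c : S) :
  schur m (fun j => c *+ (j == 1%N)) = (m`!%:R)^-1 * c ^+ m.
Proof.
symmetry; move: m; apply: schur_uniq; first by rewrite fact0 invr1 mul1r.
have factU k : (k`!%:R : S) \is a GRing.unit.
  elim: k => [|k IH]; first by rewrite unitr1.
  by rewrite factS natrM unitrM unitS.
move=> m; rewrite big_ord_recl big1 /= ?addr0 => [|i _].
  rewrite mulr1n mul1r subn0 factS natrM invrM ?unitS // exprS mulrA.
  by rewrite [m.+1%:R * _]mulrCA mulrV // mulr1 mulrCA.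
by rewrite mulr0n mulr0 mul0r.
Qed.

End Schur.

(** A ring morphism preserves the recursion. It is applied to complex conjugation, to constant
    polynomials and to evaluation at a point. *)
Lemma rmorph_schur (S S' : comUnitRingType) (f : {rmorphism S -> S'}) m z :
  (forall k, (k.+1%:R : S) \is a GRing.unit) ->
  f (schur m z) = schur m (f \o z).
Proof.
move=> uS; have uS' k : (k.+1%:R : S') \is a GRing.unit.
  by rewrite -(rmorph_nat f) rmorph_unit.
move: m; apply: schur_uniq => // [|m]; first by rewrite schur0 rmorph1.
rewrite -[m.+1%:R](rmorph_nat f) -rmorphM /= schurS // rmorph_sum.
by apply: eq_bigr => i _; rewrite !rmorphM rmorph_nat.
Qed.

(** * Orders of magnitude *)

Section ModC.
Variable R : realType.
Local Notation C := R[i].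
Implicit Types (x y : C) (a : R).

Lemma modC_ge0 x : 0 <= modC x.
Proof. by case: x => a b; exact: sqrtr_ge0. Qed.

Lemma modC0 : modC (0 : C) = 0. Proof. exact: ComplexField.Normc.normc0. Qed.
Lemma modC1 : modC (1 : C) = 1. Proof. exact: ComplexField.Normc.normc1. Qed.

Lemma modCM x y : modC (x * y) = modC x * modC y.
Proof. exact: ComplexField.Normc.normcM. Qed.

Lemma modCV x : modC x^-1 = (modC x)^-1.
Proof. exact: ComplexField.Normc.normcV. Qed.

Lemma modCD x y : modC (x + y) <= modC x + modC y.
Proof. exact: (@le_normcD R). Qed.

Lemma modCN x : modC (- x) = modC x.
Proof. exact: (@normcN R). Qed.

Lemma modCB x y : modC (x - y) <= modC x + modC y.
Proof. by rewrite -(modCN y) modCD. Qed.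

Lemma modC_eq0 x : (modC x == 0) = (x == 0).
Proof.
by apply/eqP/eqP => [/ComplexField.Normc.eq0_normc//|->]; rewrite modC0.
Qed.

Lemma modC_gt0 x : (0 < modC x) = (x != 0).
Proof. by rewrite lt0r modC_ge0 andbT modC_eq0. Qed.

Lemma modCX x k : modC (x ^+ k) = modC x ^+ k.
Proof. by elim: k => [|k IH]; rewrite ?expr0 ?modC1// !exprS modCM IH. Qed.

Lemma modC_real a : modC a%:C = `|a|.
Proof. by rewrite /= expr0n addr0 sqrtr_sqr. Qed.

Lemma modC_conj x : modC x^*%C = modC x.
Proof. by case: x => a b /=; rewrite sqrrN. Qed.

Lemma modC_i : modC ('i%C : C) = 1.
Proof. by rewrite /= expr0n add0r expr1n sqrtr1. Qed.

Lemma modC_sqr x : (modC x ^+ 2)%:C = x * x^*%C.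
Proof. by rewrite -sqr_normc rmorphXn. Qed.

Lemma modC_prod (I : Type) (r : seq I) (P : pred I) (F : I -> C) :
  modC (\prod_(i <- r | P i) F i) = \prod_(i <- r | P i) modC (F i).
Proof. exact: (big_morph _ modCM modC1). Qed.

End ModC.

Section BigO.
Variables (R : realType) (T : Type) (D : T -> Prop) (delta : T -> R).
Local Notation C := R[i].
Implicit Types (f g : T -> C) (k l : nat).

(** No limit is involved: the constant is uniform on the region [D], and [delta] plays the role of
    the small parameter. *)
Definition isO k f : Prop :=
  exists K : R, forall p, D p -> modC (f p) <= K * delta p ^+ k.

Hypothesis delta01 : forall p, D p -> 0 <= delta p <= 1.

Lemma isO_pos k f : isO k f ->
  exists2 K : R, 0 < K & forall p, D p -> modC (f p) <= K * delta p ^+ k.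
Proof.
case=> K fK; exists (Num.max K 1) => [|p Dp].
  by rewrite lt_max ltr01 orbT.
have /andP[d0 _] := delta01 Dp.
apply: (le_trans (fK _ Dp)); apply: ler_wpM2r; first exact: exprn_ge0.
by rewrite le_max lexx.
Qed.

Lemma eq_isO k f g : (forall p, D p -> f p = g p) -> isO k g -> isO k f.
Proof. by move=> fg [K gK]; exists K => p Dp; rewrite fg// gK. Qed.

Lemma isO_cst c : isO 0 (fun=> c).
Proof. by exists (modC c) => p _; rewrite mulr1. Qed.

Lemma isO0 k : isO k (fun=> 0).
Proof. by exists 0 => p _; rewrite modC0 mul0r. Qed.

Lemma isO_delta : isO 1 (fun p => (delta p)%:C).
Proof.
exists 1 => p /delta01 /andP[d0 _].
by rewrite modC_real ger0_norm // mul1r expr1.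
Qed.

Lemma isOD k f g : isO k f -> isO k g -> isO k (fun p => f p + g p).
Proof.
move=> [K fK] [L gL]; exists (K + L) => p Dp.
by rewrite (le_trans (modCD _ _)) // mulrDl lerD ?fK ?gL.
Qed.

Lemma isON k f : isO k f -> isO k (fun p => - f p).
Proof. by move=> [K fK]; exists K => p Dp; rewrite modCN fK. Qed.

Lemma isOB k f g : isO k f -> isO k g -> isO k (fun p => f p - g p).
Proof. by move=> Of Og; apply: isOD => //; apply: isON. Qed.

Lemma isOM k l f g : isO k f -> isO l g -> isO (k + l) (fun p => f p * g p).
Proof.
move=> /isO_pos[K K0 fK] /isO_pos[L L0 gL]; exists (K * L) => p Dp.
by rewrite modCM exprD mulrACA ler_pM ?modC_ge0 ?fK ?gL.
Qed.

Lemma isO_le k l f : (k <= l)%N -> isO l f -> isO k f.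
Proof.
move=> kl /isO_pos[K K0 fK]; exists K => p Dp; apply: (le_trans (fK _ Dp)).
have /andP[d0 d1] := delta01 Dp.
by apply: ler_wpM2l; [exact: ltW|exact: ler_wiXn2l].
Qed.

Lemma isOM0 k f g : isO 0 f -> isO k g -> isO k (fun p => f p * g p).
Proof. by move=> Of Og; rewrite -[k]add0n; apply: isOM. Qed.

Lemma isOZ k c f : isO k f -> isO k (fun p => c * f p).
Proof. by move=> Of; apply: isOM0 => //; apply: isO_cst. Qed.

Lemma isO_sum (I : Type) (r : seq I) (P : pred I) (F : I -> T -> C) k :
  (forall i, P i -> isO k (F i)) -> isO k (fun p => \sum_(i <- r | P i) F i p).
Proof.
move=> FO; elim: r => [|i r IH].
  by apply: (@eq_isO _ _ (fun=> 0)); [move=> p _; rewrite big_nil|exact: isO0].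
apply: (@eq_isO _ _ (fun p => (if P i then F i p else 0) +
    \sum_(j <- r | P j) F j p)).
  by move=> p _; rewrite big_cons; case: ifP => // _; rewrite add0r.
by apply: isOD => //; case: (P i) (FO i) => [FOi|_]; [exact: FOi|exact: isO0].
Qed.

Lemma isO_prod (I : Type) (r : seq I) (P : pred I) (F : I -> T -> C) :
  (forall i, P i -> isO 0 (F i)) -> isO 0 (fun p => \prod_(i <- r | P i) F i p).
Proof.
move=> FO; elim: r => [|i r IH].
  by apply: (@eq_isO _ _ (fun=> 1)); [move=> p _; rewrite big_nil|exact: isO_cst].
apply: (@eq_isO _ _ (fun p => (if P i then F i p else 1) *
    \prod_(j <- r | P j) F j p)).
  by move=> p _; rewrite big_cons; case: ifP => // _; rewrite mul1r.
by apply: isOM0 => //; case: (P i) (FO i) => [FOi|_]; [exact: FOi|exact: isO_cst].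
Qed.

Lemma isO_conj k f : isO k f -> isO k (fun p => (f p)^*%C).
Proof. by move=> [K fK]; exists K => p Dp; rewrite modC_conj fK. Qed.

Lemma isOX k f : isO 0 f -> isO 0 (fun p => f p ^+ k).
Proof.
move=> Of; elim: k => [|k IH]; first exact: isO_cst.
by apply: (@eq_isO _ _ (fun p => f p * f p ^+ k));
  [move=> p _; rewrite exprS|apply: isOM0].
Qed.

Lemma isO_mulB k f f' g g' : isO 0 f -> isO 0 f' -> isO 0 g -> isO 0 g' ->
  isO k (fun p => f p - f' p) -> isO k (fun p => g p - g' p) ->
  isO k (fun p => f p * g p - f' p * g' p).
Proof.
move=> Of Of' Og Og' ff' gg'.
apply: (@eq_isO _ _ (fun p => f p * (g p - g' p) + g' p * (f p - f' p))).
  by move=> p _; ring.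
by apply: isOD; apply: isOM0.
Qed.

Lemma isO_prod_sub N k (x y : 'I_N -> T -> C) :
  (forall i, isO 0 (x i)) -> (forall i, isO 0 (y i)) ->
  (forall i, isO k (fun p => x i p - y i p)) ->
  isO k (fun p => \prod_(i < N) x i p - \prod_(i < N) y i p).
Proof.
elim: N x y => [|N IH] x y Ox Oy Oxy.
  by apply: (@eq_isO _ _ (fun=> 0)); [move=> p _; rewrite !big_ord0 subrr|exact: isO0].
apply: (@eq_isO _ _ (fun p =>
    x ord0 p * (\prod_(i < N) x (lift ord0 i) p) -
    y ord0 p * (\prod_(i < N) y (lift ord0 i) p))).
  by move=> p _; rewrite !big_ord_recl.
by apply: isO_mulB => //; [apply: isO_prod|apply: isO_prod|apply: IH].
Qed.

(** To first order in [delta] exactly one factor is replaced by its correction; products of two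
    corrections go into the remainder. *)
Lemma isO_prod_expand N (x y z : 'I_N -> T -> C) :
  (forall i, isO 0 (x i)) -> (forall i, isO 0 (y i)) ->
  (forall i, isO 0 (z i)) ->
  (forall i, isO 2 (fun p => x i p - (y i p + (delta p)%:C * z i p))) ->
  isO 2 (fun p => \prod_(i < N) x i p - (\prod_(i < N) y i p + (delta p)%:C *
    \sum_(i < N) \prod_(j < N) (if j == i then z j p else y j p))).
Proof.
elim: N x y z => [|N IH] x y z Ox Oy Oz Oxyz.
  apply: (@eq_isO _ _ (fun=> 0)); last exact: isO0.
  by move=> p _; rewrite !big_ord0 mulr0 addr0 subrr.
pose x' i := x (lift ord0 i); pose y' i := y (lift ord0 i).
pose z' i := z (lift ord0 i).
pose s p := \sum_(i < N) \prod_(j < N) (if j == i then z' j p else y' j p).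
have Os : isO 0 s.
  by apply: isO_sum => i _; apply: isO_prod => j _; case: (j == i);
      [exact: Oz|exact: Oy].
have := IH x' y' z' (fun i => Ox _) (fun i => Oy _) (fun i => Oz _) (fun i => Oxyz _).
rewrite -/s => {}IH.
apply: (@eq_isO _ _ (fun p =>
  (\prod_(i < N) x' i p) * (x ord0 p - (y ord0 p + (delta p)%:C * z ord0 p)) +
  (y ord0 p + (delta p)%:C * z ord0 p) *
    (\prod_(i < N) x' i p - (\prod_(i < N) y' i p + (delta p)%:C * s p)) +
  (delta p)%:C * (delta p)%:C * (z ord0 p * s p))).
  move=> p _; rewrite !big_ord_recl /=.
  have -> : \prod_(i < N) (if lift ord0 i == ord0 then z (lift ord0 i) p
    else y (lift ord0 i) p) = \prod_(i < N) y' i p by exact: eq_bigr.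
  have -> : \sum_(i < N) \prod_(j < N.+1) (if j == lift ord0 i then z j p else y j p)
     = y ord0 p * s p.
    rewrite mulr_sumr; apply: eq_bigr => i _; rewrite big_ord_recl /=.
    by congr (_ * _); apply: eq_bigr => j _; rewrite (inj_eq (@lift_inj _ ord0)).
  rewrite -/(x' _) -/(y' _) -/(z' _); ring.
have Od := isO_delta.
apply: isOD; [apply: isOD|]; last 1 first.
- rewrite -[2%N]/(1 + 1 + 0)%N.
  by apply: isOM; [exact: isOM|exact: isOM0].
- by apply: isOM0 => //; apply: isO_prod => i _; apply: Ox.
apply: isOM0 => //; apply: isOD => //; apply: (isO_le (leq0n 1)).
by rewrite -[1%N]addn0; apply: isOM.
Qed.

Lemma isO_det N (X : T -> 'M[C]_N) :
  (forall i j, isO 0 (fun p => X p i j)) -> isO 0 (fun p => \det (X p)).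
Proof.
by move=> OX; apply: isO_sum => s _; apply: isOZ; apply: isO_prod => i _; apply: OX.
Qed.

Lemma isO_det_sub N k (X Y : T -> 'M[C]_N) :
  (forall i j, isO 0 (fun p => X p i j)) ->
  (forall i j, isO 0 (fun p => Y p i j)) ->
  (forall i j, isO k (fun p => X p i j - Y p i j)) ->
  isO k (fun p => \det (X p) - \det (Y p)).
Proof.
move=> OX OY OXY; apply: (@eq_isO _ _ (fun p => \sum_(s : 'S_N) (-1) ^+ s *
    (\prod_(i < N) X p i (s i) - \prod_(i < N) Y p i (s i)))).
  by move=> p _; rewrite -sumrB; apply: eq_bigr => s _; rewrite mulrBr.
apply: isO_sum => s _; apply: isOZ.
exact: (isO_prod_sub (fun i => OX i (s i)) (fun i => OY i (s i))).
Qed.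

Lemma isO_det_expand N (X Y Z : T -> 'M[C]_N) :
  (forall i j, isO 0 (fun p => X p i j)) ->
  (forall i j, isO 0 (fun p => Y p i j)) ->
  (forall i j, isO 0 (fun p => Z p i j)) ->
  (forall i j, isO 2 (fun p => X p i j - (Y p i j + (delta p)%:C * Z p i j))) ->
  isO 2 (fun p => \det (X p) - (\det (Y p) + (delta p)%:C *
     \sum_(i < N) \det (\matrix_(k, j) (if k == i then Z p k j else Y p k j)))).
Proof.
move=> OX OY OZ OXYZ; apply: (@eq_isO _ _ (fun p => \sum_(s : 'S_N) (-1) ^+ s *
    (\prod_(i < N) X p i (s i) - (\prod_(i < N) Y p i (s i) + (delta p)%:C *
      \sum_(i < N) \prod_(j < N) (if j == i then Z p j (s j) else Y p j (s j)))))).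
  move=> p _; rewrite exchange_big mulr_sumr -big_split -sumrB.
  apply: eq_bigr => s _; rewrite mulrBr mulrDr /=; congr (_ - (_ + _)).
  rewrite mulrCA; congr (_ * _); rewrite mulr_sumr; apply: eq_bigr => i _.
  by congr (_ * _); apply: eq_bigr => j _; rewrite mxE.
apply: isO_sum => s _; apply: isOZ.
exact: (isO_prod_expand (fun i => OX i (s i)) (fun i => OY i (s i))
  (fun i => OZ i (s i)) (fun i => OXYZ i (s i))).
Qed.

Lemma natC_unit k : (k.+1%:R : C) \is a GRing.unit.
Proof. by rewrite unitfE pnatr_eq0. Qed.

(** Every monomial of S_m has indices of total m, so a subadditive order [om j] of z_j passes to
    S_m; induction along the recursion avoids listing the monomials. *)
Lemma isO_schur (om : nat -> nat) (e : T -> nat -> C) m :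
  (forall i j, om (i + j)%N <= om i + om j)%N -> om 0%N = 0%N ->
  (forall j, (0 < j <= m)%N -> isO (om j) (e^~ j)) ->
  isO (om m) (fun p => schur m (e p)).
Proof.
move=> omD om0; elim/ltn_ind: m => -[|m] IH eO.
  apply: (@eq_isO _ _ (fun=> 1)); first by move=> p _; rewrite schur0.
  by rewrite om0; apply: isO_cst.
apply: (@eq_isO _ _ (fun p => (m.+1%:R)^-1 *
    \sum_(i < m.+1) i.+1%:R * (e p i.+1 * schur (m - i) (e p)))).
  move=> p _; apply: (mulrI (natC_unit m)); rewrite (schurS natC_unit).
  rewrite mulrA mulrV ?natC_unit // mul1r.
  by apply: eq_bigr => i _; rewrite mulrA.
apply: isOZ; apply: isO_sum => i _; apply: isOZ.
have im := ltn_ord i.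
apply: (@isO_le _ (om i.+1 + om (m - i)%N)); last first.
  apply: isOM; first by apply: eO; lia.
  by apply: IH; [lia|move=> j jm; apply: eO; lia].
by have := omD i.+1 (m - i)%N; rewrite addSn subnKC //; lia.
Qed.

End BigO.

(** * The Cauchy-Binet formula and its leading terms *)

Section CauchyBinet.
Variable S : comNzRingType.

Lemma det_mulmx_ffun N V (A : 'M[S]_(N, V)) (B : 'M[S]_(V, N)) :
  \det (A *m B) = \sum_(f : {ffun 'I_N -> 'I_V})
    \det (\matrix_(i, j) B (f i) j) * \prod_i A i (f i).
Proof.
pose AB (s : 'S_N) i j := A i j * B j (s i).
transitivity (\sum_(f : {ffun 'I_N -> 'I_V}) \sum_(s : 'S_N)
    (-1) ^+ s * \prod_i AB s i (f i)).
  rewrite exchange_big; apply: eq_bigr => /= s _; rewrite -big_distrr /=.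
  congr (_ * _); rewrite -(bigA_distr_bigA (AB s)) /=.
  by apply: eq_bigr => x _; rewrite mxE.
apply: eq_bigr => f _; rewrite mulrC big_distrr /=; apply: eq_bigr => s _.
rewrite mulrCA big_split //=; congr (_ * (_ * _)).
by apply: eq_bigr => x _; rewrite mxE.
Qed.

(** All maps are kept, at the cost of a factor N!, so no increasing representatives have to be
    chosen. Each permutation in the expansion of the first determinant contributes one copy of det
    (A B), once [f] is composed with its inverse. *)
Lemma det_mulmx_sym N V (A : 'M[S]_(N, V)) (B : 'M[S]_(V, N)) :
  N`!%:R * \det (A *m B) = \sum_(f : {ffun 'I_N -> 'I_V})
    \det (\matrix_(i, j) A i (f j)) * \det (\matrix_(i, j) B (f i) j).
Proof.
under eq_bigr do rewrite {1}/determinant mulr_suml.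
rewrite exchange_big /= -card_Sn -sum1_card natr_sum mulr_suml.
apply: eq_big => [s|s _]; first by rewrite inE.
rewrite mul1r det_mulmx_ffun.
pose h (t : 'S_N) (f : {ffun 'I_N -> 'I_V}) := [ffun i => f (t i)].
rewrite [RHS](reindex_inj (h := h (s^-1)%g)); last first.
  move=> f g /ffunP fg; apply/ffunP => i; have := fg (s i).
  by rewrite !ffunE permK.
apply: eq_bigr => f _ /=.
under [in RHS]eq_bigr do rewrite mxE ffunE permK.
have -> : (\matrix_(i, j) B (h s^-1%g f i) j) =
    row_perm s^-1%g (\matrix_(i, j) B (f i) j).
  by apply/matrixP => i j; rewrite !mxE ffunE.
rewrite row_permE det_mulmx det_perm odd_permV.
by rewrite mulrACA -signr_addb addbb expr0 mul1r mulrC.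
Qed.

End CauchyBinet.

Section LeadingTerms.
Variables (N V : nat).
Hypotheses (N_gt0 : (0 < N)%N) (NV : (N < V)%N).
Local Notation FF := {ffun 'I_N -> 'I_V}.
Implicit Types f g : FF.

Definition ffcomp f (s : 'S_N) : FF := [ffun i => f (s i)].

Lemma ffun_eq_image f g : injective f -> injective g ->
  f @: [set: 'I_N] = g @: [set: 'I_N] -> exists s, f = ffcomp g s.
Proof.
move=> f_inj g_inj fg.
have ex i : exists j, g j == f i.
  have : f i \in g @: [set: 'I_N] by rewrite -fg imset_f ?inE.
  by case/imsetP => j _ ->; exists j.
pose h i := xchoose (ex i).
have hP i : g (h i) = f i by apply/eqP; exact: xchooseP (ex i).
have h_inj : injective h by move=> i j hij; apply: f_inj; rewrite -!hP hij.
by exists (perm h_inj); apply/ffunP => i; rewrite ffunE permE hP.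
Qed.

Definition lead0 : FF := [ffun i => widen_ord (ltnW NV) i].

Definition lead1_subproof (i : 'I_N) : ((if i.+1 == N then N else i) < V)%N.
Proof. by case: ifP => // _; apply: leq_trans (ltn_ord i) (ltnW NV). Qed.

Definition lead1 : FF := [ffun i => Ordinal (lead1_subproof i)].

Lemma lead0_inj : injective lead0.
Proof. by move=> i j; rewrite !ffunE => /(congr1 val) /= /val_inj. Qed.

Lemma lead1_inj : injective lead1.
Proof.
move=> i j; rewrite !ffunE => /(congr1 val) /=.
have := ltn_ord i; have := ltn_ord j; move=> jN iN.
by case: eqP => iE; case: eqP => jE ij; apply: val_inj => /=; lia.
Qed.

Definition subleading f :=
  [&& injectiveb f, f \notin [set ffcomp lead0 s | s in 'S_N]
  & f \notin [set ffcomp lead1 s | s in 'S_N]].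

Lemma sum_lead0 : (\sum_i lead0 i = \sum_(i < N) i)%N.
Proof. by apply: eq_bigr => i _; rewrite ffunE. Qed.

Lemma sum_lead1 : (\sum_i lead1 i = (\sum_(i < N) i).+1)%N.
Proof.
have [M NE] : exists M, N = M.+1 by exists N.-1; rewrite prednK.
have lead1E (i : 'I_N) : lead1 i = (if i.+1 == N then N else i) :> nat.
  by rewrite ffunE.
under eq_bigr do rewrite lead1E.
rewrite NE big_ord_recr [in RHS]big_ord_recr /= eqxx -addnS; congr (_ + _)%N.
by apply: eq_bigr => i _; rewrite eqSS ltn_eqF.
Qed.

(** Compare the image P with Q = {0, .., N-1}. Elements of P outside Q are at least N and those of Q
    outside P at most N-1, so each exchange raises the sum by at least one. A single exchange raises
    it by exactly one only when N-1 is traded for N, which is [lead1]. *)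
Lemma subleading_sum f : subleading f ->
  (\sum_(i < N) i + 2 <= \sum_i f i)%N.
Proof.
case/and3P => /injectiveP f_inj f0 f1.
pose I g := g @: [set: 'I_N].
have sumI g : injective g -> (\sum_i g i = \sum_(j in I g) j)%N.
  move=> g_inj; rewrite big_imset /=; last by move=> i j _ _; apply: g_inj.
  by apply: eq_bigl => i; rewrite inE.
have cardI g : injective g -> #|I g| = N.
  by move=> g_inj; rewrite card_imset // cardsT card_ord.
have notI g : injective g -> f \notin [set ffcomp g s | s in 'S_N] -> I f != I g.
  move=> g_inj; apply: contra => /eqP /(ffun_eq_image f_inj g_inj)[s ->].
  by apply/imsetP; exists s.
have := notI _ lead0_inj f0; have := notI _ lead1_inj f1.
rewrite -sum_lead0 !sumI //; last exact: lead0_inj.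
have inT (j : 'I_V) : (j \in I lead0) = (j < N)%N.
  apply/imsetP/idP => [[i _ ->]|jN]; first by rewrite ffunE /=.
  by exists (Ordinal jN) => //; apply: val_inj; rewrite ffunE.
have inT1 (j : 'I_V) : (j \in I lead1) = (j.+1 < N)%N || (j == N :> nat).
  apply/imsetP/idP => [[i _ ->]|].
    rewrite ffunE /=; have := ltn_ord i; case: (i.+1 =P N); lia.
  case/orP => [jN|/eqP jN].
    exists (Ordinal (ltnW jN)) => //; apply: val_inj; rewrite ffunE /=.
    by rewrite ltn_eqF.
  have hN : (N.-1 < N)%N by lia.
  by exists (Ordinal hN) => //; apply: val_inj; rewrite ffunE /= prednK // eqxx.
move=> ne1 ne0.
set P := I f; set Q := I lead0.
have cPQ : #|P :\: Q| = #|Q :\: P|.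
  have := cardsID Q P; have := cardsID P Q.
  rewrite (cardI _ f_inj) (cardI _ lead0_inj) finset.setIC; lia.
have PE : (\sum_(j in P) j = \sum_(j in P :&: Q) j + \sum_(j in P :\: Q) j)%N.
  by rewrite (big_setID Q).
have QE : (\sum_(j in Q) j = \sum_(j in P :&: Q) j + \sum_(j in Q :\: P) j)%N.
  by rewrite (big_setID P) finset.setIC.
rewrite PE QE.
have lo : (#|P :\: Q| * N <= \sum_(j in P :\: Q) j)%N.
  rewrite -sum_nat_const; apply: leq_sum => j; rewrite inE inT; lia.
have hi : (\sum_(j in Q :\: P) j <= #|P :\: Q| * N.-1)%N.
  rewrite cPQ -sum_nat_const; apply: leq_sum => j; rewrite inE inT; lia.
have [k2|] := leqP 2 #|P :\: Q|.
  have : (#|P :\: Q| * N.-1 + #|P :\: Q| = #|P :\: Q| * N)%N.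
    by rewrite -mulnSr prednK.
  lia.
case E : #|P :\: Q| => [|[|//]] _.
  case/negP: ne0; rewrite eqEcard (cardI _ f_inj) (cardI _ lead0_inj) leqnn.
  by rewrite andbT -finset.setD_eq0 -cards_eq0 E.
have /cards1P[s sE] : #|P :\: Q| == 1%N by rewrite E.
have /cards1P[t tE] : #|Q :\: P| == 1%N by rewrite -cPQ E.
rewrite sE tE !big_set1.
have : s \in P :\: Q by rewrite sE set11.
have : t \in Q :\: P by rewrite tE set11.
rewrite !inE !inT => /andP[tP tN] /andP[sN sP].
rewrite -addnA leq_add2l; case: (leqP (t + 2) s) => // ts.
case/negP: ne1; rewrite eqEcard (cardI _ f_inj) (cardI _ lead1_inj) leqnn andbT.
apply/fintype.subsetP => j jP; rewrite inT1.
have [jN|jN] := ltnP j N; last first.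
  have : j \in P :\: Q by rewrite inE inT -leqNgt jN jP.
  rewrite sE inE => /eqP ->; apply/orP; right; lia.
apply/orP; left; case: (leqP j.+2 N) => // jN'.
have jt : j = t by apply: val_inj => /=; lia.
by rewrite -jt jP in tP.
Qed.

(** Invariance makes X constant on the orbits of the two leading maps, each of size N!; this is the
    factor that cancels against the one in the symmetrized formula. *)
Lemma sum_leading (Z : zmodType) (X : FF -> Z) :
  (forall f s, X (ffcomp f s) = X f) -> (forall f, ~~ injectiveb f -> X f = 0) ->
  \sum_f X f = (X lead0 + X lead1) *+ N`! + \sum_(f | subleading f) X f.
Proof.
move=> Xs Xinj.
have sum_orb g : injective g ->
    \sum_(f in [set ffcomp g s | s in 'S_N]) X f = X g *+ N`!.
  move=> g_inj; rewrite big_imset /=; last first.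
    move=> s t _ _ /ffunP st; apply/permP => i; apply: g_inj.
    by have := st i; rewrite !ffunE.
  under eq_bigr do rewrite Xs.
  by rewrite big_const -card_Sn iter_addr_0; congr (_ *+ _); apply: eq_card.
rewrite (bigID (fun f => f \in [set ffcomp lead0 s | s in 'S_N])) /=.
rewrite sum_orb; last exact: lead0_inj.
rewrite (bigID (fun f => f \in [set ffcomp lead1 s | s in 'S_N])) /=.
have <- : \sum_(f in [set ffcomp lead1 s | s in 'S_N]) X f =
   \sum_(f | (f \notin [set ffcomp lead0 s | s in 'S_N]) &&
             (f \in [set ffcomp lead1 s | s in 'S_N])) X f.
  (* The two orbits are disjoint, because the values of [lead0] and [lead1] have sums that differ by
     one. *)
  apply: eq_bigl => f; symmetry; apply: andb_idl => /imsetP[s _ ->].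
  apply/imsetP => -[t _ /(congr1 (fun f : FF => \sum_i f i)%N)].
  have sumc g u : (\sum_i ffcomp g u i = \sum_i g i)%N.
    rewrite [RHS](reindex_inj (@perm_inj _ u)) /=.
    by apply: eq_bigr => i _; rewrite ffunE.
  rewrite !sumc sum_lead0 sum_lead1; lia.
rewrite sum_orb; last exact: lead1_inj.
rewrite addrA mulrnDl; congr (_ + _).
rewrite (bigID (fun f => injectiveb f)) /= addrC big1 ?add0r; last first.
  by move=> f /andP[_]; apply: Xinj.
by apply: eq_bigl => f; rewrite /subleading andbC andbA.
Qed.

End LeadingTerms.

(** * The characteristic equation *)

Section Characteristic.
Variables (R : realType) (n : nat) (lam0 : R[i]).
Local Notation C := R[i].
Local Notation Re := complex.Re.
Local Notation Im := complex.Im.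
Local Notation chi0 := (chi0 n lam0).
Local Notation chi0c := (chi0^*%C).
Hypothesis Im_lam0 : Im lam0 != 0.
Implicit Types k : 'I_n.

Lemma expiX (theta : R) m : expi theta ^+ m = expi (m%:R * theta).
Proof.
elim: m => [|m IH]; first by rewrite mul0r /expi cos0 sin0.
rewrite exprS IH -[m.+1]add1n natrD mulrDl mul1r /expi cosD sinD.
rewrite -[LHS]/((_ - _) +i* (_ + _)).
by congr (_ +i* _); rewrite addrC [cos _ * _]mulrC.
Qed.

Lemma sin_pi_nat m : sin (m%:R * pi : R) = 0.
Proof.
elim: m => [|m IH]; first by rewrite mul0r sin0.
by rewrite -[m.+1]addn1 natrD mulrDl mul1r sinD IH sinpi mulr0 mul0r addr0.
Qed.

Lemma Im_chi0 : Im chi0 = 2 * Im lam0 / n.+1%:R. Proof. by []. Qed.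

Lemma Im_chi0_neq0 : Im chi0 != 0.
Proof. by rewrite Im_chi0 !mulf_neq0 ?invr_eq0 ?pnatr_eq0. Qed.

Lemma ang_itv k : 0 < ang R k < pi.
Proof.
have pi0 := pi_gt0 R.
rewrite /ang divr_gt0 ?mulr_gt0 ?ltr0n //= ltr_pdivrMr ?ltr0n // mulrC.
by rewrite ltr_pM2l // ltr_nat ltnS ltn_ord.
Qed.

Lemma sin_ang_gt0 k : 0 < sin (ang R k).
Proof. exact: sin_gt0_pi (ang_itv k). Qed.

(** Rests on cot + i = e^(i ang) / sin, which explains the cotangent in b_k. *)
Lemma root_sub_chi0 k :
  - (b_ lam0 k)%:C - chi0 = (- (Im chi0 / sin (ang R k)))%:C * expi (ang R k).
Proof.
have s0 := lt0r_neq0 (sin_ang_gt0 k).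
apply/eqP; rewrite eq_complex /= /b_; apply/andP; split; apply/eqP; last first.
  by rewrite !mul0r addr0 mulNr divfK // oppr0 add0r.
have := pnatr_eq0 R n.+1; move: (n.+1%:R) => m m0.
by field; rewrite s0 m0.
Qed.

Lemma root_sub_chi0_conj k :
  - (b_ lam0 k)%:C - chi0c = (- (b_ lam0 k)%:C - chi0)^*%C.
Proof. by apply/eqP; rewrite eq_complex /= !opprD !opprK !oppr0 !eqxx. Qed.

Lemma root_sub_chi0X k :
  (- (b_ lam0 k)%:C - chi0c) ^+ n.+1 = (- (b_ lam0 k)%:C - chi0) ^+ n.+1.
Proof.
rewrite root_sub_chi0_conj -rmorphXn root_sub_chi0 exprMn expiX -rmorphXn.
have -> : n.+1%:R * ang R k = k.+1%:R * pi by rewrite /ang mulrC divfK ?pnatr_eq0.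
rewrite /expi sin_pi_nat rmorphM; congr (_ * _); apply/eqP.
  by rewrite eq_complex /= oppr0 !eqxx.
by rewrite eq_complex /= oppr0 !eqxx.
Qed.

Lemma root_sub_chi0_norm k :
  (- (b_ lam0 k)%:C - chi0) * (- (b_ lam0 k)%:C - chi0c) = (a_ lam0 k ^+ 2)%:C.
Proof.
have s0 := lt0r_neq0 (sin_ang_gt0 k).
rewrite root_sub_chi0_conj root_sub_chi0; have cs := cos2Dsin2 (ang R k).
apply/eqP; rewrite eq_complex /= /a_; apply/andP; split; apply/eqP; last first.
  by rewrite !mul0r !addr0 !subr0; ring.
rewrite !mul0r !addr0 !subr0.
transitivity ((2 * Im lam0 / n.+1%:R / sin (ang R k)) ^+ 2 *
    (cos (ang R k) ^+ 2 + sin (ang R k) ^+ 2)); last by rewrite cs mulr1.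
by ring.
Qed.

(** Equal cotangents make the sine of the difference of the angles vanish, and that difference lies
    strictly between -pi and pi. *)
Lemma b_inj : injective (@b_ R n lam0).
Proof.
move=> j k /(congr1 (fun x : R => x + 2 * Re lam0)); rewrite !subrK => /mulfI.
rewrite -Im_chi0 => /(_ Im_chi0_neq0) cjk.
have sj := lt0r_neq0 (sin_ang_gt0 j); have sk := lt0r_neq0 (sin_ang_gt0 k).
have sjk : sin (ang R j - ang R k) = 0.
  rewrite sinD cosN sinN mulrN; apply/eqP; rewrite subr_eq0; apply/eqP.
  move/(congr1 (fun x => x * sin (ang R j) * sin (ang R k))): cjk.
  rewrite divfK // mulrAC divfK // => ->; ring.
have /andP[j0 jpi] := ang_itv j; have /andP[k0 kpi] := ang_itv k.
have ajk : ang R j = ang R k.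
  case: (ltrgtP (ang R j) (ang R k)) => // jk.
    have : 0 < sin (ang R k - ang R j) by apply: sin_gt0_pi; lra.
    by rewrite -opprB sinN sjk oppr0 ltxx.
  have : 0 < sin (ang R j - ang R k) by apply: sin_gt0_pi; lra.
  by rewrite sjk ltxx.
apply: val_inj => /=; move: ajk; rewrite /ang => /mulIf.
rewrite invr_eq0 pnatr_eq0 => /(_ isT) /mulIf.
by rewrite (gt_eqF (pi_gt0 R)) => /(_ isT) /eqP; rewrite eqr_nat eqSS => /eqP.
Qed.

Lemma chi0_sub_conj : chi0 - chi0c = (2 * Im chi0)%:C * 'i%C.
Proof.
apply/eqP; rewrite eq_complex /= opprK; apply/andP; split; apply/eqP; ring.
Qed.

Lemma chi0_sub_conj_neq0 : chi0 - chi0c != 0.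
Proof.
rewrite chi0_sub_conj mulf_neq0 // ?fmorph_eq0 ?mulf_neq0 ?pnatr_eq0 ?Im_chi0_neq0 //.
by rewrite eq_complex /= oner_eq0 andbF.
Qed.

Lemma chi0_add_b_neq0 k : chi0 + (b_ lam0 k)%:C != 0.
Proof.
rewrite eq_complex negb_and; apply/orP; right.
by rewrite [Im _]/= addr0; exact: Im_chi0_neq0.
Qed.

Definition bpoly : {poly C} := \prod_(j < n) ('X + (b_ lam0 j)%:C%:P).
Definition bpoly' (i : 'I_n) : {poly C} :=
  \prod_(j < n | j != i) ('X + (b_ lam0 j)%:C%:P).

Local Notation gap := (n.+1%:R * (chi0 - chi0c)).

Lemma gap_neq0 : gap != 0.
Proof. by rewrite mulf_neq0 ?pnatr_eq0 // chi0_sub_conj_neq0. Qed.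

Let roots := [seq - (b_ lam0 j)%:C | j : 'I_n].

Let roots_uniq : uniq roots.
Proof.
rewrite map_inj_uniq ?enum_uniq // => j k /oppr_inj /complexI; exact: b_inj.
Qed.

Let size_roots : size roots = n. Proof. by rewrite size_map -cardE card_ord. Qed.

Let bpolyE : bpoly = \prod_(z <- roots) ('X - z%:P).
Proof.
rewrite big_map big_enum /=; apply: eq_bigr => j _.
by rewrite polyCN opprK.
Qed.

(** Both sides have degree n with the same coefficient of X^n and share the n distinct roots -b_k.
    The identity trades the product of the X + b_j for pure powers. *)
Lemma gap_bpoly : gap *: bpoly = ('X - chi0c%:P) ^+ n.+1 - ('X - chi0%:P) ^+ n.+1.
Proof.
set Q := RHS; symmetry; apply/eqP; rewrite -subr_eq0; apply/eqP.
have coefX (z : C) : (('X - z%:P) ^+ n.+1)`_n = - (n.+1%:R * z).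
  have -> : n.+1%:R * z = \sum_(p <- nseq n.+1 z) p.
    by rewrite big_nseq iter_addr_0 mulr_natl.
  rewrite -coefPn_prod_XsubC ?size_nseq //.
  by rewrite big_nseq iter_mulr_1.
have lead (z : C) : (('X - z%:P) ^+ n.+1)`_n.+1 = 1.
  have /monicP := monic_exp n.+1 (monicXsubC z).
  by rewrite /lead_coef size_exp_XsubC.
have sizeb : size bpoly = n.+1 by rewrite bpolyE size_prod_XsubC size_roots.
have szQ : (size (Q - gap *: bpoly)%R <= n)%N.
  apply/leq_sizeP => j; rewrite leq_eqVlt => /orP[/eqP <-|].
    rewrite coefB coefZ coefB !coefX.
    have -> : bpoly`_n = 1.
      by have /monicP := monic_prod_XsubC roots xpredT id; rewrite -bpolyE /lead_coef sizeb.
    ring.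
  rewrite leq_eqVlt => /orP[/eqP <-|nj].
    by rewrite coefB coefZ coefB !lead [bpoly`__]nth_default ?sizeb // subrr mulr0 subr0.
  rewrite coefB coefZ coefB !nth_default ?size_exp_XsubC ?sizeb // ?(ltnW nj) //.
  by rewrite subrr mulr0 subr0.
apply: (roots_geq_poly_eq0 _ roots_uniq); last by rewrite size_roots.
apply/allP => z /mapP[j _ ->]; rewrite rootE hornerD hornerN hornerZ.
rewrite bpolyE (_ : (\prod_(z <- roots) _).[_] = 0) ?mulr0 ?subr0; last first.
  by apply/eqP; rewrite -rootE root_prod_XsubC; apply/mapP; exists j; rewrite ?mem_enum.
by rewrite /Q !hornerE root_sub_chi0X subrr.
Qed.

Local Notation w k := (- (b_ lam0 k)%:C).

Lemma bpolyD i : bpoly = ('X - (w i)%:P) * bpoly' i.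
Proof. by rewrite /bpoly (bigD1 i) //= polyCN opprK. Qed.

Lemma bpoly'_root i j : j != i -> (bpoly' i).[w j] = 0.
Proof.
move=> ji; rewrite /bpoly' (bigD1 j) //= hornerM hornerD hornerX hornerC.
by rewrite addNr mul0r.
Qed.

(** The value of [bpoly' i] at -b_i is the derivative of [bpoly] there, read off by differentiating
    [gap_bpoly], and a_i^2 splits by [root_sub_chi0_norm]. Consequently [charpoly] agrees with (X -
    chi_0)^(n+1) at -b_i. *)
Lemma bpoly'_at i : (a_ lam0 i ^+ 2)%:C * (bpoly' i).[w i] = - (w i - chi0) ^+ n.+1.
Proof.
have dE : gap * (bpoly' i).[w i] =
    n.+1%:R * ((w i - chi0c) ^+ n - (w i - chi0) ^+ n).
  have := congr1 (fun p => (p^`()).[w i]) gap_bpoly.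
  rewrite derivZ hornerZ (bpolyD i) derivM hornerD !hornerM derivXsubC.
  rewrite hornerXsubC subrr mul0r addr0 hornerC mul1r => ->.
  rewrite derivB !deriv_exp !derivXsubC !mul1r /= hornerD hornerN !hornerMn.
  by rewrite !horner_exp !hornerXsubC mulrBr !mulr_natl.
apply: (mulfI gap_neq0); rewrite -root_sub_chi0_norm mulrCA dE.
transitivity (n.+1%:R * ((w i - chi0c) ^+ n.+1 * (w i - chi0) -
    (w i - chi0) ^+ n.+1 * (w i - chi0c))).
  by rewrite !exprS; ring.
by rewrite root_sub_chi0X; ring.
Qed.

Definition charpoly : {poly C} :=
  ('X - (2 * lam0)%:P) * bpoly - \sum_(i < n) (a_ lam0 i ^+ 2)%:C *: bpoly' i.

(* The difference of the two sides has degree at most [n] and vanishes at the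
   [n + 1] distinct points [chi0] and [- b_k]. *)
Lemma charpolyE : charpoly.[chi0] = 0 -> charpoly = ('X - chi0%:P) ^+ n.+1.
Proof.
move=> F0; apply/eqP; rewrite -subr_eq0; apply/eqP.
have bmonic : bpoly \is monic by rewrite bpolyE monic_prod_XsubC.
have sizeb : size bpoly = n.+1 by rewrite bpolyE size_prod_XsubC size_roots.
have sizeF1 : size (('X - (2 * lam0)%:P) * bpoly) = n.+2.
  by rewrite size_monicM ?monicXsubC ?monic_neq0 // size_XsubC sizeb.
have leadF1 : (('X - (2 * lam0)%:P) * bpoly)`_n.+1 = 1.
  have := lead_coefM ('X - (2 * lam0)%:P) bpoly.
  by rewrite lead_coefXsubC (monicP bmonic) mulr1 /lead_coef sizeF1.
have szS : (size (\sum_(i < n) (a_ lam0 i ^+ 2)%:C *: bpoly' i)%R <= n.+1)%N.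
  apply: (leq_trans (size_sum _ _ _)); apply/bigmax_leqP => i _.
  apply: (leq_trans (size_scale_leq _ _)).
  have := sizeb; rewrite (bpolyD i) size_monicM ?monicXsubC //; last first.
    apply: contra_eq_neq (bpolyD i) => ->; rewrite mulr0; exact: monic_neq0.
  by rewrite size_XsubC add2n => -[->].
have lead : (('X - chi0%:P) ^+ n.+1)`_n.+1 = 1.
  have /monicP := monic_exp n.+1 (monicXsubC chi0).
  by rewrite /lead_coef size_exp_XsubC.
have szD : (size (charpoly - ('X - chi0%:P) ^+ n.+1)%R <= n.+1)%N.
  apply/leq_sizeP => j; rewrite leq_eqVlt => /orP[/eqP <-|nj].
    by rewrite !coefB leadF1 lead [X in _ - X - _]nth_default // subr0 subrr.
  rewrite !coefB !nth_default ?size_exp_XsubC ?sizeF1 ?subr0 //.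
  exact: leq_trans szS (ltnW nj).
apply: (@roots_geq_poly_eq0 _ _ (chi0 :: roots)); last by rewrite /= size_roots.
  apply/allP => z; rewrite inE => /orP[/eqP ->|/mapP[j _ ->]].
    by rewrite rootE hornerD F0 hornerN !hornerE subrr expr0n ?oppr0 ?addr0.
  rewrite rootE hornerD hornerN /charpoly hornerD hornerN hornerM (bpolyD j).
  rewrite [(('X - (w j)%:P) * _).[_]]hornerM [('X - (w j)%:P).[_]]hornerXsubC.
  rewrite subrr mul0r mulr0 add0r.
  rewrite horner_sum (bigD1 j) //= big1 => [|i ij]; last first.
    by rewrite hornerZ bpoly'_root ?mulr0 // eq_sym.
  by rewrite addr0 hornerZ bpoly'_at opprK !hornerE subrr.
rewrite /= roots_uniq andbT; apply/mapP => -[j _ /eqP].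
by rewrite -subr_eq0 opprK (negPf (chi0_add_b_neq0 j)).
Qed.

End Characteristic.

(** * Power series substituted into polynomials *)

Section SeriesEval.
Variable S : fieldType.
Local Notation F := (fps S).

Definition fpsX : F := fun m => (m == 1%N)%:R.

Lemma fpsX_coefM (f : F) m : (fpsX * f) m = if m is m'.+1 then f m' else 0.
Proof.
case: m => [|m]; first by rewrite fps_coefM big_ord1 /fpsX mul0r.
rewrite fps_coefM !big_ord_recl /fpsX mul0r add0r mul1r big1 ?addr0.
  by rewrite lift0 subSS subn0.
by move=> i _; rewrite !lift0 mul0r.
Qed.

Lemma fpsXn_coef k m : (fpsX ^+ k) m = (m == k)%:R.
Proof.
elim: k m => [|k IH] m; first by case: m.
by rewrite exprS fpsX_coefM; case: m => // m; rewrite IH.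
Qed.

Lemma fpsXn_coefM (f : F) k m : (fpsX ^+ k * f) (k + m)%N = f m.
Proof. by elim: k => [|k IH]; rewrite ?mul1r // exprS -mulrA addSn fpsX_coefM. Qed.

Lemma fps_coefB (f g : F) m : (f - g) m = f m - g m. Proof. by []. Qed.

Lemma fpsC_coef0 (c : S) : fpsC c 0%N = c. Proof. by []. Qed.

Lemma fpsC_coefS (c : S) m : fpsC c m.+1 = 0. Proof. by []. Qed.

Lemma fps_coef0M (f g : F) : (f * g) 0%N = f 0%N * g 0%N.
Proof. by rewrite fps_coefM big_ord1. Qed.

Lemma fps_coef1M (f g : F) : (f * g) 1%N = f 0%N * g 1%N + f 1%N * g 0%N.
Proof. by rewrite fps_coefM !big_ord_recl big_ord0 addr0 lift0. Qed.

Lemma fps_coef0X (f : F) k : (f ^+ k) 0%N = f 0%N ^+ k.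
Proof. by elim: k => [//|k IH]; rewrite !exprS fps_coef0M IH. Qed.

Lemma fps_coef1X (f : F) k : (f ^+ k.+1) 1%N = k.+1%:R * f 0%N ^+ k * f 1%N.
Proof.
elim: k => [|k IH]; first by rewrite expr1 !mul1r.
rewrite exprS fps_coef1M IH fps_coef0X !exprS -[k.+2]add1n natrD; ring.
Qed.

Definition fps_eval (f : F) (p : {poly S}) : F := (map_poly (@fpsC S) p).[f].

Lemma fps_evalM f p q : fps_eval f (p * q) = fps_eval f p * fps_eval f q.
Proof. by rewrite /fps_eval rmorphM hornerM. Qed.

Lemma fps_evalB f p q : fps_eval f (p - q) = fps_eval f p - fps_eval f q.
Proof. by rewrite /fps_eval rmorphB hornerD hornerN. Qed.

Lemma fps_evalXn f p k : fps_eval f (p ^+ k) = fps_eval f p ^+ k.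
Proof. by rewrite /fps_eval rmorphXn horner_exp. Qed.

Lemma fps_evalZ f c p : fps_eval f (c *: p) = fpsC c * fps_eval f p.
Proof. by rewrite /fps_eval map_polyZ hornerZ. Qed.

Lemma fps_eval_sum f (I : Type) (r : seq I) (P : pred I) (G : I -> {poly S}) :
  fps_eval f (\sum_(i <- r | P i) G i) = \sum_(i <- r | P i) fps_eval f (G i).
Proof. by rewrite /fps_eval rmorph_sum horner_sum. Qed.

Lemma fps_eval_prod f (I : Type) (r : seq I) (P : pred I) (G : I -> {poly S}) :
  fps_eval f (\prod_(i <- r | P i) G i) = \prod_(i <- r | P i) fps_eval f (G i).
Proof. by rewrite /fps_eval rmorph_prod horner_prod. Qed.

Lemma fps_evalXsubC f c : fps_eval f ('X - c%:P) = f - fpsC c.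
Proof. by rewrite /fps_eval rmorphB /= map_polyX map_polyC hornerXsubC. Qed.

Lemma fps_evalXaddC f c : fps_eval f ('X + c%:P) = f + fpsC c.
Proof. by rewrite /fps_eval rmorphD /= map_polyX map_polyC hornerD hornerX hornerC. Qed.

Lemma fps_eval_coef0 f p : fps_eval f p 0%N = p.[f 0%N].
Proof.
elim/poly_ind: p => [|p c IH]; first by rewrite /fps_eval rmorph0 !horner0.
rewrite hornerMXaddC -IH /fps_eval rmorphD rmorphM /= map_polyX map_polyC hornerMXaddC.
by rewrite -[LHS]/((_ * f) 0%N + c) fps_coef0M.
Qed.

Lemma fps_gap_coef0 (f g : F) (a a' u v : S) m : f 0%N = a ->
  fpsC u * g ^+ m.+1 = fpsC v * ((f - fpsC a') ^+ m.+1 - (f - fpsC a) ^+ m.+1) ->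
  u * g 0%N ^+ m.+1 = v * (a - a') ^+ m.+1.
Proof.
move=> f0 /(congr1 (fun h : F => h 0%N)); rewrite !fpsCM fps_coef0X => ->.
rewrite fps_coefB !fps_coef0X !fps_coefB !fpsC_coef0 f0 subrr.
by rewrite [0 ^+ _]exprS mul0r subr0.
Qed.

(** Since f - a has no constant term, its (m+1)-st power starts at eps^(m+1), beyond the coefficient
    compared here. *)
Lemma fps_gap_coef1 (f g : F) (a a' u v : S) m : (0 < m)%N -> f 0%N = a ->
  fpsC u * g ^+ m.+1 = fpsC v * ((f - fpsC a') ^+ m.+1 - (f - fpsC a) ^+ m.+1) ->
  u * (m.+1%:R * g 0%N ^+ m * g 1%N) = v * (m.+1%:R * (a - a') ^+ m * f 1%N).
Proof.
move=> m0 f0 /(congr1 (fun h : F => h 1%N)); rewrite !fpsCM fps_coef1X => ->.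
rewrite fps_coefB !fps_coef1X !fps_coefB !fpsC_coef0 !fpsC_coefS !subr0 f0 subrr.
by rewrite expr0n (gtn_eqF m0) mulr0 mul0r subr0.
Qed.

End SeriesEval.

(** * The first coefficients of chi and the vanishing of h_(1,1) *)

Section Perturbation.
Variables (R : realType) (n : nat) (lam0 lam1 : R[i]) (chi : nat -> R[i]).
Local Notation C := R[i].
Local Notation Re := complex.Re.
Local Notation Im := complex.Im.
Local Notation chi0 := (chi0 n lam0).
Local Notation chi0c := (chi0^*%C).
Local Notation F := (fps C).
Hypotheses (n_ge1 : (1 <= n)%N) (Im_lam0 : Im lam0 != 0) (lam1_neq0 : lam1 != 0).
Hypothesis chiP : chi_expansion n lam0 lam1 chi.
Let X : F := chi.

Lemma chi_at0 : chi 0%N = chi0. Proof. by case: chiP. Qed.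

Let X0 : X 0%N = chi0. Proof. exact: chi_at0. Qed.

(** lambda enters only through -2 lambda times the product of the chi + b_j; moving its eps^(n+1)
    part to the right leaves the polynomial for lambda_0 on the left. *)
Lemma chareq_fps : fps_eval X (charpoly n lam0) =
  fpsC (2 * lam1) * fpsX C ^+ n.+1 * fps_eval X (bpoly n lam0).
Proof.
have [_ charP] := chiP.
pose B (j : 'I_n) : F := fps_addc chi (b_ lam0 j)%:C.
have BE j : fps_eval X ('X + (b_ lam0 j)%:C%:P) = B j by rewrite fps_evalXaddC.
have lamE : (lam n lam0 lam1 : F) = fpsC lam0 + fpsC lam1 * fpsX C ^+ n.+1.
  apply/funext => m; rewrite -[RHS]/(fpsC lam0 m + (fpsC lam1 * fpsX C ^+ n.+1) m).
  rewrite fpsCM fpsXn_coef /lam /fpsC /fps_const; case: m => [|m] /=.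
    by rewrite mulr0 addr0.
  by rewrite add0r; case: eqP; rewrite ?mulr1 ?mulr0.
have lhsE : (chareq_lhs n lam0 lam1 chi : F) =
    (X - fpsC 2 * (lam n lam0 lam1 : F) -
      \sum_(i < n) fpsC ((a_ lam0 i ^+ 2)%:C) * (fps_inv (B i) : F)) *
    \prod_(j < n) B j.
  rewrite /chareq_lhs fps_mulE; congr (_ * _); apply/funext => m.
  rewrite -[RHS]/(chi m - (fpsC 2 * (lam n lam0 lam1 : F)) m -
    (\sum_(i < n) fpsC ((a_ lam0 i ^+ 2)%:C) * (fps_inv (B i) : F)) m).
  rewrite fpsCM fps_coef_sum; congr (_ - _).
  by apply: eq_bigr => i _; rewrite fpsCM.
have lhsE0 : (chareq_lhs n lam0 lam1 chi : F) = 0 by apply/funext => m; apply: charP.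
have invB i : (fps_inv (B i) : F) * B i = 1.
  apply: fps_mulVr; rewrite unitfE -[B i 0%N]/(chi 0%N + (b_ lam0 i)%:C) chi_at0.
  exact: chi0_add_b_neq0.
have PE : fps_eval X (bpoly n lam0) = \prod_(j < n) B j.
  by rewrite fps_eval_prod; apply: eq_bigr => j _.
apply/eqP; rewrite -subr_eq0 -[X in _ == X]lhsE0 lhsE; apply/eqP.
rewrite /charpoly fps_evalB fps_evalM fps_evalXsubC PE [in RHS]mulrBl lamE.
rewrite mulr_suml fps_eval_sum.
have -> : \sum_(i < n) fpsC ((a_ lam0 i ^+ 2)%:C) * (fps_inv (B i) : F) * \prod_(j < n) B j
   = \sum_(i < n) fps_eval X ((a_ lam0 i ^+ 2)%:C *: bpoly' lam0 i).
  apply: eq_bigr => i _; rewrite fps_evalZ fps_eval_prod -mulrA; congr (_ * _).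
  rewrite (bigD1 i) //= mulrA invB mul1r; apply: eq_bigr => j _.
  by rewrite BE.
by rewrite !rmorphM /=; ring.
Qed.

Lemma chi_sub_chi0X : (X - fpsC chi0) ^+ n.+1 =
  fpsC (2 * lam1) * fpsX C ^+ n.+1 * fps_eval X (bpoly n lam0).
Proof.
rewrite -chareq_fps charpolyE //; first by rewrite fps_evalXn fps_evalXsubC.
(* The constant coefficient of the equation says that chi_0 is a root of [charpoly]; its
   multiplicity n + 1 then comes from [charpolyE]. *)
rewrite -chi_at0 -[chi 0%N]/(X 0%N) -fps_eval_coef0 chareq_fps.
by rewrite 2!fps_coef0M fps_coef0X (_ : fpsX C 0%N = 0) // exprS mul0r mulr0 mul0r.
Qed.

Let y : F := fun m => chi m.+1.

Let yX : y ^+ n.+1 = fpsC (2 * lam1) * fps_eval X (bpoly n lam0).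
Proof.
have yE : X - fpsC chi0 = fpsX C * y.
  apply/funext => m; rewrite fpsX_coefM fps_coefB.
  by case: m => [|m]; rewrite ?fpsC_coef0 ?fpsC_coefS ?X0 ?subrr ?subr0.
apply/funext => m; rewrite -(fpsXn_coefM _ n.+1) -exprMn -yE chi_sub_chi0X.
by rewrite mulrAC -mulrA -[RHS](fpsXn_coefM _ n.+1) [in RHS]mulrC mulrA.
Qed.

(** Here y = (chi - chi_0) / eps. The product of the chi + b_j becomes a difference of powers, whose
    first two coefficients are explicit. *)
Let yX_gap : fpsC (n.+1%:R * (chi0 - chi0c)) * y ^+ n.+1 =
  fpsC (2 * lam1) * ((X - fpsC chi0c) ^+ n.+1 - (X - fpsC chi0) ^+ n.+1).
Proof.
rewrite yX mulrCA -fps_evalZ gap_bpoly // fps_evalB !fps_evalXn.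
by rewrite !fps_evalXsubC.
Qed.

Let chi1X : n.+1%:R * (chi0 - chi0c) * chi 1%N ^+ n.+1 =
  2 * lam1 * (chi0 - chi0c) ^+ n.+1.
Proof. exact: fps_gap_coef0 X0 yX_gap. Qed.

Lemma chi1_neq0 : chi 1%N != 0.
Proof.
have : 2 * lam1 * (chi0 - chi0c) ^+ n.+1 != 0.
  by rewrite !mulf_neq0 ?expf_neq0 ?pnatr_eq0 // chi0_sub_conj_neq0.
rewrite -chi1X; apply: contraNneq => ->.
by rewrite exprS mul0r mulr0.
Qed.

(** Obtained by comparing the coefficient of eps in [yX_gap] with its constant coefficient
    [chi1X]. *)
Lemma chi2E : chi 2 * (chi0 - chi0c) = chi 1%N ^+ 2.
Proof.
have := fps_gap_coef1 n_ge1 X0 yX_gap.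
rewrite -[y 0%N]/(chi 1%N) -[y 1%N]/(chi 2) -[X 1%N]/(chi 1%N).
have c0 : chi0 - chi0c != 0 by exact: chi0_sub_conj_neq0.
move: c0 chi1X chi1_neq0; move: (chi0 - chi0c) (chi 1%N) (chi 2) => c x1 x2.
move=> c0 e1 x10 e2.
have n0 : (n.+1%:R : C) != 0 by rewrite pnatr_eq0.
have u0 : n.+1%:R * c * x1 ^+ n * n.+1%:R != 0 by rewrite !mulf_neq0 ?expf_neq0.
apply: (mulfI u0).
transitivity ((n.+1%:R * c * (n.+1%:R * x1 ^+ n * x2)) * c); first by ring.
rewrite e2; transitivity (n.+1%:R * (2 * lam1 * c ^+ n.+1) * x1).
  by rewrite exprS; ring.
by rewrite -e1 exprS; ring.
Qed.

(* Otherwise the rogue waves would be displaced by an extra multiple of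
   [(N - 1) h1 1]. *)
Lemma h1_1 : h1 n lam0 chi 1%N = 0.
Proof.
rewrite /h1 fps_ln_coef1 fps_mulE.
pose I : F := fps_inv (fps_addc chi (- chi0c)).
have c0 : chi0 - chi0c != 0 by exact: chi0_sub_conj_neq0.
have IM : I * (X - fpsC chi0c) = 1.
  rewrite (_ : X - fpsC chi0c = fps_addc chi (- chi0c)); last first.
    apply/funext => m; rewrite -[LHS]/(chi m - fps_const chi0c m) /fps_addc /fps_const.
    by case: eqP; rewrite ?oppr0.
  apply: fps_mulVr; rewrite unitfE.
  by rewrite -[fps_addc _ _ _]/(chi 0%N - chi0c) chi_at0.
have I0 : I 0%N = (chi0 - chi0c)^-1.
  have := congr1 (fun f : F => f 0%N) IM.
  rewrite fps_coef0M fps_coefB fpsC_coef0 X0 => e.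
  by apply: (mulIf c0); rewrite mulVf.
have I1 : I 1%N = - chi 1%N / (chi0 - chi0c) ^+ 2.
  have := congr1 (fun f : F => f 1%N) IM.
  rewrite fps_coef1M I0 !fps_coefB fpsC_coef0 fpsC_coefS X0 subr0.
  rewrite -[X 1%N]/(chi 1%N); move: (chi0 - chi0c) c0 (chi 1%N) (I 1%N) => c c0' x1 i1.
  move=> /eqP; rewrite addrC addr_eq0 => /eqP e; apply: (mulIf c0'); rewrite e.
  by field.
rewrite fps_coef1M -[fps_inv _]/I I0 I1.
have := chi2E; have := chi1_neq0; move: c0; rewrite /=.
move: (chi0 - chi0c) (chi 1%N) (chi 2) => c x1 x2 c0 x10 e.
have -> : x2 = x1 ^+ 2 / c by rewrite -e mulfK.
by field; rewrite c0 x10.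
Qed.

Lemma h2_1 (k : 'I_n) : h2 lam0 chi k 1%N = chi 1%N / (chi0 + (b_ lam0 k)%:C).
Proof. by rewrite /h2 fps_ln_coef1 /fps_addc /fps_const /= addr0. Qed.

Lemma alpha1 : alpha n lam0 lam1 chi 1 = 'i%C * chi 1%N.
Proof. by rewrite /alpha /lam /= eqSS eq_sym (gtn_eqF n_ge1) subr0. Qed.

Lemma beta1 : beta n lam0 lam1 chi 1 = chi0 * chi 1%N.
Proof.
have l1 : lam n lam0 lam1 1%N = 0 by rewrite /lam /= eqSS eq_sym (gtn_eqF n_ge1).
rewrite /beta !fps_mulE !fps_coef1M l1 mulr0 mul0r addr0 subr0 chi_at0.
by rewrite /fps_const /= subr0; field.
Qed.

End Perturbation.

(** * The generalized mixed Adler-Moser polynomial *)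

Section PolyProd.
Variable S : idomainType.

Lemma size_prod_leq_sum (I : Type) (r : seq I) (p : I -> {poly S}) (m : I -> nat) :
  (forall i, size (p i) <= (m i).+1)%N ->
  (size (\prod_(i <- r) p i)%R <= (\sum_(i <- r) m i).+1)%N.
Proof.
move=> pm; elim: r => [|i r IH]; first by rewrite !big_nil size_poly1.
rewrite !big_cons; apply: (leq_trans (size_polyMleq _ _)).
by have := pm i; move: IH; case: (size (p i)) => [|a]; case: (size _) => [|b]; lia.
Qed.

Lemma coef_prod_sum (I : Type) (r : seq I) (p : I -> {poly S}) (m : I -> nat) :
  (forall i, size (p i) <= (m i).+1)%N ->
  (\prod_(i <- r) p i)`_(\sum_(i <- r) m i)%N = \prod_(i <- r) (p i)`_(m i).
Proof.
move=> pm; elim: r => [|i r IH]; first by rewrite !big_nil coef1.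
have szr := size_prod_leq_sum r pm; rewrite !big_cons coefM -IH.
rewrite (bigD1 (inord (m i))) //= inordK ?ltnS ?leq_addr // addKn [X in _ + X]big1 ?addr0 //.
move=> j; rewrite -val_eqE /= inordK ?ltnS ?leq_addr // => jm.
have [jlt|jge] := ltnP j (m i).
  by rewrite [X in _ * X]nth_default ?mulr0 //; apply: leq_trans szr _; lia.
by rewrite [X in X * _]nth_default ?mul0r //; apply: leq_trans (pm i) _; lia.
Qed.

Lemma deriv_prod_ord N (p : 'I_N -> {poly S}) :
  (\prod_(i < N) p i)^`() =
  \sum_(i < N) \prod_(k < N) (if k == i then (p k)^`() else p k).
Proof.
elim: N p => [|N IH] p; first by rewrite !big_ord0 derivC.
rewrite !big_ord_recl derivM IH; congr (_ * _ + _).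
rewrite mulr_sumr; apply: eq_bigr => i _; rewrite big_ord_recl /=.
by congr (_ * _); apply: eq_bigr => k _; rewrite (inj_eq (@lift_inj _ ord0)).
Qed.

Lemma deriv_det N (M : 'M[{poly S}]_N) : (\det M)^`() =
  \sum_(i < N) \det (\matrix_(k, j) (if k == i then (M k j)^`() else M k j)).
Proof.
rewrite /determinant raddf_sum exchange_big /=; apply: eq_bigr => s _.
have -> (b : bool) (q : {poly S}) : ((-1) ^+ b * q)^`() = (-1) ^+ b * q^`().
  by case: b; rewrite ?expr1 ?mulN1r ?derivN ?expr0 ?mul1r.
rewrite deriv_prod_ord mulr_sumr; apply: eq_bigr => i _; congr (_ * _).
by apply: eq_bigr => k _; rewrite mxE.
Qed.

End PolyProd.

Section DetScale.
Variable S : comNzRingType.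

Lemma eq_det N (A B : 'M[S]_N) : (forall i j, A i j = B i j) -> \det A = \det B.
Proof. by move=> AB; congr (\det _); apply/matrixP. Qed.

Lemma det_scale_rows N (c : 'I_N -> S) (F : 'I_N -> 'I_N -> S) :
  \det (\matrix_(i, j) (c i * F i j)) = (\prod_i c i) * \det (\matrix_(i, j) F i j).
Proof.
rewrite /determinant mulr_sumr; apply: eq_bigr => s _.
rewrite mulrCA; congr (_ * _); rewrite -big_split.
by apply: eq_bigr => i _; rewrite !mxE.
Qed.

Lemma det_scale_cols N (c : 'I_N -> S) (F : 'I_N -> 'I_N -> S) :
  \det (\matrix_(i, j) (c j * F i j)) = (\prod_j c j) * \det (\matrix_(i, j) F i j).
Proof.
rewrite -det_tr -[in RHS]det_tr.
rewrite -[X in _ = _ * \det X]/(trmx _) [X in _ = _ * \det X](_ : _ = \matrix_(i, j) F j i).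
  by rewrite -det_scale_rows; apply: eq_det => i j; rewrite !mxE.
by apply/matrixP => i j; rewrite !mxE.
Qed.

(** Stated without division; the weights will be a_i = r^(g_i) and b_j = r^(J_j), and entries with
    J_j < g_i are zero on both sides. *)
Lemma det_rescale N (a b : 'I_N -> S) (F G : 'I_N -> 'I_N -> S) :
  (forall i j, a i * F i j = b j * G i j) ->
  (\prod_i a i) * \det (\matrix_(i, j) F i j) =
  (\prod_j b j) * \det (\matrix_(i, j) G i j).
Proof.
move=> FG; rewrite -det_scale_rows -det_scale_cols.
by apply: eq_det => i j; rewrite !mxE.
Qed.

Lemma det_row_eq0 N (M : 'M[S]_N) (i1 i2 : 'I_N) : i1 != i2 ->
  (forall j, M i1 j = M i2 j) -> \det M = 0.
Proof. exact: determinant_alternate. Qed.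

End DetScale.

Section Factorials.
Variable S : numFieldType.

Definition ffactp m : {poly S} := \prod_(k < m) ('X - (k%:R)%:P).

Lemma ffactp_monic m : ffactp m \is monic.
Proof. by apply: monic_prod => i _; apply: monicXsubC. Qed.

Lemma size_ffactp m : size (ffactp m) = m.+1.
Proof.
have -> : ffactp m = \prod_(z <- [seq k%:R | k : 'I_m]) ('X - z%:P).
  by rewrite big_map big_enum.
by rewrite size_prod_XsubC size_map -cardE card_ord.
Qed.

Lemma horner_ffactp m k : (ffactp m).[k%:R] = (k ^_ m)%:R.
Proof.
elim: m => [|m IH]; first by rewrite /ffactp big_ord0 hornerC ffactn0.
rewrite /ffactp big_ord_recr hornerM [X in X * _]IH ffactnSr natrM !hornerE.
have [km|mk] := ltnP k m; first by rewrite ffact_small // !mul0r.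
by rewrite natrB.
Qed.

(* [J ^_ i = J! / (J - i)!] is a monic polynomial of degree [i] in [J], so this
   determinant is a Vandermonde determinant up to the factor [prod_j 1/J_j!] *)
Lemma det_inv_fact_neq0 N (J : 'I_N -> nat) : injective J ->
  \det (\matrix_(i < N, j < N)
    (if (i <= J j)%N then ((J j - i)`!%:R)^-1 else 0 : S)) != 0.
Proof.
move=> J_inj.
have factU k : (k`!%:R : S) != 0 by rewrite pnatr_eq0 -lt0n fact_gt0.
have -> : \matrix_(i < N, j < N) (if (i <= J j)%N then ((J j - i)`!%:R)^-1 else 0 : S)
  = \matrix_(i, j) (((J j)`!%:R)^-1 * (ffactp i).[(J j)%:R]).
  apply/matrixP => i j; rewrite !mxE horner_ffactp; case: leqP => ij.
    by rewrite -(ffact_fact ij) natrM invfM mulrAC mulVf ?mul1r // pnatr_eq0 -lt0n ffact_gt0.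
  by rewrite ffact_small // mulr0.
rewrite det_scale_cols mulf_neq0 //.
  by apply/prodf_neq0 => j _; rewrite invr_eq0.
have -> : (\matrix_(i, j) (ffactp i).[(J j)%:R] : 'M[S]_N) =
  (\matrix_(i, k) (ffactp i)`_k) *m Vandermonde N (\row_j (J j)%:R).
  apply/matrixP => i j; rewrite !mxE (horner_coef_wide _ (n := N)) ?size_ffactp //.
  by apply: eq_bigr => k _; rewrite !mxE.
rewrite det_mulmx mulf_neq0 // ?det_Vandermonde.
  rewrite det_trig; last first.
    apply/is_trig_mxP => i k ik; rewrite mxE nth_default // size_ffactp //.
  apply/prodf_neq0 => i _; rewrite mxE.
  by have /monicP := ffactp_monic i; rewrite /lead_coef size_ffactp /= => ->; rewrite oner_eq0.
apply/prodf_neq0 => i _; apply/prodf_neq0 => j ij.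
rewrite !mxE subr_eq0 eqr_nat; apply: contraTN ij => /eqP /J_inj ->.
by rewrite ltnn.
Qed.

End Factorials.

(** A by-product of the classification of index maps: an injective map has the image of [lead0],
    that of [lead1], or a sum at least two larger than that of [lead0]. *)
Lemma sum_inj_ge N (f : 'I_N -> nat) : injective f ->
  (\sum_(i < N) i <= \sum_i f i)%N.
Proof.
case: N f => [|N] f f_inj; first by rewrite !big_ord0.
pose V := (\sum_i f i + N.+2)%N; have NV : (N.+1 < V)%N by rewrite /V addnS ltnS leq_addl.
have fV i : (f i < V)%N.
  rewrite /V (bigD1 i) //=; lia.
pose g : {ffun 'I_N.+1 -> 'I_V} := [ffun i => Ordinal (fV i)].
have g_inj : injective g.
  by move=> i j; rewrite !ffunE => /(congr1 val) /= /f_inj.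
have -> : (\sum_i f i = \sum_i g i)%N by apply: eq_bigr => i _; rewrite ffunE.
have sumc (h : {ffun 'I_N.+1 -> 'I_V}) u : (\sum_i ffcomp h u i = \sum_i h i)%N.
  rewrite [RHS](reindex_inj (@perm_inj _ u)) /=.
  by apply: eq_bigr => i _; rewrite ffunE.
have [/imsetP[s _ ->]|g0] := boolP (g \in [set ffcomp (lead0 NV) s | s in 'S_N.+1]).
  by rewrite sumc sum_lead0.
have [/imsetP[s _ ->]|g1] := boolP (g \in [set ffcomp (lead1 NV) s | s in 'S_N.+1]).
  by rewrite sumc sum_lead1.
apply: (leq_trans (leq_addr 2 _)); apply: (@subleading_sum N.+1 V isT NV).
by rewrite /subleading g0 g1 !andbT; apply/injectiveP.
Qed.

Lemma mup_prod_XsubC (F : fieldType) (rs : seq F) z :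
  mup z (\prod_(x <- rs) ('X - x%:P)) = count_mem z rs.
Proof.
elim: rs => [|x rs IH]; first by rewrite big_nil mupNroot // root1.
rewrite big_cons mupM ?polyXsubC_eq0 ?monic_neq0 ?monic_prod_XsubC // IH /=.
by rewrite -[X in mup z X]expr1 mup_XsubCX; case: eqP.
Qed.

Lemma sum_ord_rat m : \sum_(i < m) (i%:R : rat) = m%:R * (m%:R - 1) / 2.
Proof.
elim: m => [|m IH]; first by rewrite big_ord0 !mul0r.
by rewrite big_ord_recr /= IH -[m.+1]addn1 natrD; field.
Qed.

Lemma sqr_sum_rat m (a : 'I_m -> rat) : (\sum_l a l) ^+ 2 =
  \sum_l a l ^+ 2 + 2 * \sum_(l < m) \sum_(k < m | (l < k)%N) a l * a k.
Proof.
rewrite expr2 mulr_suml.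
have -> : \sum_l a l * (\sum_k a k) = \sum_(l < m) (a l ^+ 2 +
    \sum_(k < m | (l < k)%N) a l * a k + \sum_(k < m | (k < l)%N) a l * a k).
  apply: eq_bigr => l _; rewrite mulr_sumr (bigD1 l) //= -expr2 -addrA.
  congr (_ + _); rewrite (bigID (fun k : 'I_m => (l < k)%N)) /=.
  congr (_ + _); apply: eq_bigl => k; rewrite -val_eqE /=; lia.
rewrite !big_split /= -addrA; congr (_ + _); rewrite mulrDl mul1r; congr (_ + _).
rewrite (exchange_big_dep xpredT) //=; apply: eq_bigr => l _.
by apply: eq_bigr => k _; rewrite mulrC.
Qed.

(** * The homogenized Wronskian, its derivative and its roots *)

Section Gmam.
Variables (R : realType) (n : nat) (Nv : 'I_n -> nat) (kappa : 'I_n -> nat -> R[i]).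
Local Notation C := R[i].
Local Notation N := (\sum_(l < n) Nv l)%N.
Local Notation unitC := (@natC_unit R).

Definition blk (j : 'I_N) : 'I_n := tagnat.sig1 j.

Definition col_idx (j : 'I_N) : nat := idx (tagnat.sig1 j) (tagnat.sig2 j).

(** The 1-based block number lies in 1, .., n, so it is the residue of the index modulo n + 1, and
    the quotient is the position in the block. *)
Lemma col_idx_inj : injective col_idx.
Proof.
move=> i j; rewrite /col_idx /idx => ij.
have [li lj] := (ltn_ord (tagnat.sig1 i), ltn_ord (tagnat.sig1 j)).
have e1 : tagnat.sig1 i = tagnat.sig1 j.
  have := congr1 (modn ^~ n.+1) ij; rewrite !(mulnC n.+1) !modnMDl !modn_small //.
  by move=> [] /val_inj.
have e2 : tagnat.sig2 i = tagnat.sig2 j :> nat.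
  have e1' : tagnat.sig1 i = tagnat.sig1 j :> nat by rewrite e1.
  by move: ij; rewrite e1' => /addIn /eqP; rewrite eqn_mul2l => /eqP.
by apply: val_inj; rewrite /= [LHS]tagnat.rect [RHS]tagnat.rect e2; congr addn;
  apply: eq_bigl => k; rewrite e1.
Qed.

(* The variables of the Schur polynomials in GMAM, homogenized: [r] has weight 1
   and kappa_{l,j} is multiplied by [r ^+ j]. *)
Definition base (l : 'I_n) (u r : C) (j : nat) : C :=
  u *+ (j == 1%N) + (if (n.+1 %| j)%N then 0 else kappa l j * r ^+ j).

(** Subtraction on [nat] is truncated, so the test carries the convention S_j = 0 for j < 0. *)
Definition schur_sub (J g : nat) (z : nat -> C) : C :=
  if (g <= J)%N then schur (J - g) z else 0.

Definition phi_sub (l : 'I_n) (J g : nat) : {poly C} :=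
  if (g <= J)%N then phi kappa l (J - g) else 0.

Lemma polyC_unit k : (k.+1%:R : {poly C}) \is a GRing.unit.
Proof. by rewrite -[k.+1%:R](rmorph_nat (@polyC C)) rmorph_unit // unitC. Qed.

(** Splitting z eps off the exponent multiplies the series by exp(z eps), whence the z^a / a!.
    Degree, top coefficient and derivative of phi can be read off. *)
Lemma phiE l m : phi kappa l m =
  \poly_(a < m.+1) ((a`!%:R)^-1 * schur (m - a) (base l 0 1)).
Proof.
pose kap i : {poly C} := if (n.+1 %| i)%N then 0 else (kappa l i)%:P.
have kapE i : kap i = (base l 0 1 i)%:P.
  rewrite /kap /base mul0rn add0r expr1n mulr1; case: ifP => // _.
rewrite /phi.
rewrite (@eq_schur _ m _ (fun i => kap i + 'X *+ (i == 1%N))); last first.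
  by move=> i _; rewrite addrC.
rewrite (schurD polyC_unit) poly_def; apply: eq_bigr => a _.
rewrite (schur_X polyC_unit) (_ : schur _ kap = (schur (m - a) (base l 0 1))%:P).
  have -> : (a`!%:R : {poly C})^-1 = ((a`!%:R)^-1)%:P.
    have uf : (a`!%:R : C) \is a GRing.unit.
      by rewrite unitfE pnatr_eq0 -lt0n fact_gt0.
    by rewrite -[a`!%:R in LHS](rmorph_nat (@polyC C)) -rmorphV.
  by rewrite mulrAC -polyCM mul_polyC.
rewrite (rmorph_schur (@polyC C)) //; last exact: unitC.
by apply: eq_schur => i _; rewrite kapE.
Qed.

Lemma size_phi l m : (size (phi kappa l m) <= m.+1)%N.
Proof. by rewrite phiE size_poly. Qed.

Lemma coef_phi l m : (phi kappa l m)`_m = (m`!%:R)^-1.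
Proof. by rewrite phiE coef_poly ltnSn subnn schur0 mulr1. Qed.

Lemma deriv_phi l m : (phi kappa l m.+1)^`() = phi kappa l m.
Proof.
rewrite !phiE; apply/polyP => a; rewrite coef_deriv !coef_poly ltnS.
case: ifP => [am|]; last by rewrite mul0rn.
rewrite subSS -mulrnAl factS natrM invfM -[X in X * _ = _]mulr_natl mulrA.
by rewrite mulfV ?mul1r // pnatr_eq0.
Qed.

Lemma deriv_phi0 l : (phi kappa l 0)^`() = 0.
Proof.
rewrite phiE; apply/polyP => a.
by rewrite coef_deriv coef_poly coef0 mul0rn.
Qed.

Lemma deriv_phi_sub l J g : (phi_sub l J g)^`() = phi_sub l J g.+1.
Proof.
rewrite /phi_sub; have [gJ|Jg|->] := ltngtP g J.
- by rewrite -(subnSK gJ) deriv_phi.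
- by rewrite derivC.
- by rewrite subnn deriv_phi0.
Qed.

Lemma derivn_phi l J g : (phi kappa l J)^`(g) = phi_sub l J g.
Proof.
elim: g => [|g IH]; first by rewrite derivn0 /phi_sub subn0.
by rewrite derivnS IH deriv_phi_sub.
Qed.

Lemma phizE l (J g : nat) : phiz kappa l (J%:Z - g%:Z) = phi_sub l J g.
Proof.
rewrite /phi_sub; case: leqP => gJ; first by rewrite subzn.
have -> : J%:Z - g%:Z = Negz (g - J).-1.
  by rewrite NegzE prednK ?subn_gt0 // -subzn ?(ltnW gJ) // opprB.
by [].
Qed.

Lemma horner_phi l m z : (phi kappa l m).[z] = schur m (base l z 1).
Proof.
rewrite -[LHS]/(horner_eval z _) /phi (rmorph_schur (horner_eval z)) //; last first.
  exact: polyC_unit.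
apply: eq_schur => i _; rewrite /= /base expr1n mulr1 /horner_eval hornerD hornerMn hornerX.
by congr (_ + _); case: ifP => _; rewrite ?hornerC.
Qed.

Lemma horner_phi_sub l J g z : (phi_sub l J g).[z] = schur_sub J g (base l z 1).
Proof.
by rewrite /phi_sub /schur_sub; case: ifP => _; rewrite ?horner_phi ?hornerC.
Qed.

(* The Wronskian is [Hdet id]: differentiating the [j]-th column lowers the index
   of phi, so row [i] carries the shift [g i = i]. *)
Definition Hdet (g : 'I_N -> nat) (u r : C) : C :=
  \det (\matrix_(i < N, j < N) schur_sub (col_idx j) (g i) (base (blk j) u r)).

Lemma shifted_detE (p : 'I_N -> nat) z : shifted_det kappa p z = Hdet p z 1.
Proof.
apply: eq_det => i j; rewrite !mxE -horner_phi_sub -phizE //.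
Qed.

Lemma wrE : wr Nv kappa = \det (\matrix_(i, j) phi_sub (blk j) (col_idx j) i).
Proof.
rewrite /wr /wronskian; apply: eq_det => i j.
by rewrite !mxE derivn_phi.
Qed.

Lemma horner_wr z : (wr Nv kappa).[z] = Hdet (fun i => i) z 1.
Proof.
rewrite wrE -[LHS]/(horner_eval z _) -det_map_mx; apply: eq_det => i j.
by rewrite !mxE /= /horner_eval horner_phi_sub.
Qed.

Lemma horner_deriv_wr z : (wr Nv kappa)^`().[z] =
  \sum_(i < N) Hdet (fun k => if k == i then k.+1 else k) z 1.
Proof.
rewrite wrE deriv_det horner_sum; apply: eq_bigr => i _.
rewrite -[LHS]/(horner_eval z _) -det_map_mx; apply: eq_det => k j; rewrite !mxE /= /horner_eval.
by case: eqP => _; rewrite ?deriv_phi_sub horner_phi_sub.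
Qed.

Lemma eq_Hdet g g' u r : (forall i, g i = g' i) -> Hdet g u r = Hdet g' u r.
Proof. by move=> gg; apply: eq_det => i j; rewrite !mxE gg. Qed.

Lemma Hdet_eq0 g u r (i1 i2 : 'I_N) : i1 != i2 -> g i1 = g i2 -> Hdet g u r = 0.
Proof. by move=> i12 g12; apply: (det_row_eq0 i12) => j; rewrite !mxE g12. Qed.

Hypothesis N_ge1 : (1 <= N)%N.

Let last_subproof : (N.-1 < N)%N. Proof. by rewrite prednK. Qed.
Let lastN : 'I_N := Ordinal last_subproof.

(** Raising the shift of row i by one makes it equal to row i + 1, except for the last row. *)
Lemma deriv_wr_lead1 z : (wr Nv kappa)^`().[z] =
  Hdet (fun k => if k.+1 == N then N else k) z 1.
Proof.
rewrite horner_deriv_wr (bigD1 lastN) //= [X in _ + X]big1 ?addr0 => [|i].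
  apply: eq_Hdet => k; rewrite -val_eqE /= -eqSS prednK //.
  by case: eqP => // ->.
rewrite -val_eqE /= => iN; have iN' := ltn_ord i.
have i1N : (i.+1 < N)%N by rewrite -ltn_predRL ltn_neqAle iN -ltnS prednK.
apply: (@Hdet_eq0 _ _ _ i (Ordinal i1N)); rewrite -?val_eqE /= ?eqxx.
  by rewrite ltn_eqF.
by rewrite gtn_eqF.
Qed.

(** Raising a shift by two duplicates row i + 2 unless i is one of the last two rows; these give
    [pbar] and [phat]. *)
Lemma Hdet_sum2 z : (wr Nv kappa).[z] = 0 ->
  \sum_(i < N) Hdet (fun k => if k == i then k.+2 else k) z 1 =
  Hdet (@pbar n Nv) z 1 + Hdet (@phat n Nv) z 1.
Proof.
move=> wr0; rewrite (bigD1 lastN) //= addrC; congr (_ + _); last first.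
  apply: eq_Hdet => k; rewrite /phat -val_eqE /= -eqSS prednK //.
  by case: eqP => // ->.
(* For N = 1 there is no row before the last: [pbar] is the identity and its determinant is the
   Wronskian at z, zero by hypothesis. *)
have [N2|N2] := leqP 2 N; last first.
  rewrite [X in X = _]big1 => [|i]; last first.
    rewrite -val_eqE /= => iN; exfalso; have := ltn_ord i; move: iN N2 N_ge1.
    by move: (nat_of_ord i) => k; move: N => M; lia.
  rewrite -wr0 horner_wr; apply: eq_Hdet => k; rewrite /pbar.
  by case: eqP => // kN; move: N2; rewrite -[X in (X < _)%N]kN.
have penP : (N.-2 < N)%N by move: N2; move: N => M; lia.
rewrite (bigD1 (Ordinal penP)) /=; last by rewrite -val_eqE /=; move: N2; move: N => M; lia.
rewrite [X in _ + X]big1 ?addr0 => [|i].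
  apply: eq_Hdet => k; rewrite /pbar -val_eqE /=.
  have -> : (k == N.-2 :> nat) = (k.+2 == N).
    by move: (nat_of_ord k) N2 => k'; move: N => M; lia.
  by case: eqP => // ->.
rewrite -!val_eqE /= => iN; have iN' := ltn_ord i.
have i2N : (i.+2 < N)%N.
  by move: iN iN' N2; move: (nat_of_ord i) => k; move: N => M; lia.
apply: (@Hdet_eq0 _ _ _ i (Ordinal i2N)); rewrite -?val_eqE /= ?eqxx.
  by rewrite ltn_eqF // ltnW.
by rewrite gtn_eqF // ltnW.
Qed.

Lemma base_scale l u r j : r != 0 -> base l u r j = r ^+ j * base l (u / r) 1 j.
Proof.
move=> r0; rewrite /base expr1n mulr1 mulrDr; congr (_ + _).
  by have [->|_] := eqVneq j 1%N; rewrite ?mulr0 // expr1 !mulr1n mulrC divfK.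
by case: ifP; rewrite ?mulr0 // mulrC.
Qed.

Lemma Hdet_scale g u r : r != 0 ->
  r ^+ (\sum_i g i) * Hdet g u r = r ^+ (\sum_j col_idx j) * Hdet g (u / r) 1.
Proof.
move=> r0; rewrite /Hdet -!prodrXr; apply: det_rescale => i j.
rewrite /schur_sub; case: leqP => [gJ|_]; last by rewrite [LHS]mulr0 [RHS]mulr0.
rewrite (@eq_schur _ _ _ (fun m => r ^+ m * base (blk j) (u / r) 1 m)); last first.
  by move=> m _; apply: base_scale.
by rewrite (schur_scale unitC) mulrA -exprD subnKC.
Qed.

Definition GammaN : nat := (\sum_j col_idx j - \sum_(i < N) i)%N.

(** Every J_j is positive, so the numbers J_j - 1 are still distinct naturals. The surplus N makes
    the subtraction in [GammaN] genuine and its value positive. *)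
Lemma sum_col_idx_ge : (\sum_(i < N) i + N <= \sum_j col_idx j)%N.
Proof.
have inj : injective (fun j => (col_idx j).-1).
  move=> i j; rewrite /col_idx /idx !addnS /= => ij.
  by apply: col_idx_inj; rewrite /col_idx /idx !addnS ij.
have := sum_inj_ge inj.
have -> : (\sum_j col_idx j = \sum_(j < N) (col_idx j).-1 + N)%N.
  rewrite -[X in (_ = _ + X)%N]card_ord -sum1_card -big_split /=.
  by apply: eq_bigr => j _; rewrite addn1 prednK // /col_idx /idx addnS.
by rewrite leq_add2r.
Qed.

Lemma GammaN_gt0 : (0 < GammaN)%N.
Proof. have := sum_col_idx_ge; rewrite /GammaN; lia. Qed.

Lemma sum_col_idxE : (\sum_j col_idx j = \sum_(i < N) i + GammaN)%N.
Proof. by rewrite /GammaN subnKC //; have := sum_col_idx_ge; lia. Qed.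

Let term (s : 'S_N) : {poly C} :=
  \prod_(i < N) phi_sub (blk (s i)) (col_idx (s i)) i.

Let size_phi_sub l J g : (size (phi_sub l J g) <= (J - g).+1)%N.
Proof. by rewrite /phi_sub; case: ifP => _; rewrite ?size_phi // size_poly0. Qed.

(** The differences J_(s i) - i add up to the same number for every s, so all Leibniz terms have the
    same formal degree; a term with some i > J_(s i) vanishes. *)
Let term_size s : (size (term s) <= GammaN.+1)%N /\
  (term s)`_GammaN = \prod_(i < N)
    (if (i <= col_idx (s i))%N then ((col_idx (s i) - i)`!%:R)^-1 else 0).
Proof.
have [/forallP sP|/forallPn[i0 si0]] := boolP [forall i : 'I_N, (i <= col_idx (s i))%N].
  have GE : GammaN = (\sum_(i < N) (col_idx (s i) - i))%N.
    rewrite /GammaN (reindex_inj (@perm_inj _ s)) /=.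
    by rewrite sumnB // => i _; apply: sP.
  rewrite GE; split; first exact: size_prod_leq_sum.
  rewrite coef_prod_sum //; apply: eq_bigr => i _.
  by rewrite sP /phi_sub sP coef_phi.
have -> : term s = 0 by rewrite /term (bigD1 i0) //= {1}/phi_sub (negPf si0) mul0r.
by rewrite size_poly0 coef0 [X in _ /\ _ = X](bigD1 i0) //= (negPf si0) mul0r.
Qed.

Let wr_term : wr Nv kappa = \sum_(s : 'S_N) (-1) ^+ s * term s.
Proof.
rewrite wrE; apply: eq_bigr => s _; congr (_ * _).
by apply: eq_bigr => i _; rewrite mxE.
Qed.

Let signE (b : bool) (q : {poly C}) : (-1) ^+ b * q = ((-1) ^+ b : C) *: q.
Proof. by case: b; rewrite ?expr0 ?expr1 ?mul1r ?scale1r ?mulN1r ?scaleN1r. Qed.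

Lemma size_wr : size (wr Nv kappa) = GammaN.+1.
Proof.
apply/eqP; rewrite eqn_leq; apply/andP; split.
  rewrite wr_term; apply: (leq_trans (size_sum _ _ _)); apply/bigmax_leqP => s _.
  by rewrite signE (leq_trans (size_scale_leq _ _)) //; case: (term_size s).
rewrite ltnNge; apply/negP => /leq_sizeP /(_ _ (leqnn _)) c0.
have /negP[] := @det_inv_fact_neq0 C _ _ col_idx_inj; rewrite -[X in _ == X]c0.
apply/eqP; rewrite wr_term coef_sum; apply: eq_bigr => s _.
rewrite signE coefZ; case: (term_size s) => _ ->; congr (_ * _).
by apply: eq_bigr => i _; rewrite mxE.
Qed.

Lemma wr_neq0 : wr Nv kappa != 0.
Proof. by rewrite -size_poly_eq0 size_wr. Qed.

Lemma cN_neq0 : cN Nv kappa != 0.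
Proof. by rewrite /cN invr_eq0 lead_coef_eq0 wr_neq0. Qed.

Lemma root_gmam z : root (gmam Nv kappa) z = root (wr Nv kappa) z.
Proof. by rewrite /gmam rootZ // cN_neq0. Qed.

Lemma gmam_roots : (forall z, root (gmam Nv kappa) z -> mup z (gmam Nv kappa) = 1%N) ->
  exists rs : seq C, [/\ uniq rs, size rs = GammaN,
    (forall z, root (gmam Nv kappa) z = (z \in rs)) &
    wr Nv kappa = (cN Nv kappa)^-1 *: \prod_(z <- rs) ('X - z%:P)].
Proof.
move=> simple; have [rs rsE] := closed_field_poly_normal (gmam Nv kappa).
have lead1 : lead_coef (gmam Nv kappa) = 1.
  by rewrite lead_coefZ mulVf // lead_coef_eq0 wr_neq0.
rewrite lead1 scale1r in rsE.
have rootE z : root (gmam Nv kappa) z = (z \in rs) by rewrite rsE root_prod_XsubC.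
exists rs; split => //.
- apply: count_mem_uniq => z.
  case: (boolP (z \in rs)) => [zrs|/count_memPn //].
  have := zrs; rewrite -rootE => /simple; rewrite rsE.
  by rewrite mup_prod_XsubC => ->.
- have := size_scale (wr Nv kappa) cN_neq0.
  by rewrite -/(gmam Nv kappa) rsE size_prod_XsubC size_wr => -[].
- by rewrite -rsE /gmam scalerA mulVf ?cN_neq0 // scale1r.
Qed.

(** Homogeneity carries the factorization to every nonzero r, as needed when r = del * A varies with
    the point. *)
Lemma Hdet_roots (rs : seq C) u r : r != 0 -> size rs = GammaN ->
  wr Nv kappa = (cN Nv kappa)^-1 *: \prod_(z <- rs) ('X - z%:P) ->
  Hdet (fun i => i) u r = (cN Nv kappa)^-1 * \prod_(z <- rs) (u - z * r).
Proof.
move=> r0 rsG wrrs; have rX : r ^+ (\sum_(i < N) i) != 0 by rewrite expf_neq0.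
apply: (mulfI rX); rewrite Hdet_scale // -horner_wr wrrs hornerZ horner_prod.
rewrite sum_col_idxE exprD -mulrA; congr (_ * _); rewrite mulrCA; congr (_ * _).
rewrite -rsG; elim: (rs) => [|z s IH]; first by rewrite !big_nil mulr1.
rewrite !big_cons -IH hornerXsubC /= exprS mulrACA; congr (_ * _).
by rewrite mulrBr mulrC divfK // mulrC.
Qed.

Lemma sum_col_idx_rat : (\sum_j (col_idx j)%:R : rat) =
  \sum_(l < n) ((n%:R + 1) * ((Nv l)%:R * ((Nv l)%:R - 1) / 2) + l.+1%:R * (Nv l)%:R).
Proof.
rewrite (reindex (@tagnat.rank n Nv)) /=; last exact: tagnat.rank_bij_on.
transitivity (\sum_(p : {l : 'I_n & 'I_(Nv l)}) ((idx (tag p) (tagged p))%:R : rat)).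
  apply: eq_bigr => p _; rewrite /col_idx; congr (_%:R).
  by rewrite /tagnat.sig1 /tagnat.sig2 tagnat.rankK.
have <- : \sum_(l < n) \sum_(i < Nv l) ((idx l i)%:R : rat) =
    \sum_(p : {l : 'I_n & 'I_(Nv l)}) ((idx (tag p) (tagged p))%:R : rat).
  by rewrite sig_big_dep.
apply: eq_bigr => l _; rewrite /idx.
under eq_bigr do rewrite natrD natrM.
rewrite big_split /= -mulr_sumr sum_ord_rat sumr_const card_ord.
by rewrite -[n.+1]addn1 natrD mulr_natr.
Qed.

(** The term N(N-1)/2 is expanded by writing N^2 as the sum of the N_l^2 plus twice the mixed
    products. *)
Lemma GammaN_rat : GammaN%:R = Gamma Nv.
Proof.
have : (\sum_j col_idx j)%:R = (\sum_(i < N) i + GammaN)%:R :> rat.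
  by rewrite sum_col_idxE.
rewrite natrD natr_sum sum_col_idx_rat natr_sum sum_ord_rat => /eqP.
rewrite [_ + GammaN%:R]addrC -subr_eq => /eqP <-.
have := sqr_sum_rat (fun l => (Nv l)%:R); rewrite -natr_sum => NE.
rewrite /Gamma.
set T := \sum_l \sum_(k < n | _) _ in NE *.
transitivity (\sum_(l < n) ((n%:R + 1) * ((Nv l)%:R * ((Nv l)%:R - 1) / 2) +
   l.+1%:R * (Nv l)%:R) - (\sum_l (Nv l)%:R ^+ 2 + 2 * T - \sum_l (Nv l)%:R) / 2 : rat).
  by rewrite -NE -natr_sum; congr (_ - _); field.
have -> : \sum_(l < n) ((n%:R + 1) * ((Nv l)%:R * ((Nv l)%:R - 1) / 2) +
     l.+1%:R * (Nv l)%:R) =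
   \sum_(l < n) (Nv l)%:R / 2 * (n%:R * ((Nv l)%:R - 1) + 2 * l.+1%:R) +
   (\sum_l (Nv l)%:R ^+ 2 - \sum_l (Nv l)%:R) / 2 :> rat.
  by rewrite -sumrB mulr_suml -big_split /=; apply: eq_bigr => l _; field.
by field.
Qed.

End Gmam.

(** * Asymptotics of the determinants *)

Section DetMmat.
Variables (R : realType) (n : nat) (Nv : 'I_n -> nat).
Variables (lam0 lam1 : R[i]) (chi : nat -> R[i]) (dpar : 'I_n -> nat -> R[i]).
Local Notation C := R[i].
Local Notation N := (\sum_(l < n) Nv l)%N.
Local Notation C1 := (C1 n lam0 chi).
Local Notation h1 := (h1 n lam0 chi).
Local Notation hs := (hshift lam0 chi).
Hypothesis N_ge1 : (1 <= N)%N.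

Definition shifted_vars (x t : R) (v : nat) (eta : nat -> C) (l : 'I_n) (r : nat) : C :=
  xplus lam0 lam1 chi dpar x t l r + v%:R * h1 r + eta r.

Definition bdet (x t : R) (f : 'I_N -> nat) (eta : nat -> C) : C :=
  \det (\matrix_(i, j) schur_sub (col_idx j) (f i) (shifted_vars x t (f i) eta (blk j))).

(** A common cut-off for all sums over v: beyond every J_j, so that extending a sum adds only zeros,
    and beyond N, so that the value N of [lead1] fits. *)
Definition depth : nat := (N + \max_(j < N) col_idx j).+1.

Lemma ltN_depth : (N < depth)%N. Proof. by rewrite ltnS leq_addr. Qed.

Lemma col_idx_depth (j : 'I_N) : (col_idx j < depth)%N.
Proof. by rewrite ltnS; apply: leq_trans (leq_addl _ _); apply: leq_bigmax. Qed.

Lemma conj_schur_sub J g (z : nat -> C) :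
  (schur_sub J g z)^*%C = schur_sub J g (fun r => (z r)^*%C).
Proof.
rewrite /schur_sub; case: ifP => _; last exact: rmorph0.
by rewrite (rmorph_schur (@conjc R)) //; apply: natC_unit.
Qed.

Lemma conj_det (M : 'M[C]_N) : (\det M)^*%C = \det (\matrix_(i, j) (M i j)^*%C).
Proof.
rewrite -[LHS](det_map_mx (@conjc R)); apply: eq_det => i j.
by rewrite !mxE.
Qed.

(** The sum over v in tau is already a matrix product; the bound v <= min(i, j) is absorbed by the
    zeros of [schur_sub]. The row factor is a conjugate in the same plus variables, with the
    opposite sign of h_2. *)
Lemma Mmat_mul x t s : Mmat lam0 lam1 chi Nv dpar x t s =
  (\matrix_(i < N, v < depth) (C1 ^+ v * (schur_sub (col_idx i) v
     (shifted_vars x t v (hs s) (blk i)))^*%C)) *m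
  (\matrix_(v < depth, j < N) schur_sub (col_idx j) v
     (shifted_vars x t v (fun r => - hs s r) (blk j))).
Proof.
apply/matrixP => i j; rewrite /Mmat /mxblock !mxE /tau -/(blk i) -/(blk j).
rewrite -/(col_idx i) -/(col_idx j).
rewrite (big_ord_widen depth (fun v => C1 ^+ v *
   schur (col_idx i - v) (fun r => xminus lam0 lam1 chi dpar x t (blk i) r +
     v%:R * (h1 r)^*%C + (hs s r)^*%C) *
   schur (col_idx j - v) (fun r => xplus lam0 lam1 chi dpar x t (blk j) r +
     v%:R * h1 r - hs s r))); last first.
  by apply: leq_ltn_trans (geq_minl _ _) (col_idx_depth _).
rewrite big_mkcond; apply: eq_bigr => v _; rewrite !mxE conj_schur_sub.
rewrite ltnS leq_min /schur_sub; case: leqP => /= vi; last by rewrite mulr0 mul0r.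
case: leqP => /= vj; last by rewrite mulr0.
congr (_ * _ * _); apply: eq_schur => r _; rewrite /shifted_vars.
by rewrite 2!rmorphD rmorphM rmorph_nat.
Qed.

Lemma det_Mmat x t s : N`!%:R * \det (Mmat lam0 lam1 chi Nv dpar x t s) =
  \sum_(f : {ffun 'I_N -> 'I_depth}) C1 ^+ (\sum_i f i) *
    ((bdet x t (fun i => f i) (hs s))^*%C * bdet x t (fun i => f i) (fun r => - hs s r)).
Proof.
rewrite Mmat_mul det_mulmx_sym; apply: eq_bigr => f _; rewrite mulrA.
congr (_ * _); last by apply: eq_det => i j; rewrite !mxE.
rewrite -prodrXr conj_det -det_tr -det_scale_rows.
by apply: eq_det => i j; rewrite !mxE.
Qed.

Lemma bdet_comp x t (f : {ffun 'I_N -> 'I_depth}) s eta :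
  bdet x t (fun i => ffcomp f s i) eta = (-1) ^+ s * bdet x t (fun i => f i) eta.
Proof.
rewrite /bdet -det_perm -det_mulmx -row_permE; apply: eq_det => i j.
by rewrite !mxE ffunE.
Qed.

Lemma bdet_noninj x t (f : {ffun 'I_N -> 'I_depth}) eta :
  ~~ injectiveb f -> bdet x t (fun i => f i) eta = 0.
Proof.
move=> /injectivePn[i [j ij fij]]; apply: (det_row_eq0 ij) => k.
by rewrite !mxE fij.
Qed.

Definition mterm x t (s : option 'I_n) (f : 'I_N -> nat) : C :=
  C1 ^+ (\sum_i f i) * ((bdet x t f (hs s))^*%C * bdet x t f (fun r => - hs s r)).

Lemma eq_bdet x t f g eta : (forall i, f i = g i) -> bdet x t f eta = bdet x t g eta.
Proof. by move=> fg; apply: eq_det => i j; rewrite !mxE fg. Qed.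

Lemma eq_mterm x t s f g : (forall i, f i = g i) -> mterm x t s f = mterm x t s g.
Proof.
move=> fg; rewrite /mterm !(eq_bdet _ _ _ fg); congr (_ ^+ _ * _).
by apply: eq_bigr => i _; rewrite fg.
Qed.

Definition top_shift (i : 'I_N) : nat := if i.+1 == N then N else i.

Lemma det_Mmat_leading x t s : \det (Mmat lam0 lam1 chi Nv dpar x t s) =
  mterm x t s (fun i => i) + mterm x t s top_shift +
  (N`!%:R)^-1 * \sum_(f | subleading ltN_depth f) mterm x t s (fun i => f i).
Proof.
have fN : (N`!%:R : C) != 0 by rewrite pnatr_eq0 -lt0n fact_gt0.
apply: (mulfI fN); rewrite det_Mmat.
rewrite (@sum_leading _ _ N_ge1 ltN_depth _ (fun f => mterm x t s (fun i => f i))).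
- have -> : mterm x t s (fun i => lead0 ltN_depth i) = mterm x t s (fun i => i).
    by apply: eq_mterm => i; rewrite ffunE.
  have -> : mterm x t s (fun i => lead1 ltN_depth i) = mterm x t s top_shift.
    by apply: eq_mterm => i; rewrite ffunE.
  by rewrite -[in LHS]mulr_natl [RHS]mulrDr [_ * (_^-1 * _)]mulrA mulfV // mul1r.
- move=> f u; rewrite /mterm !bdet_comp.
  have -> : (\sum_i ffcomp f u i = \sum_i f i)%N.
    rewrite [RHS](reindex_inj (@perm_inj _ u)) /=.
    by apply: eq_bigr => i _; rewrite ffunE.
  congr (_ * _); rewrite rmorphM /= mulrACA.
  have -> : ((-1) ^+ u : C)^*%C = (-1) ^+ u by rewrite rmorph_sign.
  by rewrite -signr_addb addbb mul1r.
- by move=> f fi; rewrite /mterm !bdet_noninj // !mulr0.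
Qed.

End DetMmat.

Section Scaling.
Variables (R : realType) (n : nat) (Nv : 'I_n -> nat).
Variables (lam0 lam1 : R[i]) (chi : nat -> R[i]) (kappa : 'I_n -> nat -> R[i]).
Local Notation C := R[i].
Local Notation N := (\sum_(l < n) Nv l)%N.
Local Notation h1 := (h1 n lam0 chi).

(* What remains of the rescaled variables [del ^+ r * x_r] once the homogenized
   GMAM variables [base l u (del * A)] are subtracted. *)
Definition rem_vars (del x t : R) (u : C) (v : nat) (eta : nat -> C) (r : nat) : C :=
  del%:C ^+ r * (alpha n lam0 lam1 chi r * x%:C + beta n lam0 lam1 chi r * 'i%C * t%:C
    + v%:R * h1 r + eta r) - u *+ (r == 1%N).

Definition hdet (del A x t : R) (u : C) (f : 'I_N -> nat) (eta : nat -> C) : C :=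
  \det (\matrix_(i, j) schur_sub (col_idx j) (f i)
    (fun r => base kappa (blk j) u (del * A)%:C r + rem_vars del x t u (f i) eta r)).

(** The parameters are prescribed on Lambda_l and at the multiples of n + 1; this shows that the
    minors involve no others. *)
Lemma col_idx_Lambda (j : 'I_N) r : (0 < r <= col_idx j)%N -> ~~ (n.+1 %| r)%N ->
  Lambda Nv (blk j) r.
Proof.
move=> /andP[r0 rj] nr; apply/and3P; split => //.
have := ltn_ord (tagnat.sig2 j); rewrite -(leq_pmul2l (ltn0Sn n)) mulnS.
move: rj; rewrite /col_idx /idx -/(blk j); lia.
Qed.

(** An exact identity for every [u], which cancels between [base] and [rem_vars]; its choice only
    decides what counts as the leading part. *)
Lemma bdet_scale dpar del A x t u f eta : del != 0 ->
  (forall l j, Lambda Nv l j -> dpar l j = kappa l j * A%:C ^+ j) ->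
  (forall l j, (1 <= j)%N -> dpar l (n.+1 * j)%N = 0) ->
  del%:C ^+ (\sum_(j < N) col_idx j) * bdet lam0 lam1 chi dpar x t f eta =
  del%:C ^+ (\sum_i f i) * hdet del A x t u f eta.
Proof.
move=> del0 dP d0; have dC : del%:C != 0 by rewrite fmorph_eq0.
rewrite /bdet /hdet -!prodrXr; symmetry; apply: det_rescale => i j.
rewrite /schur_sub; case: leqP => [fj|_]; last by rewrite [LHS]mulr0 [RHS]mulr0.
rewrite (@eq_schur _ _ _ (fun r => del%:C ^+ r *
    shifted_vars lam0 lam1 chi dpar x t (f i) eta (blk j) r)); last first.
  move=> r /andP[r0 rj]; rewrite /rem_vars /shifted_vars /xplus /base.
  have -> : dpar (blk j) r = if (n.+1 %| r)%N then 0 else kappa (blk j) r * A%:C ^+ r.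
    case: ifP => [/dvdnP[m rm]|/negbT nr].
      by rewrite rm mulnC d0 //; move: r0; rewrite rm; case: (m).
    by rewrite dP // col_idx_Lambda // r0 (leq_trans rj (leq_subr _ _)).
  rewrite rmorphM exprMn; case: ifP => _; ring.
by rewrite (schur_scale (@natC_unit R)) mulrA -exprD subnKC.
Qed.

End Scaling.

Lemma schur_subD (R : realType) J g M (z e : nat -> R[i]) : (J < M)%N ->
  schur_sub J g (fun r => z r + e r) =
  \sum_(a < M) schur a e * schur_sub J (g + a) z.
Proof.
move=> JM; rewrite /schur_sub; case: leqP => gJ; last first.
  by rewrite big1 // => a _; rewrite leqNgt ltn_addr ?mulr0.
rewrite (schurD (@natC_unit R)).
rewrite (big_ord_widen M (fun a => schur a e * schur (J - g - a) z)); last first.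
  by apply: leq_ltn_trans (leq_subr _ _) JM.
rewrite big_mkcond; apply: eq_bigr => a _; rewrite ltnS leq_subRL // subnDA.
by case: ifP => _; rewrite ?mulr0.
Qed.

(** * Uniform expansions on a region [D] with scale [del] and reference point [u] *)

Section Asymptotics.
Variables (R : realType) (n : nat) (Nv : 'I_n -> nat).
Variables (lam0 lam1 : R[i]) (chi : nat -> R[i]) (kappa : 'I_n -> nat -> R[i]).
Local Notation C := R[i].
Local Notation N := (\sum_(l < n) Nv l)%N.
Local Notation h1 := (h1 n lam0 chi).
Local Notation hs := (hshift lam0 chi).
Local Notation C1 := (C1 n lam0 chi).
Local Notation al := (alpha n lam0 lam1 chi).
Local Notation be := (beta n lam0 lam1 chi).
Hypothesis N_ge1 : (1 <= N)%N.
Variables (T : Type) (D : T -> Prop) (del A x t : T -> R) (u : T -> C).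
Hypothesis del01 : forall p, D p -> 0 < del p <= 1.
Local Notation O := (isO D del).
Hypothesis OA : O 0 (fun p => (del p * A p)%:C).
Hypothesis Ou : O 0 u.
Hypothesis Ox : O 0 (fun p => (del p * x p)%:C).
Hypothesis Ot : O 0 (fun p => (del p * t p)%:C).
Hypothesis Oz : O 1 (fun p =>
  (del p)%:C * (al 1 * (x p)%:C + be 1 * 'i%C * (t p)%:C) - u p).

Let del01' p : D p -> 0 <= del p <= 1.
Proof. by move=> /del01 /andP[d0 ->]; rewrite (ltW d0). Qed.

Local Notation OM := (isOM del01').
Local Notation OM0 := (isOM0 del01').
Local Notation OZ := (isOZ del01').
Local Notation Ole := (isO_le del01').

Lemma isO_deltaX k : O k (fun p => (del p)%:C ^+ k).
Proof.
exists 1 => p /del01' /andP[d0 _].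
by rewrite mul1r modCX modC_real ger0_norm.
Qed.

Local Notation rem v eta r :=
  (fun p => rem_vars n lam0 lam1 chi (del p) (x p) (t p) (u p) v eta r).

(* The order is [r - 1] for [r >= 2]; [uphalf r] is weaker, but being subadditive
   it passes to the Schur polynomials. *)
Lemma isO_rem v eta r : (0 < r)%N -> O (uphalf r) (rem v eta r).
Proof.
case: r => // -[|r] _.
  apply: (@eq_isO _ _ _ _ _ _ (fun p =>
    ((del p)%:C * (al 1 * (x p)%:C + be 1 * 'i%C * (t p)%:C) - u p) +
    (v%:R * h1 1%N + eta 1%N) * (del p)%:C ^+ 1)).
    by move=> p _; rewrite /rem_vars expr1 eqxx mulr1n; ring.
  by apply: isOD => //; apply: OZ; apply: isO_deltaX.
apply: (@eq_isO _ _ _ _ _ _ (fun p => (del p)%:C ^+ r.+1 *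
    (al r.+2 * (del p * x p)%:C + be r.+2 * 'i%C * (del p * t p)%:C) +
    (v%:R * h1 r.+2 + eta r.+2) * (del p)%:C ^+ r.+2)).
  by move=> p _; rewrite /rem_vars /= mulr0n subr0 !rmorphM /= exprS; ring.
apply: isOD; last first.
  apply: OZ; apply: (@Ole _ r.+2); last exact: isO_deltaX.
  by rewrite uphalf_half /=; lia.
apply: (@Ole _ (r.+1 + 0)).
  by rewrite addn0 uphalf_half /=; lia.
by apply: OM; [exact: isO_deltaX|apply: isOD; apply: OZ].
Qed.

Lemma isO_base l r : O 0 (fun p => base kappa l (u p) (del p * A p)%:C r).
Proof.
apply: isOD; first by case: (r == 1%N); [|exact: isO0].
case: (n.+1 %| r)%N; first exact: isO0.
by apply: OZ; apply: isOX.
Qed.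


Lemma isO_schur_sub J g (z : T -> nat -> C) :
  (forall r, (0 < r)%N -> O 0 (z^~ r)) -> O 0 (fun p => schur_sub J g (z p)).
Proof.
move=> Oz'; rewrite /schur_sub; case: (g <= J)%N; last exact: isO0.
by apply: (isO_schur del01' (om := fun=> 0%N)) => // r /andP[r0 _]; apply: Oz'.
Qed.

(** So S_1 and S_2 are of first order and every S_a with a >= 3 is at least of second order: only
    the first two enter the expansion at a root. *)
Lemma isO_schur_rem v eta a :
  O (uphalf a) (fun p => schur a (fun r => rem v eta r p)).
Proof.
apply: (isO_schur del01' (om := uphalf)) => // [i j|r /andP[r0 _]]; last exact: isO_rem.
by rewrite !uphalf_half halfD oddD; case: (odd i); case: (odd j); lia.
Qed.

Local Notation hd f eta := (fun p =>
  hdet (Nv := Nv) lam0 lam1 chi kappa (del p) (A p) (x p) (t p) (u p) f eta).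
Local Notation Hd f := (fun p => Hdet (Nv := Nv) kappa f (u p) (del p * A p)%:C).

Lemma isO_base_rem l v eta r : (0 < r)%N ->
  O 0 (fun p => base kappa l (u p) (del p * A p)%:C r + rem v eta r p).
Proof.
move=> r0; apply: isOD; first exact: isO_base.
by apply: (Ole (leq0n _)); apply: isO_rem.
Qed.

Lemma isO_hdet f eta : O 0 (hd f eta).
Proof.
apply: (isO_det del01') => i j.
apply: eq_isO => [p _|]; first by rewrite mxE.
by apply: isO_schur_sub => r r0; apply: isO_base_rem.
Qed.

Lemma isO_hdet_sub f eta : O 1 (fun p => hd f eta p - Hd f p).
Proof.
apply: (isO_det_sub del01') => i j.
- apply: eq_isO => [p _|]; first by rewrite mxE.
  by apply: isO_schur_sub => r r0; apply: isO_base_rem.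
- apply: eq_isO => [p _|]; first by rewrite mxE.
  by apply: isO_schur_sub => r r0; apply: isO_base.
- apply: (@eq_isO _ _ _ _ _ _ (fun p => \sum_(a < col_idx j)
      schur a.+1 (fun r => rem (f i) eta r p) *
      schur_sub (col_idx j) (f i + a.+1) (base kappa (blk j) (u p) (del p * A p)%:C))).
    move=> p _; rewrite !mxE (schur_subD _ _ _ (ltnSn _)) big_ord_recl schur0 mul1r addn0.
    by rewrite addrAC subrr add0r.
  apply: isO_sum => a _; rewrite -[1%N]addn0.
  apply: OM; last by apply: isO_schur_sub => r r0; apply: isO_base.
  by apply: (@Ole _ (uphalf a.+1)); [rewrite uphalf_half /=; lia|exact: isO_schur_rem].
Qed.

Let S0 := (\sum_(i < N) i)%N.

Definition rest (s : option 'I_n) (p : T) : C :=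
  (N`!%:R)^-1 * \sum_(f : {ffun 'I_N -> 'I_(depth Nv)} | subleading (ltN_depth Nv) f)
    C1 ^+ (\sum_i f i - S0) * ((del p)%:C ^+ (2 * (\sum_i f i - S0)) *
     ((hd (fun i => f i) (hs s) p)^*%C * hd (fun i => f i) (fun r => - hs s r) p)).

(** The determinant of M^[s] without the factor C_1^S0 del^(2 S0 - 2 sum J), common to all s. Each
    unit by which the index sum exceeds [S0] costs a factor C_1 del^2. *)
Definition scaled_det (s : option 'I_n) (p : T) : C :=
  (hd (fun i => i) (hs s) p)^*%C * hd (fun i => i) (fun r => - hs s r) p +
  C1 * ((del p)%:C ^+ 2 *
    ((hd (@top_shift n Nv) (hs s) p)^*%C * hd (@top_shift n Nv) (fun r => - hs s r) p)) +
  rest s p.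

Lemma isO_rest s : O 4 (rest s).
Proof.
apply: OZ; apply: isO_sum => f /(subleading_sum N_ge1) sf; apply: OZ.
rewrite -[4%N]addn0; apply: OM; last first.
  by apply: OM0; [apply: isO_conj|]; apply: isO_hdet.
by apply: Ole (isO_deltaX _); rewrite /S0; lia.
Qed.

Lemma scaled_detE dpar s p : D p ->
  (forall l j, Lambda Nv l j -> dpar l j = kappa l j * (A p)%:C ^+ j) ->
  (forall l j, (1 <= j)%N -> dpar l (n.+1 * j)%N = 0) ->
  (del p)%:C ^+ (2 * \sum_(j < N) col_idx j) *
    \det (Mmat lam0 lam1 chi Nv dpar (x p) (t p) s) =
  C1 ^+ S0 * (del p)%:C ^+ (2 * S0) * scaled_det s p.
Proof.
move=> Dp dP d0; have /andP[del0 _] := del01 Dp.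
have aux a b c e (w : C) : a * b * (c * e * w) = a * c * (b * (e * w)) by ring.
have mE f : (del p)%:C ^+ (2 * \sum_(j < N) col_idx j) *
    mterm lam0 lam1 chi dpar (x p) (t p) s f =
  C1 ^+ (\sum_i f i) * ((del p)%:C ^+ (2 * \sum_i f i) *
     ((hd f (hs s) p)^*%C * hd f (fun r => - hs s r) p)).
  rewrite /mterm mulrCA; congr (_ * _).
  have bE (eta : nat -> C) := @bdet_scale _ _ _ lam0 lam1 chi kappa dpar (del p)
    (A p) (x p) (t p) (u p) f eta (lt0r_neq0 del0) dP d0.
  have cE k : ((del p)%:C ^+ k)^*%C = (del p)%:C ^+ k :> C.
    by rewrite rmorphXn /= oppr0.
  rewrite mul2n -addnn exprD mulrACA -[X in X * _ * _]cE -rmorphM !bE rmorphM /= cE.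
  by rewrite mulrACA -exprD addnn -mul2n.
rewrite (det_Mmat_leading _ _ _ _ N_ge1) !mulrDr !mE; congr (_ + _ + _).
- by rewrite mulrA.
- have -> : (\sum_(i < N) @top_shift n Nv i = S0.+1)%N.
    rewrite -(sum_lead1 N_ge1 (ltN_depth Nv)).
    by apply: eq_bigr => i _; rewrite ffunE.
  by rewrite mulnS exprSr [_ ^+ (2 + _)]exprD [_ ^+ 2 * _]mulrC aux.
- rewrite /rest mulrCA [RHS]mulrCA; congr (_ * _); rewrite !mulr_sumr.
  apply: eq_bigr => f /(subleading_sum N_ge1) sf; rewrite mE.
  have le : (S0 <= \sum_i f i)%N by exact: leq_trans (leq_addr _ _) sf.
  rewrite -[in C1 ^+ _](subnKC le) -[in (del p)%:C ^+ (2 * \sum_i f i)](subnKC le).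
  by rewrite mulnDr !exprD aux.
Qed.

(** The mixed terms, products of H and h - H up to conjugation, keep a factor |H|. A plain O(del)
    error would be useless where |H| is itself only of order del. *)
Lemma scaled_det_far s : exists2 K : R, 0 < K & forall p, D p ->
  modC (scaled_det s p - (modC (Hd (fun i => i) p) ^+ 2)%:C) <=
    K * (modC (Hd (fun i => i) p) * del p + del p ^+ 2).
Proof.
pose d eta p := hd (fun i => i) eta p - Hd (fun i => i) p.
have [Ka Ka0 aP] := isO_pos del01' (isO_hdet_sub (fun i => i) (hs s)).
have [Kb Kb0 bP] := isO_pos del01' (isO_hdet_sub (fun i => i) (fun r => - hs s r)).
have Oc : O 2 (fun p => (d (hs s) p)^*%C * d (fun r => - hs s r) p +
   (C1 * ((del p)%:C ^+ 2 *
    ((hd (@top_shift n Nv) (hs s) p)^*%C * hd (@top_shift n Nv) (fun r => - hs s r) p)) +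
  rest s p)).
  apply: isOD; [|apply: isOD].
  - by rewrite -[2%N]/(1 + 1)%N; apply: OM; [apply: isO_conj|]; apply: isO_hdet_sub.
  - apply: OZ; rewrite -[2%N]addn0; apply: OM; first exact: isO_deltaX.
    by apply: OM0; [apply: isO_conj|]; apply: isO_hdet.
  - exact: Ole (isO_rest s).
have [Kc Kc0 cP] := isO_pos del01' Oc.
exists (Ka + Kb + Kc) => [|p Dp]; first by rewrite !addr_gt0.
have /andP[del0 _] := del01' Dp.
have := aP p Dp; have := bP p Dp; have := cP p Dp; rewrite /scaled_det /d modC_sqr.
move: (Hd (fun i => i) p) (hd (fun i => i) (hs s) p) (rest s p)
  (hd (fun i => i) (fun r => - hs s r) p) (C1 * _) => H h r h' w cb bb ab.
have -> : h^*%C * h' + w + r - H * H^*%C = (h - H)^*%C * H + H^*%C * (h' - H) +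
    ((h - H)^*%C * (h' - H) + (w + r)).
  by rewrite rmorphB /=; ring.
apply: (le_trans (modCD _ _)); rewrite [X in _ <= X]mulrDr; apply: lerD; last first.
  by apply: (le_trans cb); rewrite ler_wpM2r ?exprn_ge0 // lerDr ltW ?addr_gt0.
apply: (le_trans (modCD _ _)); rewrite !modCM !modC_conj.
apply: (@le_trans _ _ ((Ka + Kb) * (modC H * del p))).
  rewrite [X in _ <= X]mulrDl; apply: lerD.
    by rewrite mulrC mulrCA ler_wpM2l ?modC_ge0 // -[del p]expr1.
  by rewrite mulrCA ler_wpM2l ?modC_ge0 // -[del p]expr1.
by rewrite ler_wpM2r ?mulr_ge0 ?modC_ge0 // lerDl ltW.
Qed.

(** * Expansion at a root of the GMAM polynomial *)

Section Near.
Variables (z0 g : C) (zeta : T -> C).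
Hypothesis wr0 : (wr Nv kappa).[z0] = 0.
Hypothesis uE : forall p, D p -> u p = z0.
Hypothesis delA : forall p, D p -> del p * A p = 1.
Hypothesis h1_1_eq0 : h1 1%N = 0.
Hypothesis Ozeta : O 0 zeta.
Hypothesis zetaE : forall p, D p ->
  (del p)%:C * (al 1 * (x p)%:C + be 1 * 'i%C * (t p)%:C) - z0 = (del p)%:C * zeta p.
Hypothesis Og : O 2 (fun p => (del p)%:C ^+ 2 *
  (al 2 * (x p)%:C + be 2 * 'i%C * (t p)%:C) - (del p)%:C * g).

Let W1 := (wr Nv kappa)^`().[z0].
Let W2s := shifted_det kappa (@pbar n Nv) z0 + shifted_det kappa (@phat n Nv) z0.

Let delA1 p : D p -> (del p * A p)%:C = 1 :> C.
Proof. by move=> Dp; rewrite delA // rmorph1. Qed.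

(* To first order in [del] only [schur 1] and [schur 2] of the remainders matter;
   by multilinearity they turn the Wronskian at its root [z0] into its derivative
   and into the determinants [W2s] of the constant Delta. *)
Lemma hdet_near eta : O 2 (fun p => hd (fun i => i) eta p -
  (del p)%:C * ((zeta p + eta 1%N) * W1 + g * W2s)).
Proof.
pose B (l : 'I_n) := base kappa l z0 1.
pose X p : 'M[C]_N := \matrix_(i, j) schur_sub (col_idx j) i
  (fun r => B (blk j) r + rem i eta r p).
pose Y (p : T) : 'M[C]_N := \matrix_(i, j) schur_sub (col_idx j) i (B (blk j)).
pose Z p : 'M[C]_N := \matrix_(i, j) ((zeta p + eta 1%N) *
  schur_sub (col_idx j) i.+1 (B (blk j)) + g * schur_sub (col_idx j) i.+2 (B (blk j))).
have OB l r : O 0 (fun=> B l r) by exact: isO_cst.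
have Oze : O 0 (fun p => zeta p + eta 1%N) by apply: isOD => //; apply: isO_cst.
have OX i j : O 0 (fun p => X p i j).
  apply: (@eq_isO _ _ _ _ _ _ (fun p => schur_sub (col_idx j) i
     (fun r => B (blk j) r + rem i eta r p))) => [p _|]; first by rewrite mxE.
  apply: isO_schur_sub => r r0; apply: isOD => //.
  by apply: (Ole (leq0n _)); apply: isO_rem.
have OY i j : O 0 (fun p => Y p i j) by exact: isO_cst.
have OZ' i j : O 0 (fun p => Z p i j).
  apply: (@eq_isO _ _ _ _ _ _ (fun p => (zeta p + eta 1%N) *
     schur_sub (col_idx j) i.+1 (B (blk j)) + g * schur_sub (col_idx j) i.+2 (B (blk j)))).
    by move=> p _; rewrite mxE.
  by apply: isOD; [apply: OM0 => //|]; apply: isO_cst.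
have OXYZ i j : O 2 (fun p => X p i j - (Y p i j + (del p)%:C * Z p i j)).
  pose S a := schur_sub (col_idx j) (i + a) (B (blk j)).
  apply: (@eq_isO _ _ _ _ _ _ (fun p =>
      (rem i eta 2%N p + 2^-1 * rem i eta 1%N p ^+ 2 - (del p)%:C * g) * S 2%N +
      \sum_(a < col_idx j) schur a.+3 (fun r => rem i eta r p) * S a.+3)).
    move=> p Dp; rewrite !mxE (@schur_subD _ (col_idx j) _ (col_idx j).+3);
      last by rewrite ltnS ltnW.
    rewrite 3!big_ord_recl !lift0 schur0 (schur1 (@natC_unit R)) (schur2 (@natC_unit R)).
    rewrite mul1r addn0 addn1 addn2.
    (* Since h_(1,1) = 0, the row index i drops out of the remainder of the first variable, which is
       thus the same for all rows. *)
    have -> : rem i eta 1%N p = (del p)%:C * (zeta p + eta 1%N).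
      rewrite /rem_vars expr1 eqxx mulr1n h1_1_eq0 mulr0 addr0 uE // mulrDr.
      by rewrite [RHS]mulrDr -zetaE // addrAC.
    have -> : \sum_(a < col_idx j) schur (lift ord0 (lift ord0 (lift ord0 a)))
        (fun r => rem i eta r p) * schur_sub (col_idx j)
          (i + lift ord0 (lift ord0 (lift ord0 a))) (B (blk j)) =
      \sum_(a < col_idx j) schur a.+3 (fun r => rem i eta r p) * S a.+3.
      by apply: eq_bigr => a _; rewrite !lift0.
    by rewrite /S addn2; ring.
  apply: isOD; last first.
    apply: isO_sum => a _; rewrite -[2%N]addn0; apply: OM; last exact: isO_cst.
    by apply: (@Ole _ (uphalf a.+3)); [rewrite uphalf_half /=; lia|exact: isO_schur_rem].
  rewrite -[2%N]addn0; apply: OM; last exact: isO_cst.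
  (* The second variable is del g up to second order by [Og]; the shifts by h_(1,2) and eta_2 carry
     del^2, and the square of the first variable is of second order too. *)
  apply: (@eq_isO _ _ _ _ _ _ (fun p => ((del p)%:C ^+ 2 *
      (al 2 * (x p)%:C + be 2 * 'i%C * (t p)%:C) - (del p)%:C * g) +
    ((i%:R * h1 2 + eta 2%N) * (del p)%:C ^+ 2 + 2^-1 * (rem i eta 1%N p ^+ 2)))).
    by move=> p _; rewrite {1}/rem_vars /= mulr0n subr0; ring.
  apply: isOD => //; apply: isOD; apply: OZ; first exact: isO_deltaX.
  apply: (@eq_isO _ _ _ _ _ _ (fun p => rem i eta 1%N p * rem i eta 1%N p)).
    by move=> p _; rewrite expr2.
  by rewrite -[2%N]/(1 + 1)%N; apply: OM; apply: isO_rem.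
have EX p : D p -> hd (fun i => i) eta p = \det (X p).
  move=> Dp; apply: eq_det => i j; rewrite [LHS]mxE [RHS]mxE /B.
  by rewrite delA1 // uE.
have EY p : \det (Y p) = 0 by rewrite -wr0 horner_wr.
have EZ p : (zeta p + eta 1%N) * W1 + g * W2s =
    \sum_(i < N) \det (\matrix_(k, j) (if k == i then Z p k j else Y p k j)).
  rewrite /W1 /W2s !shifted_detE horner_deriv_wr -Hdet_sum2 // !mulr_sumr -big_split /=.
  apply: eq_bigr => i _; symmetry.
  apply: (@determinant_multilinear _ _ _ _ _ i).
  - by apply/matrixP => a j; rewrite !mxE eqxx.
  - by apply/matrixP => a j; rewrite !mxE eq_sym (negPf (neq_lift _ _)).
  - by apply/matrixP => a j; rewrite !mxE eq_sym (negPf (neq_lift _ _)).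
have [K KP] := isO_det_expand del01' OX OY OZ' OXYZ.
exists K => p Dp; have := KP p Dp; rewrite EY add0r -EZ -EX //.
Qed.

Lemma top_shift_near eta : O 1 (fun p => hd (@top_shift n Nv) eta p - W1).
Proof.
have [K KP] := isO_hdet_sub (@top_shift n Nv) eta.
exists K => p Dp; have := KP p Dp; rewrite delA1 // uE // /W1 deriv_wr_lead1 //; apply.
Qed.

(** Both leading types are of order del^2 at a root, the first because each of its two factors is of
    order del. An error of order 3 leaves O(del) after division by del^2. *)
Lemma scaled_det_near s : O 3 (fun p => scaled_det s p - (del p)%:C ^+ 2 *
  (((zeta p + hs s 1%N) * W1 + g * W2s)^*%C * ((zeta p - hs s 1%N) * W1 + g * W2s) +
   C1 * (W1^*%C * W1))).
Proof.
pose q eta p := (zeta p + eta 1%N) * W1 + g * W2s.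
pose q' := q (fun r => - hs s r).
have Oq eta : O 0 (q eta).
  apply: isOD; last exact: isO_cst.
  by apply: OM0; [apply: isOD => //|]; apply: isO_cst.
pose h := hd (fun i => i) (hs s); pose h' := hd (fun i => i) (fun r => - hs s r).
pose k := hd (@top_shift n Nv) (hs s); pose k' := hd (@top_shift n Nv) (fun r => - hs s r).
apply: (@eq_isO _ _ _ _ _ _ (fun p =>
  (h p)^*%C * (h' p - (del p)%:C * q' p) +
  ((h p - (del p)%:C * q (hs s) p)^*%C * ((del p)%:C * q' p) +
  (C1 * ((del p)%:C ^+ 2 * ((k p)^*%C * k' p - W1^*%C * W1)) + rest s p)))).
  move=> p _; rewrite /scaled_det -/(h p) -/(h' p) -/(k p) -/(k' p).
  have qE : q (hs s) p = (zeta p + hs s 1%N) * W1 + g * W2s by [].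
  have qE' : q' p = (zeta p - hs s 1%N) * W1 + g * W2s by [].
  rewrite -qE -qE'.
  have -> : (h p - (del p)%:C * q (hs s) p)^*%C = (h p)^*%C - (del p)%:C * (q (hs s) p)^*%C.
    rewrite rmorphB rmorphM /=; congr (_ - _ * _).
    by apply/eqP; rewrite eq_complex /= oppr0 !eqxx.
  clear qE qE'; move: (h p) (h' p) (k p) (k' p) (q (hs s) p) (q' p) (rest s p) => *; ring.
have Oh eta : O 1 (hd (fun i => i) eta).
  apply: (@eq_isO _ _ _ _ _ _ (fun p => (hd (fun i => i) eta p - (del p)%:C * q eta p) +
      (del p)%:C * q eta p)); first by move=> p _; rewrite subrK.
  apply: isOD; first by exact: (@Ole 1 2 _ _ (hdet_near eta)).
  by rewrite -[1%N]addn0; apply: OM => //; apply: isO_delta.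
apply: isOD; [|apply: isOD; [|apply: isOD]].
- rewrite -[3%N]/(1 + 2)%N; apply: OM; first exact: isO_conj (Oh _).
  exact: hdet_near.
- rewrite -[3%N]/(2 + (1 + 0))%N; apply: OM; first exact: isO_conj (hdet_near _).
  by apply: OM; [exact: isO_delta del01'|exact: Oq].
- apply: OZ; rewrite -[3%N]/(2 + 1)%N; apply: OM; first exact: isO_deltaX.
  apply: isO_mulB => //; try exact: isO_cst; try exact: isO_hdet.
  + by apply: isO_conj; apply: isO_hdet.
  + apply: (@eq_isO _ _ _ _ _ _ (fun p => (k p - W1)^*%C)).
      by move=> p _; rewrite rmorphB.
    by apply: isO_conj; apply: top_shift_near.
  + exact: top_shift_near.
- exact: Ole (isO_rest s).
Qed.

End Near.

End Asymptotics.

(** * From the determinants to the solution *)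

Section Bounds.
Variable R : realType.
Local Notation C := R[i].
Local Notation Re := complex.Re.
Local Notation Im := complex.Im.

Lemma modC_ge_Re (z : C) : `|Re z| <= modC z.
Proof. by case: z => a b /=; rewrite -sqrtr_sqr ler_wsqrtr // lerDl sqr_ge0. Qed.

Lemma modC_ge_Im (z : C) : `|Im z| <= modC z.
Proof. by case: z => a b /=; rewrite -sqrtr_sqr ler_wsqrtr // lerDr sqr_ge0. Qed.

Lemma dist2_le (x t x' t' : R) : dist2 x t x' t' <= `|x - x'| + `|t - t'|.
Proof.
rewrite /dist2 -[X in _ <= X]ger0_norm ?addr_ge0 // -sqrtr_sqr ler_wsqrtr //.
by rewrite [X in _ <= X]sqrrD !real_normK ?num_real // lerD2r lerDl mulrn_wge0.
Qed.

Lemma dist2_ge (x t x' t' : R) : `|x - x'| + `|t - t'| <= 2 * dist2 x t x' t'.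
Proof.
have le1 : `|x - x'| <= dist2 x t x' t'.
  by rewrite -sqrtr_sqr ler_wsqrtr // lerDl sqr_ge0.
have le2 : `|t - t'| <= dist2 x t x' t'.
  by rewrite -sqrtr_sqr ler_wsqrtr // lerDr sqr_ge0.
by rewrite mulr_natl mulr2n lerD.
Qed.

Lemma seq_min (f : C -> R) (s : seq C) : s != [::] ->
  exists2 z, z \in s & forall w, w \in s -> f z <= f w.
Proof.
elim: s => // a [|b s] IH _.
  by exists a; rewrite ?inE // => w; rewrite inE => /eqP ->.
have [//|z zs zmin] := IH; have [az|za] := leP (f a) (f z).
  exists a; rewrite ?mem_head // => w; rewrite in_cons => /orP[/eqP ->//|/zmin].
  exact: le_trans.
exists z; first by rewrite in_cons zs orbT.
move=> w; rewrite in_cons => /orP[/eqP ->|/zmin//].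
exact: ltW.
Qed.

Lemma seq_separated (s : seq C) :
  exists2 eta : R, 0 < eta & forall w, w \in s -> w != 0 -> eta <= modC w.
Proof.
elim: s => [|a s [eta eta0 IH]]; first by exists 1.
exists (Num.min eta (if a == 0 then 1 else modC a)).
  by rewrite lt_min eta0 /=; case: eqP => // /eqP; rewrite -modC_gt0.
move=> w; rewrite inE => /orP[/eqP -> /negPf ->|ws w0].
  by rewrite ge_min lexx orbT.
by rewrite ge_min IH.
Qed.

(* At most one of the points [z * A] is close to [L] on the scale [A + |L|],
   because the [z] are separated. *)
Lemma prod_dist_ge (rs : seq C) : uniq rs -> rs != [::] ->
  exists2 c : R, 0 < c & forall (A : R) (L : C), 0 < A ->
    exists2 z, z \in rs & c * modC (L - z * A%:C) * (A + modC L) ^+ (size rs).-1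
      <= modC (\prod_(w <- rs) (L - w * A%:C)).
Proof.
move=> urs rs0.
have [eta eta0 sep] := seq_separated [seq z - w | z <- rs, w <- rs].
pose M := \sum_(z <- rs) modC z.
have M0 : 0 <= M by apply: sumr_ge0 => z _; apply: modC_ge0.
have Mz z : z \in rs -> modC z <= M.
  by move=> zrs; rewrite /M (big_rem z) //= lerDl sumr_ge0 // => w _; apply: modC_ge0.
(* For q = |L - w A| with w not the nearest root, separation gives A <= (2 / eta) q, and |L| <= q +
   M A; adding, A + |L| <= k q. *)
pose k := 1 + 2 * (M + 1) / eta.
have k0 : 0 < k by rewrite /k ltr_pwDl // divr_ge0 ?(ltW eta0) // mulr_ge0 // addr_ge0.
exists ((k^-1) ^+ (size rs).-1) => [|A L A0]; first by rewrite exprn_gt0 // invr_gt0.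
have [z zrs zmin] := seq_min (fun z => modC (L - z * A%:C)) rs0.
exists z => //; rewrite (big_rem z) //= modCM mulrAC mulrC ler_wpM2l ?modC_ge0 //.
rewrite modC_prod -(size_rem zrs) -exprMn.
have far w : w \in rem z rs -> k^-1 * (A + modC L) <= modC (L - w * A%:C).
  rewrite mem_rem_uniq // inE => /andP[wz wrs].
  rewrite ler_pdivrMl // /k.
  have q := zmin _ wrs; have q0 := modC_ge0 (L - w * A%:C).
  have dA : eta * A <= 2 * modC (L - w * A%:C).
    have : eta <= modC (z - w).
      by apply: sep; [apply: allpairs_f|rewrite subr_eq0 eq_sym].
    rewrite -(ler_pM2r A0) => /le_trans; apply.
    have -> : modC (z - w) * A = modC ((L - w * A%:C) - (L - z * A%:C)).
      by rewrite -[A in LHS](ger0_norm (ltW A0)) -modC_real -modCM; congr modC; ring.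
    by apply: (le_trans (modCB _ _)); rewrite [2 * _]mulr_natl mulr2n lerD.
  have Lle : modC L <= modC (L - w * A%:C) + M * A.
    have {1}-> : L = (L - w * A%:C) + w * A%:C by rewrite subrK.
    apply: (le_trans (modCD _ _)); rewrite lerD2l modCM modC_real (ger0_norm (ltW A0)).
    by rewrite ler_wpM2r ?(ltW A0) // Mz.
  have A1 : A <= 2 / eta * modC (L - w * A%:C).
    by rewrite mulrAC ler_pdivlMr // mulrC.
  have MA := ler_wpM2l M0 A1.
  apply: (le_trans (lerD A1 (le_trans Lle (lerD (lexx _) MA)))).
  by rewrite le_eqVlt; apply/orP; left; apply/eqP; field; rewrite gt_eqF.
have kA0 : 0 <= k^-1 * (A + modC L).
  by rewrite mulr_ge0 ?invr_ge0 ?(ltW k0) // addr_ge0 ?modC_ge0 // ltW.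
elim: (rem z rs) far => [|w s IH] far; first by rewrite big_nil.
rewrite big_cons exprS; apply: ler_pM => //; first exact: exprn_ge0.
  by apply: far; rewrite mem_head.
by apply: IH => v vs; apply: far; rewrite inE vs orbT.
Qed.

Lemma isO_ratio (T : Type) (D : T -> Prop) (del : T -> R) (n0 n1 E0 E1 : T -> C) (c : R) :
  (forall p, D p -> 0 <= del p <= 1) -> 0 < c ->
  (forall p, D p -> c <= modC (n0 p)) ->
  isO D del 0 n0 -> isO D del 0 n1 -> isO D del 1 E0 -> isO D del 1 E1 ->
  exists2 KM : R * R, 0 < KM.1 /\ 0 < KM.2 & forall p, D p -> KM.2 * del p <= 1 ->
    modC ((n1 p + E1 p) / (n0 p + E0 p) - n1 p / n0 p) <= KM.1 * del p.
Proof.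
move=> del01 c0 cn O0 O1 OE0 OE1.
have Odiff : isO D del 1 (fun p => E1 p * n0 p - n1 p * E0 p).
  apply: isOB; last exact: isOM0.
  by rewrite -[1%N]addn0; apply: isOM.
have [K0 K00 E0P] := isO_pos del01 OE0.
have [K K_0 KP] := isO_pos del01 Odiff.
(* The threshold 2 K0 / c keeps |E0| <= c / 2, so the perturbed denominator is at least c / 2 and
   the product of the two denominators at least c^2 / 2. *)
exists (2 * K / c ^+ 2, 2 * K0 / c) => [|p Dp /= small].
  by split=> /=; rewrite divr_gt0 ?mulr_gt0 ?exprn_gt0.
have cp := cn p Dp; have /andP[d0 _] := del01 p Dp.
have n0p : n0 p != 0 by rewrite -modC_gt0 (lt_le_trans c0).
have hE : modC (E0 p) <= c / 2.
  apply: (le_trans (E0P p Dp)); rewrite expr1 ler_pdivlMr // mulrC mulrA.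
  by move: small; rewrite mulrAC ler_pdivrMr // mul1r.
have hD : c / 2 <= modC (n0 p + E0 p).
  have : modC (n0 p) <= modC (n0 p + E0 p) + modC (E0 p).
    by rewrite -{1}(addrK (E0 p) (n0 p)) modCB.
  by move: cp hE; lra.
have D0 : n0 p + E0 p != 0 by rewrite -modC_gt0 (lt_le_trans _ hD) // divr_gt0.
have -> : (n1 p + E1 p) / (n0 p + E0 p) - n1 p / n0 p =
    (E1 p * n0 p - n1 p * E0 p) / ((n0 p + E0 p) * n0 p).
  by field; rewrite n0p D0.
rewrite modCM modCV modCM ler_pdivrMr ?mulr_gt0 ?modC_gt0 //.
apply: (le_trans (KP p Dp)); rewrite expr1.
have : c / 2 * c <= modC (n0 p + E0 p) * modC (n0 p).
  by apply: ler_pM => //; [rewrite divr_ge0 // ltW|exact: ltW].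
have kd : 0 <= 2 * K / c ^+ 2 * del p.
  by rewrite mulr_ge0 // divr_ge0 ?exprn_ge0 ?mulr_ge0 ?ltW.
move=> /(ler_wpM2l kd); apply: le_trans.
by rewrite le_eqVlt; apply/orP; left; apply/eqP; field; rewrite gt_eqF.
Qed.

(** Here P stands for |H| and d for [del]. From Q d <= P both errors are at most a multiple of P^2 /
    Q, so the final bound involves only Q. *)
Lemma ratio_near_one (s0 s1 : C) (P K0 K1 d Q : R) : 0 < d -> 0 < K0 -> 0 < K1 ->
  1 <= Q -> 4 * K0 <= Q -> Q * d <= P ->
  modC (s0 - (P ^+ 2)%:C) <= K0 * (P * d + d ^+ 2) ->
  modC (s1 - (P ^+ 2)%:C) <= K1 * (P * d + d ^+ 2) ->
  modC (s1 / s0 - 1) <= 4 * (K0 + K1) / Q.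
Proof.
move=> d0 K00 K10 Q1 QK QP h0 h1.
have Q0 : 0 < Q by lra.
have P0 : 0 < P by apply: lt_le_trans QP; rewrite mulr_gt0.
have dP : d <= P / Q by rewrite ler_pdivlMr // mulrC.
have dP' : d <= P by apply: le_trans QP; rewrite ler_peMl // ltW.
have small : P * d + d ^+ 2 <= 2 * P ^+ 2 / Q.
  rewrite expr2 -mulrDl; apply: (@le_trans _ _ ((P + P) * (P / Q))).
    by apply: ler_pM => //; [rewrite addr_ge0 // ltW|exact: ltW|rewrite lerD2l].
  by rewrite le_eqVlt; apply/orP; left; apply/eqP; field; rewrite gt_eqF.
have r0 : modC (s0 - (P ^+ 2)%:C) <= K0 * (2 * P ^+ 2 / Q).
  by apply: (le_trans h0); rewrite ler_wpM2l // ltW.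
have r1 : modC (s1 - (P ^+ 2)%:C) <= K1 * (2 * P ^+ 2 / Q).
  by apply: (le_trans h1); rewrite ler_wpM2l // ltW.
have P2 : 0 < P ^+ 2 by rewrite exprn_gt0.
(* The condition 4 K0 <= Q enters here: the error takes away at most half of P^2. *)
have low : P ^+ 2 / 2 <= modC s0.
  have : modC (P ^+ 2)%:C <= modC s0 + modC (s0 - (P ^+ 2)%:C).
    have {1}-> : (P ^+ 2)%:C = s0 - (s0 - (P ^+ 2)%:C) by rewrite subKr.
    exact: modCB.
  rewrite modC_real (ger0_norm (ltW P2)) => hP.
  have : K0 * (2 * P ^+ 2 / Q) <= P ^+ 2 / 2.
    rewrite !mulrA ler_pdivrMr // [_ / 2 * Q]mulrAC ler_pdivlMr //.
    have := ler_wpM2l (ltW P2) QK; lra.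
  by move: hP r0; lra.
have s00 : s0 != 0 by rewrite -modC_gt0 (lt_le_trans _ low) // divr_gt0.
have -> : s1 / s0 - 1 = (s1 - s0) / s0 by rewrite mulrBl divff.
rewrite modCM modCV ler_pdivrMr ?modC_gt0 //.
have -> : s1 - s0 = (s1 - (P ^+ 2)%:C) - (s0 - (P ^+ 2)%:C) by ring.
apply: (le_trans (modCB _ _)); apply: (le_trans (lerD r1 r0)).
have kq : 0 <= 4 * (K0 + K1) / Q by rewrite divr_ge0 ?mulr_ge0 ?addr_ge0 ?ltW.
apply: le_trans (ler_wpM2l kq low).
by rewrite le_eqVlt; apply/orP; left; apply/eqP; field; rewrite gt_eqF.
Qed.

End Bounds.

(** * The linear form Z and the first-order rogue wave expressed in it *)

Section LinearForm.
Variables (R : realType) (n : nat) (lam0 lam1 : R[i]) (chi : nat -> R[i]).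
Local Notation C := R[i].
Local Notation Re := complex.Re.
Local Notation Im := complex.Im.
Local Notation chi0 := (chi0 n lam0).
Local Notation C1 := (C1 n lam0 chi).
Hypotheses (n_ge1 : (1 <= n)%N) (Im_lam0 : Im lam0 != 0) (lam1_neq0 : lam1 != 0).
Hypothesis chiP : chi_expansion n lam0 lam1 chi.

Definition lform (x t : R) : C := 'i%C * chi 1%N * (x%:C + chi0 * t%:C).

Lemma alpha_beta1 x t : alpha n lam0 lam1 chi 1 * x%:C +
  beta n lam0 lam1 chi 1 * 'i%C * t%:C = lform x t.
Proof. by rewrite alpha1 // (beta1 n_ge1 chiP) /lform; ring. Qed.

Lemma lformB x t x' t' : lform (x - x') (t - t') = lform x t - lform x' t'.
Proof. by rewrite /lform !rmorphB; ring. Qed.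

Lemma lformZ a x t : lform (a * x) (a * t) = a%:C * lform x t.
Proof. by rewrite /lform !rmorphM; ring. Qed.

Lemma lform_le : exists2 K : R, 0 < K &
  forall x t, modC (lform x t) <= K * (`|x| + `|t|).
Proof.
exists (modC (chi 1%N) * (1 + modC chi0) + 1) => [|x t].
  by rewrite ltr_wpDl // mulr_ge0 ?addr_ge0 ?modC_ge0.
rewrite /lform !modCM modC_i mul1r.
apply: (@le_trans _ _ (modC (chi 1%N) * (1 + modC chi0) * (`|x| + `|t|))).
  rewrite -mulrA ler_wpM2l ?modC_ge0 //; apply: (le_trans (modCD _ _)).
  rewrite modCM !modC_real mulrDl mul1r; apply: lerD; first by rewrite lerDl.
  by rewrite ler_wpM2l ?modC_ge0 // lerDr.
by rewrite ler_wpM2r ?addr_ge0 // lerDl.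
Qed.

(** As chi_0 is not real, (x, t) -> x + chi_0 t is a real isomorphism: its imaginary part controls
    t, and then its real part controls x. *)
Lemma lform_ge : exists2 K : R, 0 < K &
  forall x t, `|x| + `|t| <= K * modC (lform x t).
Proof.
have e0 := Im_chi0_neq0 n Im_lam0; have c1 := chi1_neq0 Im_lam0 lam1_neq0 chiP.
have m0 : 0 < modC (chi 1%N) by rewrite modC_gt0.
pose K1 := `|Im chi0|^-1 * (1 + `|Re chi0|) + 1.
have K10 : 0 < K1.
  by rewrite ltr_wpDl // mulr_ge0 ?invr_ge0 ?addr_ge0.
exists (K1 / modC (chi 1%N)) => [|x t]; first exact: divr_gt0.
rewrite /lform !modCM modC_i mul1r mulrA divfK ?gt_eqF //.
set X := x%:C + chi0 * t%:C.
have ImX : Im X = Im chi0 * t by rewrite /X /=; ring.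
have ReX : Re X = x + Re chi0 * t by rewrite /X /=; ring.
have t_le : `|t| <= `|Im chi0|^-1 * modC X.
  by rewrite ler_pdivlMl ?normr_gt0 // -normrM -ImX modC_ge_Im.
have x_le : `|x| <= modC X + `|Re chi0| * `|t|.
  have -> : x = Re X - Re chi0 * t by rewrite ReX addrK.
  by apply: (le_trans (ler_normB _ _)); rewrite normrM lerD2r modC_ge_Re.
have := ler_wpM2l (normr_ge0 (Re chi0)) t_le; rewrite /K1; move: x_le t_le; lra.
Qed.

Definition c1r : R := modC (chi 1%N) ^+ 2 / (2 * Im chi0) ^+ 2.

Lemma c1r_gt0 : 0 < c1r.
Proof.
have e0 := Im_chi0_neq0 n Im_lam0; have c1 := chi1_neq0 Im_lam0 lam1_neq0 chiP.
apply: divr_gt0; first by rewrite exprn_gt0 // modC_gt0.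
by rewrite exprn_even_gt0 //= mulf_neq0 ?pnatr_eq0.
Qed.

Lemma C1E : C1 = c1r%:C.
Proof.
rewrite /Defs.C1 /c1r; congr ((_ / _)%:C).
rewrite (chi0_sub_conj n) modCM modC_i mulr1 modC_real.
by rewrite real_normK ?num_real.
Qed.

(** With X = x + chi_0 t and w = chi_0 + b_k, the form is i chi_1 X and h_(2,1) is chi_1 / w. So
    |chi_1|^2 cancels from the quotient and C_1 leaves 1 / (4 (Im chi_0)^2). *)
Lemma qhat1E (k : 'I_n) x t : qhat1 lam0 k x t =
  ((lform x t + h2 lam0 chi k 1%N)^*%C * (lform x t - h2 lam0 chi k 1%N) + C1) /
  ((lform x t)^*%C * lform x t + C1).
Proof.
have e0 := Im_chi0_neq0 n Im_lam0; have c1 := chi1_neq0 Im_lam0 lam1_neq0 chiP.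
have w0 := chi0_add_b_neq0 Im_lam0 k.
rewrite h2_1 C1E /qhat1 /lform modC_sqr.
set X := x%:C + chi0 * t%:C; set w := chi0 + (b_ lam0 k)%:C.
pose d : R := (4 * Im chi0 ^+ 2)^-1.
have c1E : c1r%:C = chi 1%N * (chi 1%N)^*%C * d%:C.
  rewrite -modC_sqr -rmorphM /c1r /d; congr (_%:C); congr (_ / _); ring.
have numE : ((Re chi0 + b_ lam0 k) * (x + Re chi0 * t) - Im chi0 ^+ 2 * t)%:C =
    (X * w + X^*%C * w^*%C) / 2.
  have two0 : (2 : C) != 0 by rewrite pnatr_eq0.
  apply: (mulIf two0); rewrite divfK //; apply/eqP.
  by rewrite eq_complex /=; apply/andP; split; apply/eqP; ring.
have denE : ((x + Re chi0 * t) ^+ 2 + Im chi0 ^+ 2 * t ^+ 2 + d)%:C = X * X^*%C + d%:C.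
  by apply/eqP; rewrite eq_complex /=; apply/andP; split; apply/eqP; ring.
have d0 : 0 < d by rewrite invr_gt0 mulr_gt0 // exprn_even_gt0.
have den0 : X * X^*%C + d%:C != 0.
  rewrite -denE fmorph_eq0 gt_eqF // ltr_wpDl //.
  by apply: addr_ge0; [|apply: mulr_ge0]; exact: sqr_ge0.
have cc (z : C) : (z^*%C == 0) = (z == 0) by rewrite fmorph_eq0.
rewrite -/d numE denE c1E.
have iJ : ('i%C : C)^*%C = - 'i%C by apply/eqP; rewrite eq_complex /= oppr0 !eqxx.
have conjM (a b : C) : (a * b)^*%C = a^*%C * b^*%C by rewrite rmorphM.
have conjV (a : C) : (a^-1)^*%C = (a^*%C)^-1 by rewrite fmorphV.
have conjD (a b : C) : (a + b)^*%C = a^*%C + b^*%C by rewrite rmorphD.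
rewrite conjD !conjM conjV iJ.
have m0 := c1; have m0' := c1; rewrite -cc in m0'.
have w0' := w0; rewrite -cc -/w in w0'; rewrite -/w in w0.
have ii : 'i%C * 'i%C = -1 :> C by rewrite -expr2 sqr_i.
clear numE denE c1E; clearbody X w.
(* Numbers and their conjugates become independent variables; what remains is a rational identity
   that uses only i^2 = -1. *)
move: ('i%C : C) X X^*%C w w^*%C (chi 1%N) (chi 1%N)^*%C d%:C ii den0 m0 m0' w0 w0'.
move=> i X1 X2 w1 w2 m1 m2 dd ii den0 m0 m0' w0 w0'.
have -> : - i * m2 * X2 * (i * m1 * X1) + m1 * m2 * dd = m1 * m2 * (X1 * X2 + dd).
  transitivity (m1 * m2 * (- (i * i) * (X1 * X2) + dd)); first by ring.
  by rewrite ii opprK mul1r.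
have -> : (- i * m2 * X2 + m2 / w2) * (i * m1 * X1 - m1 / w1) + m1 * m2 * dd =
    m1 * m2 * (X1 * X2 + dd + (i * (X1 * w1 + X2 * w2) + i * i) / (w1 * w2)).
  transitivity (m1 * m2 * (- (i * i) * (X1 * X2) + dd +
      (i * (X1 * w1 + X2 * w2) - 1) / (w1 * w2))).
    by field; rewrite w0 w0'.
  by rewrite ii opprK mul1r.
rewrite -[RHS]mulf_div divff ?mulf_neq0 // mul1r [RHS]mulrDl divff //; congr (_ + _).
by field; rewrite den0 w0 w0'.
Qed.

End LinearForm.

Section Estimates.
Variables (R : realType) (n : nat) (Nv : 'I_n -> nat).
Variables (lam0 lam1 : R[i]) (chi : nat -> R[i]) (kappa : 'I_n -> nat -> R[i]).
Variable d : R -> 'I_n -> nat -> R[i].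
Local Notation C := R[i].
Local Notation N := (\sum_(l < n) Nv l)%N.
Local Notation lform := (lform n lam0 chi).
Local Notation C1 := (C1 n lam0 chi).
Local Notation c1r := (c1r n lam0 chi).
Local Notation al := (alpha n lam0 lam1 chi).
Local Notation be := (beta n lam0 lam1 chi).
Local Notation hs := (hshift lam0 chi).
Hypotheses (n_ge1 : (1 <= n)%N) (N_ge1 : (1 <= N)%N).
Hypotheses (Im_lam0 : complex.Im lam0 != 0) (lam1_neq0 : lam1 != 0).
Hypothesis chiP : chi_expansion n lam0 lam1 chi.
Hypothesis dP : forall A, 0 < A -> forall l j, Lambda Nv l j ->
  d A l j = kappa l j * A%:C ^+ j.
Hypothesis d0 : forall A, 0 < A -> forall l j, (1 <= j)%N ->
  d A l (n.+1 * j)%N = 0.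

Lemma modC_q0 (k : 'I_n) x t : modC (q0 lam0 k x t) = `|a_ lam0 k|.
Proof.
by rewrite /q0 modCM modC_real /expi /= cos2Dsin2 sqrtr1 mulr1.
Qed.

Lemma det_ratio (T : Type) (D : T -> Prop) (del A x t : T -> R) (u : T -> C) s p :
  (forall p, D p -> 0 < del p <= 1) -> D p -> 0 < A p ->
  \det (Mmat lam0 lam1 chi Nv (d (A p)) (x p) (t p) s) /
    \det (Mmat lam0 lam1 chi Nv (d (A p)) (x p) (t p) None) =
  scaled_det Nv lam0 lam1 chi kappa del A x t u s p /
    scaled_det Nv lam0 lam1 chi kappa del A x t u None p.
Proof.
move=> del01 Dp A0; have /andP[del0 _] := del01 p Dp.
have e s' := @scaled_detE _ _ _ lam0 lam1 chi kappa N_ge1 _ _ del A x t u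
   del01 (d (A p)) s' p Dp (dP A0) (d0 A0).
have delC : (del p)%:C != 0 by rewrite fmorph_eq0 gt_eqF.
have C10 : C1 != 0 by rewrite C1E fmorph_eq0 gt_eqF // (c1r_gt0 Im_lam0 lam1_neq0 chiP).
set a := (del p)%:C ^+ _ in e; set b := C1 ^+ _ * _ in e.
have a0 : a != 0 by rewrite expf_neq0.
have b0 : b != 0 by rewrite mulf_neq0 // expf_neq0.
have cancel (c y z : C) : c != 0 -> (c * y) / (c * z) = y / z.
  by move=> c0; rewrite -mulf_div divff // mul1r.
by rewrite -[LHS](cancel a) // (e s) (e None) cancel.
Qed.

(** * The solution on a disc around one of the rogue waves *)

Section NearRoot.
Variables (z : C) (xh th : R) (xb tb : R -> R) (r : R).
Hypothesis wr0 : (wr Nv kappa).[z] = 0.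
Let W1 := (wr Nv kappa)^`().[z].
Let W2s := shifted_det kappa (@pbar n Nv) z + shifted_det kappa (@phat n Nv) z.
Let g := al 2 * xh%:C + be 2 * 'i%C * th%:C.
Let Dl := g * (W2s / W1).
Hypothesis W1_neq0 : W1 != 0.
Hypothesis hatP : lform xh th = z.
Hypothesis barP : forall A, 0 < A -> lform (xb A) (tb A) = z * A%:C - Dl.

Let T := (R * R * R)%type.
Let A (p : T) := p.1.1.
Let x (p : T) := p.1.2.
Let t (p : T) := p.2.
Let D (p : T) := 1 <= A p /\ dist2 (x p) (t p) (xb (A p)) (tb (A p)) <= r.
Let del p := (A p)^-1.
Let u (_ : T) := z.

Let A_gt0 p : D p -> 0 < A p.
Proof. by case=> A1 _; apply: lt_le_trans A1. Qed.

Let del01 p : D p -> 0 < del p <= 1.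
Proof. by move=> Dp; rewrite invr_gt0 A_gt0 //= invf_le1 ?A_gt0 //; case: Dp. Qed.

Let del01' p : D p -> 0 <= del p <= 1.
Proof. by move=> /del01 /andP[d0' ->]; rewrite (ltW d0'). Qed.

Let delA p : D p -> del p * A p = 1.
Proof. by move=> Dp; rewrite mulVf // gt_eqF // A_gt0. Qed.

(** [zeta0] is the coordinate around the shifted centre, [zeta] the one around z A; the expansion
    yields [zeta], the limit is expressed in [zeta0]. *)
Let zeta0 p := lform (x p - xb (A p)) (t p - tb (A p)).
Let zeta p := zeta0 p - Dl.

Let zetaE p : D p -> lform (x p) (t p) - z * (A p)%:C = zeta p.
Proof. by move=> Dp; rewrite /zeta /zeta0 lformB barP ?A_gt0 //; ring. Qed.

Let Ozeta0 : isO D del 0 zeta0.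
Proof.
have [K K0 KP] := @lform_le _ n lam0 chi.
exists (K * (2 * r)) => p [A1 pr]; rewrite expr0 mulr1; apply: (le_trans (KP _ _)).
rewrite ler_pM2l //; apply: (le_trans (dist2_ge _ _ _ _)).
by rewrite ler_pM2l.
Qed.

Let Ozeta : isO D del 0 zeta.
Proof. by apply: isOB => //; apply: isO_cst. Qed.

(** Inverting the linear form, (x, t) stays within O(1) of A ([xh], [th]); hence alpha_2 x + beta_2
    i t is A g up to O(1). *)
Let lin_bound : exists K : R, forall p, D p ->
  `|x p - A p * xh| + `|t p - A p * th| <= K.
Proof.
have [K' K'0 zP] := isO_pos del01' Ozeta.
have [K K0 KP] := lform_ge Im_lam0 lam1_neq0 chiP.
exists (K * K') => p Dp; apply: (le_trans (KP _ _)); rewrite ler_pM2l //.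
rewrite lformB lformZ hatP [_ * z]mulrC zetaE //.
by have := zP p Dp; rewrite expr0 mulr1.
Qed.

Let Odx : isO D del 0 (fun p => (x p - A p * xh)%:C).
Proof.
have [K KP] := lin_bound; exists K => p Dp; rewrite expr0 mulr1 modC_real.
by apply: le_trans (KP p Dp); rewrite lerDl.
Qed.

Let Odt : isO D del 0 (fun p => (t p - A p * th)%:C).
Proof.
have [K KP] := lin_bound; exists K => p Dp; rewrite expr0 mulr1 modC_real.
by apply: le_trans (KP p Dp); rewrite lerDr.
Qed.

Let Oscaled (y : T -> R) (yh : R) : isO D del 0 (fun p => (y p - A p * yh)%:C) ->
  isO D del 0 (fun p => (del p * y p)%:C).
Proof.
move=> Oy; apply: (@eq_isO _ _ _ _ _ _ (fun p =>
    yh%:C + (del p)%:C * (y p - A p * yh)%:C)).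
  move=> p Dp; rewrite -rmorphM -rmorphD; congr (_%:C).
  by rewrite mulrBr mulrA delA // mul1r addrC subrK.
apply: isOD; first exact: isO_cst.
apply: (isO_le del01' (leq0n 1)); rewrite -[1%N]addn0.
by apply: (isOM del01') => //; apply: isO_delta.
Qed.

Let OA : isO D del 0 (fun p => (del p * A p)%:C).
Proof. by apply: (eq_isO (g := fun=> 1)) => [p Dp|]; [rewrite delA|exact: isO_cst]. Qed.

Let zetaE' p : D p -> (del p)%:C * (al 1 * (x p)%:C + be 1 * 'i%C * (t p)%:C) - z =
  (del p)%:C * zeta p.
Proof.
move=> Dp; have dA : (del p)%:C * (A p)%:C = 1 by rewrite -rmorphM delA.
by rewrite (alpha_beta1 n_ge1 chiP) -zetaE // mulrBr [_ * (z * _)]mulrCA dA mulr1.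
Qed.

Let Oz : isO D del 1 (fun p =>
  (del p)%:C * (al 1 * (x p)%:C + be 1 * 'i%C * (t p)%:C) - u p).
Proof.
apply: (@eq_isO _ _ _ _ _ _ (fun p => (del p)%:C * zeta p)) => [p Dp|].
  exact: zetaE'.
by rewrite -[1%N]addn0; apply: (isOM del01') => //; apply: isO_delta.
Qed.

Let Og : isO D del 2 (fun p => (del p)%:C ^+ 2 *
  (al 2 * (x p)%:C + be 2 * 'i%C * (t p)%:C) - (del p)%:C * g).
Proof.
apply: (@eq_isO _ _ _ _ _ _ (fun p => (del p)%:C ^+ 2 *
    (al 2 * (x p - A p * xh)%:C + be 2 * 'i%C * (t p - A p * th)%:C))).
  move=> p Dp; have dA : (del p)%:C * (A p)%:C = 1 by rewrite -rmorphM delA.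
  rewrite /g !rmorphB !rmorphM /=.
  transitivity ((del p)%:C ^+ 2 * (al 2 * (x p)%:C + be 2 * 'i%C * (t p)%:C) -
    (del p)%:C * ((del p)%:C * (A p)%:C) * (al 2 * xh%:C + be 2 * 'i%C * th%:C)).
    by rewrite dA mulr1.
  by ring.
rewrite -[2%N]addn0; apply: (isOM del01'); first exact: isO_deltaX.
by apply: isOD; apply: (isOZ del01').
Qed.

Let sd s := scaled_det Nv lam0 lam1 chi kappa del A x t u s.
Let ns (s : option 'I_n) p := (W1^*%C * W1) *
  ((zeta0 p + hs s 1%N)^*%C * (zeta0 p - hs s 1%N) + C1).

Let Osd s : isO D del 1 (fun p => sd s p / (del p)%:C ^+ 2 - ns s p).
Proof.
have [K KP] := @scaled_det_near _ _ Nv lam0 lam1 chi kappa N_ge1 _ D del A x t u del01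
  OA (isO_cst _ _ _) (Oscaled Odx) (Oscaled Odt) Oz z g zeta wr0 (fun _ _ => erefl) delA
  (h1_1 n_ge1 Im_lam0 lam1_neq0 chiP) Ozeta zetaE' Og s.
exists K => p Dp; have /andP[del0 _] := del01 Dp.
have delC : (del p)%:C != 0 by rewrite fmorph_eq0 gt_eqF.
(* By definition g W2s = Delta W', so the second-order shifts turn [zeta] back into [zeta0]. *)
have shift (h : C) : (zeta p + h) * W1 + g * W2s = (zeta0 p + h) * W1.
  by rewrite /zeta /Dl; field.
have -> : sd s p / (del p)%:C ^+ 2 - ns s p = (sd s p - (del p)%:C ^+ 2 *
  (((zeta p + hs s 1%N) * W1 + g * W2s)^*%C * ((zeta p - hs s 1%N) * W1 + g * W2s) +
   C1 * (W1^*%C * W1))) / (del p)%:C ^+ 2.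
  rewrite !shift mulrBl [(del p)%:C ^+ 2 * _]mulrC mulfK ?expf_neq0 //; congr (_ - _).
  by rewrite /ns rmorphM /=; ring.
rewrite modCM modCV modCX modC_real gtr0_norm // ler_pdivrMr ?exprn_gt0 //.
apply: (le_trans (KP p Dp)).
by rewrite le_eqVlt; apply/orP; left; apply/eqP; ring.
Qed.

Let Ons s : isO D del 0 (ns s).
Proof.
apply: (isOZ del01'); apply: isOD; last exact: isO_cst.
apply: (isOM0 del01'); [apply: isO_conj; apply: isOD|apply: isOB] => //; exact: isO_cst.
Qed.

Lemma near_root_estimate (k : 'I_n) : exists2 KM : R * R, 0 < KM.1 /\ 0 < KM.2 &
  forall A x t, 1 <= A -> KM.2 <= A -> dist2 x t (xb A) (tb A) <= r ->
  modC (qN lam0 lam1 chi Nv (d A) k x t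
    - qhat1 lam0 k (x - xb A) (t - tb A) * q0 lam0 k x t) <= KM.1 * A^-1.
Proof.
have c0 := c1r_gt0 Im_lam0 lam1_neq0 chiP.
have w0 : 0 < modC W1 ^+ 2 by rewrite exprn_gt0 // modC_gt0.
have nsE p : ns None p = (modC W1 ^+ 2 * (modC (zeta0 p) ^+ 2 + c1r))%:C.
  rewrite /ns /= addr0 subr0 [_^*%C * W1]mulrC [_^*%C * zeta0 p]mulrC.
  by rewrite -!modC_sqr C1E -rmorphD -rmorphM.
(* The positive constant C_1 keeps the limiting denominator away from zero, even at the centre of
   the wave. *)
have lo p : D p -> modC W1 ^+ 2 * c1r <= modC (ns None p).
  move=> Dp; rewrite nsE modC_real ger0_norm ?mulr_ge0 ?addr_ge0 ?exprn_ge0 ?modC_ge0 ?(ltW c0) //.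
  by rewrite ler_pM2l // lerDr exprn_ge0 ?modC_ge0.
have [[K M] /= [K0 M0] KMP] := isO_ratio del01' (mulr_gt0 w0 c0) lo (Ons None)
  (Ons (Some k)) (Osd None) (Osd (Some k)).
exists ((`|a_ lam0 k| + 1) * K, M) => /= [|A1 x1 t1 A11 MA dr].
  by split=> //; rewrite mulr_gt0 // ltr_wpDl.
pose p : T := (A1, x1, t1).
have Dp : D p by [].
have Ap : 0 < A p := A_gt0 Dp.
have /andP[del0 _] := del01 Dp.
have delC : (del p)%:C ^+ 2 != 0 by rewrite expf_neq0 // fmorph_eq0 gt_eqF.
have Msmall : M * del p <= 1 by rewrite /del ler_pdivrMr // mul1r.
have := KMP p Dp Msmall.
have sub (v : C) (w : C) : v + (w - v) = w by rewrite addrC subrK.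
rewrite !sub.
have -> : sd (Some k) p / (del p)%:C ^+ 2 / (sd None p / (del p)%:C ^+ 2) =
    sd (Some k) p / sd None p.
  have divdiv (v w c : C) : c != 0 -> v / c / (w / c) = v / w.
    by move=> cn0; rewrite invf_div mulrA divfK.
  exact: divdiv.
rewrite -(@det_ratio _ D del A x t u (Some k) p) //.
have -> : ns (Some k) p / ns None p = qhat1 lam0 k (x1 - xb A1) (t1 - tb A1).
  rewrite (qhat1E Im_lam0 lam1_neq0 chiP) /ns -mulf_div divff ?mul1r /=.
    by rewrite addr0 subr0.
  by rewrite mulf_neq0 // fmorph_eq0.
move=> h; rewrite /qN mulrC -mulrBl modCM modC_q0.
apply: (@le_trans _ _ (`|a_ lam0 k| * (K * del p))).
  by rewrite mulrC ler_wpM2l.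
by rewrite mulrA ler_wpM2r ?(ltW del0) // ler_wpM2r ?(ltW K0) // lerDl.
Qed.

End NearRoot.

(** * The plane wave background far from all rogue waves *)

Section Far.
Variable rs : seq C.
Hypotheses (rs_uniq : uniq rs) (rs_size : size rs = GammaN Nv).
Hypothesis wr_rs : wr Nv kappa = (cN Nv kappa)^-1 *: \prod_(z <- rs) ('X - z%:P).

Let T := (R * R * R)%type.
Let A (p : T) := p.1.1.
Let x (p : T) := p.1.2.
Let t (p : T) := p.2.
Let L p := lform (x p) (t p).
Let D (p : T) := 1 <= A p.
Let del p := (A p + modC (L p))^-1.
Let u p := (del p)%:C * L p.

Let A_gt0 p : D p -> 0 < A p.
Proof. exact: lt_le_trans. Qed.

Let B_gt0 p : D p -> 0 < A p + modC (L p).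
Proof. by move=> Dp; rewrite ltr_wpDr ?modC_ge0 ?A_gt0. Qed.

Let del01 p : D p -> 0 < del p <= 1.
Proof.
move=> Dp; rewrite invr_gt0 B_gt0 //= invf_le1 ?B_gt0 //.
by apply: (le_trans Dp); rewrite lerDl modC_ge0.
Qed.

Let O_le_B (y : T -> R) (K : R) : 0 <= K ->
  (forall p, D p -> `|y p| <= K * (A p + modC (L p))) -> isO D del 0 (fun p => (del p * y p)%:C).
Proof.
move=> K0 yP; exists K => p Dp; have /andP[del0 _] := del01 Dp.
rewrite expr0 mulr1 modC_real normrM gtr0_norm // /del mulrC ler_pdivrMr ?B_gt0 //.
exact: yP.
Qed.

Let OA : isO D del 0 (fun p => (del p * A p)%:C).
Proof.
apply: (O_le_B (K := 1)) => // p Dp; rewrite mul1r gtr0_norm ?A_gt0 //.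
by rewrite lerDl modC_ge0.
Qed.

Let Oxt : isO D del 0 (fun p => (del p * x p)%:C) /\
  isO D del 0 (fun p => (del p * t p)%:C).
Proof.
have [K K0 KP] := lform_ge Im_lam0 lam1_neq0 chiP.
by split; apply: (O_le_B (ltW K0)) => p Dp; apply: (@le_trans _ _ (K * modC (L p)));
  rewrite ?ler_wpM2l ?(ltW K0) ?lerDr ?(ltW (A_gt0 Dp)) //;
  apply: le_trans (KP _ _); rewrite ?lerDl ?lerDr.
Qed.

Let Ou : isO D del 0 u.
Proof.
exists 1 => p Dp; have /andP[del0 _] := del01 Dp.
rewrite expr0 mulr1 modCM modC_real gtr0_norm // /del mulrC ler_pdivrMr ?B_gt0 //.
by rewrite mul1r lerDr ltW // A_gt0.
Qed.

Let Oz : isO D del 1 (fun p =>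
  (del p)%:C * (al 1 * (x p)%:C + be 1 * 'i%C * (t p)%:C) - u p).
Proof.
apply: (@eq_isO _ _ _ _ _ _ (fun=> 0)); last exact: isO0.
by move=> p _; rewrite (alpha_beta1 n_ge1 chiP) subrr.
Qed.

Let H p := Hdet (Nv := Nv) kappa (fun i => i) (u p) (del p * A p)%:C.

(** Among the factors |u - z del A| all but one are bounded below, by [prod_dist_ge]; the remaining
    one is del times the distance from Z to some z A. *)
Let H_ge : exists2 c : R, 0 < c & forall p, D p ->
  exists2 z, z \in rs & c * modC (L p - z * (A p)%:C) * del p <= modC (H p).
Proof.
have G0 : (0 < size rs)%N by rewrite rs_size GammaN_gt0.
have rs0 : rs != [::] by rewrite -size_eq0 -lt0n.
have [c c0 cP] := prod_dist_ge rs_uniq rs0.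
have cN0 : 0 < modC (cN Nv kappa)^-1 by rewrite modC_gt0 invr_eq0 cN_neq0.
exists (modC (cN Nv kappa)^-1 * c) => [|p Dp]; first exact: mulr_gt0.
have [z zrs zP] := cP (A p) (L p) (A_gt0 Dp); exists z => //.
have /andP[del0 _] := del01 Dp.
have dB : del p * (A p + modC (L p)) = 1 by rewrite mulVf // gt_eqF // B_gt0.
have dAC : (del p * A p)%:C != 0.
  by rewrite fmorph_eq0 gt_eqF // mulr_gt0 // A_gt0.
have -> : modC (H p) = modC (cN Nv kappa)^-1 *
    (del p ^+ size rs * modC (\prod_(w <- rs) (L p - w * (A p)%:C))).
  rewrite /H (Hdet_roots N_ge1 _ dAC rs_size wr_rs) modCM; congr (_ * _).
  have -> : \prod_(w <- rs) (u p - w * (del p * A p)%:C) =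
      (del p)%:C ^+ size rs * \prod_(w <- rs) (L p - w * (A p)%:C).
    rewrite -[size rs]count_predT -iter_mulr_1 -big_const_seq -big_split /=.
    by apply: eq_bigr => w _; rewrite /u rmorphM /=; ring.
  by rewrite modCM modCX modC_real gtr0_norm.
rewrite -!mulrA ler_pM2l // -[size rs]prednK //.
have -> : c * (modC (L p - z * (A p)%:C) * del p) = del p ^+ (size rs).-1.+1 *
    (c * modC (L p - z * (A p)%:C) * (A p + modC (L p)) ^+ (size rs).-1).
  transitivity (c * modC (L p - z * (A p)%:C) * del p *
      (del p * (A p + modC (L p))) ^+ (size rs).-1).
    by rewrite dB expr1n mulr1 mulrA.
  by rewrite exprMn exprS; ring.
by rewrite ler_pM2l ?exprn_gt0.
Qed.

Lemma far_estimate (k : 'I_n) (e : R) : 0 < e -> exists2 Q : R, 0 < Q &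
  forall A x t, 1 <= A -> (forall z, z \in rs -> Q <= modC (lform x t - z * A%:C)) ->
  modC (qN lam0 lam1 chi Nv (d A) k x t - q0 lam0 k x t) < e.
Proof.
move=> e0; have [Ox Ot] := Oxt.
have [K0 K00 K0P] := scaled_det_far kappa N_ge1 del01 OA Ou Ox Ot Oz None.
have [K1 K10 K1P] := scaled_det_far kappa N_ge1 del01 OA Ou Ox Ot Oz (Some k).
have [c c0 cP] := H_ge.
have a0 : 0 < `|a_ lam0 k| + 1 by rewrite ltr_wpDl.
(* [Q1] makes 4 (K0 + K1) |a_k| / Q smaller than e, where |a_k| is the modulus of the plane wave;
   the extra 1 + 4 K0 serves the conditions of [ratio_near_one]. *)
pose Q1 := 4 * (K0 + K1) * (`|a_ lam0 k| + 1) / e.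
have Q10 : 0 < Q1 by rewrite divr_gt0 // !mulr_gt0 // addr_gt0.
pose Q := 1 + 4 * K0 + Q1.
have Q0 : 0 < Q by rewrite /Q; move: Q10 K00; lra.
exists (Q / c) => [|A1 x1 t1 A11 far]; first exact: divr_gt0.
pose p : T := (A1, x1, t1).
have Dp : D p by [].
have /andP[del0 _] := del01 Dp.
have PQ : Q * del p <= modC (H p).
  have [z zrs] := cP p Dp; apply: le_trans; rewrite ler_pM2r //.
  by have := far z zrs; rewrite ler_pdivrMr // mulrC.
have Q1' : 1 <= Q by rewrite /Q; move: Q10 K00; lra.
have Q4 : 4 * K0 <= Q by rewrite /Q; move: Q10 K00; lra.
have := ratio_near_one del0 K00 K10 Q1' Q4 PQ (K0P p Dp) (K1P p Dp).
rewrite -(@det_ratio _ D del A x t u (Some k) p) //; last exact: A_gt0.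
move=> h; rewrite /qN -[X in _ - X]mulr1 -mulrBr modCM modC_q0.
apply: (@le_lt_trans _ _ (`|a_ lam0 k| * (4 * (K0 + K1) / Q))).
  by rewrite ler_wpM2l.
rewrite mulrA ltr_pdivrMr //; apply: (@lt_trans _ _ (e * Q1)).
  have -> : e * Q1 = 4 * (K0 + K1) * (`|a_ lam0 k| + 1).
    by rewrite /Q1 mulrC divfK // gt_eqF.
  by rewrite mulrC ltr_pM2l ?ltrDl // mulr_gt0 // addr_gt0.
by rewrite ltr_pM2l // /Q; move: K00; lra.
Qed.

End Far.

End Estimates.

(** * Assembly of the count of roots and the two limits *)

Local Open Scope classical_set_scope.
Local Open Scope ring_scope.
Local Open Scope complex_scope.

Theorem theorem3 (R : realType) (n : nat) (Nv : 'I_n -> nat)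
    (lam0 lam1 : R[i]) (chi : nat -> R[i])
    (kappa : 'I_n -> nat -> R[i])
    (d : R -> 'I_n -> nat -> R[i])
    (xhat that : R[i] -> R) (xbar tbar : R[i] -> R -> R)
    (n_ge1 : (1 <= n)%N)
    (N_ge1 : (1 <= \sum_(l < n) Nv l)%N)
    (Im_lam0 : complex.Im lam0 != 0)
    (lam1_neq0 : lam1 != 0)
    (chiP : chi_expansion n lam0 lam1 chi)
    (kappa_neq0 : exists l j, Lambda Nv l j /\ kappa l j != 0)
    (simple_roots : forall z, root (gmam Nv kappa) z ->
       mup z (gmam Nv kappa) = 1%N)
    (dP : forall A, 0 < A -> forall l j, Lambda Nv l j ->
       d A l j = kappa l j * A%:C ^+ j)
    (d0 : forall A, 0 < A -> forall l j, (1 <= j)%N ->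
       d A l (n.+1 * j)%N = 0)
    (hatP : forall z, root (gmam Nv kappa) z ->
       'i%C * chi 1%N * ((xhat z)%:C + chi0 n lam0 * (that z)%:C) = z)
    (barP : forall z, root (gmam Nv kappa) z -> forall A, 0 < A ->
       'i%C * chi 1%N * ((xbar z A)%:C + chi0 n lam0 * (tbar z A)%:C)
       = z * A%:C - Delta Nv kappa lam0 lam1 chi z (xhat z) (that z)) :
  [/\ (exists2 rs : seq R[i], uniq rs & (size rs)%:R = Gamma Nv /\
         forall z, root (gmam Nv kappa) z = (z \in rs)),
      (forall z, root (gmam Nv kappa) z -> forall r : R, 0 < r ->
         exists K : R, \forall A \near +oo,
           forall x t, dist2 x t (xbar z A) (tbar z A) <= r ->
           forall k : 'I_n,
             modC (qN lam0 lam1 chi Nv (d A) k x t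
                   - qhat1 lam0 k (x - xbar z A) (t - tbar z A)
                     * q0 lam0 k x t) <= K * A^-1)
    & (forall e : R, 0 < e ->
         exists D : R, \forall A \near +oo,
           forall x t,
             (forall z, root (gmam Nv kappa) z ->
                D <= dist2 x t (xbar z A) (tbar z A)) ->
             forall k : 'I_n,
               modC (qN lam0 lam1 chi Nv (d A) k x t - q0 lam0 k x t) < e)].
Proof.
have [rs [rs_uniq rs_size rsP wr_rs]] := gmam_roots simple_roots.
have wr0 z : root (gmam Nv kappa) z -> (wr Nv kappa).[z] = 0.
  by rewrite root_gmam // => /rootP.
(* At a root the derivative is a nonzero constant times the product of the differences to the other
   roots, which are distinct from it. *)
have W1 z : root (gmam Nv kappa) z -> (wr Nv kappa)^`().[z] != 0.
  rewrite rsP => zrs; rewrite wr_rs derivZ hornerZ.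
  apply: mulf_neq0; first by rewrite invr_neq0 // cN_neq0.
  rewrite (big_rem z) //= derivM derivXsubC mul1r hornerD hornerM hornerXsubC subrr.
  rewrite mul0r addr0 -rootE root_prod_XsubC.
  by rewrite mem_rem_uniq // inE eqxx.
have DeltaE z : Delta Nv kappa lam0 lam1 chi z (xhat z) (that z) =
    (alpha n lam0 lam1 chi 2 * (xhat z)%:C + beta n lam0 lam1 chi 2 * 'i%C * (that z)%:C) *
    ((shifted_det kappa (@pbar n Nv) z + shifted_det kappa (@phat n Nv) z) /
     (wr Nv kappa)^`().[z]).
  rewrite /Delta /W2 /gmam derivZ hornerZ; congr (_ * _).
  by rewrite -mulf_div divff ?mul1r // cN_neq0.
split.
- exists rs => //; split; last exact: rsP.
  by rewrite rs_size GammaN_rat.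
- move=> z zroot r r0.
  have bar A : 0 < A -> lform n lam0 chi (xbar z A) (tbar z A) = z * A%:C -
      Delta Nv kappa lam0 lam1 chi z (xhat z) (that z) by exact: barP.
  rewrite DeltaE in bar.
  have /choice[KM KMP] (k : 'I_n) : exists KM : R * R, [/\ 0 < KM.1, 0 < KM.2 &
      forall A x t, 1 <= A -> KM.2 <= A -> dist2 x t (xbar z A) (tbar z A) <= r ->
      modC (qN lam0 lam1 chi Nv (d A) k x t - qhat1 lam0 k (x - xbar z A) (t - tbar z A) *
        q0 lam0 k x t) <= KM.1 * A^-1].
    have [KM [? ?] ?] := near_root_estimate n_ge1 N_ge1 Im_lam0 lam1_neq0 chiP dP d0 r
      (wr0 z zroot) (W1 z zroot) (hatP z zroot) bar k.
    by exists KM.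
  (* Sums of positive constants serve as common bounds for the finitely many components. *)
  exists (\sum_k (KM k).1), (1 + \sum_k (KM k).2); split; first exact: num_real.
  move=> A MA x t dr k.
  have M0 : 0 <= \sum_k (KM k).2 by apply: sumr_ge0 => j _; apply: ltW; case: (KMP j).
  have A1 : 1 <= A by lra.
  have Mk : (KM k).2 <= \sum_k (KM k).2.
    by rewrite (bigD1 k) //= lerDl sumr_ge0 // => j _; apply: ltW; case: (KMP j).
  have Kk : (KM k).1 <= \sum_k (KM k).1.
    by rewrite (bigD1 k) //= lerDl sumr_ge0 // => j _; apply: ltW; case: (KMP j).
  have [_ _ h] := KMP k; apply: (le_trans (h A x t A1 _ dr)); first by lra.
  by rewrite ler_wpM2r // invr_ge0; lra.
- move=> e e0.
  have /choice[Q QP] (k : 'I_n) : exists Q : R, 0 < Q /\ forall A x t, 1 <= A ->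
      (forall z, z \in rs -> Q <= modC (lform n lam0 chi x t - z * A%:C)) ->
      modC (qN lam0 lam1 chi Nv (d A) k x t - q0 lam0 k x t) < e.
    have [Q Q0 QP] := far_estimate n_ge1 N_ge1 Im_lam0 lam1_neq0 chiP dP d0
      rs_uniq rs_size wr_rs k e0.
    by exists Q.
  have [K K0 KP] := lform_ge Im_lam0 lam1_neq0 chiP.
  pose Dl z := Delta Nv kappa lam0 lam1 chi z (xhat z) (that z).
  pose DM := \sum_(z <- rs) modC (Dl z).
  pose QM := \sum_k Q k.
  (* [K] converts a distance in the (x, t) plane into a lower bound for the linear form; [DM] pays
     for replacing the centre z A - Delta by z A. *)
  exists (K * (QM + DM)), 1; split; first exact: num_real.
  move=> A A1 x t far k; have [_ h] := QP k; apply: h => [|z zrs]; first exact: ltW.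
  have A0 : 0 < A by lra.
  have zroot : root (gmam Nv kappa) z by rewrite rsP.
  have Dz : modC (Dl z) <= DM.
    by rewrite /DM (big_rem z) //= lerDl sumr_ge0 // => w _; apply: modC_ge0.
  have Qk : Q k <= QM.
    by rewrite /QM (bigD1 k) //= lerDl sumr_ge0 // => j _; apply: ltW; case: (QP j).
  have lb : QM + DM <= modC (lform n lam0 chi x t - (z * A%:C - Dl z)).
    have -> : z * A%:C - Dl z = lform n lam0 chi (xbar z A) (tbar z A).
      by symmetry; exact: barP.
    rewrite -lformB -(ler_pM2l K0); apply: le_trans (KP _ _).
    exact: le_trans (far z zroot) (dist2_le _ _ _ _).
  have : modC (lform n lam0 chi x t - (z * A%:C - Dl z)) <=
      modC (lform n lam0 chi x t - z * A%:C) + modC (Dl z).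
    by rewrite opprB addrCA addrC modCD.
  by move: lb Dz Qk; lra.
Qed.
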